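(* Fix one of the ground state sequences (A) or (B) and $m\in\mathbb Z$. The normally ordered semi-infinite wedges in $\mathcal F_m$ form a basis of the $\mathbb Q(q)$-vector space $\mathcal F_m$. Here a normally ordered semi-infinite wedge is (the image in $\mathcal F_m$ of) $G(c_m)\wedge G(c_{m+1})\wedge\cdots\wedge G(c_{m+r-1})\wedge\overline{|m+r\rangle}$ where $(c_m,c_{m+1},\dots)$ is a sequence in $B_{\mathrm{aff}}$ with $c_s=b^\circ_s$ for all $s\ge m+r$, and $H(c_s\otimes c_{s+1})>0$ for all $s\ge m$.
   Context: Let $\mathfrak g=\widehat{\mathfrak{sl}}_2$, $I=\{0,1\}$, weight lattice $P=\mathbb Z\Lambda_0\oplus\mathbb Z\Lambda_1\oplus\mathbb Z\delta$, coroots $h_0,h_1$ with $\langle h_i,\Lambda_j\rangle=\delta_{ij}$, $\langle h_i,\delta\rangle=0$, central element $c=h_0+h_1$. $U_q(\mathfrak g)$ is the quantum affine algebra over $\mathbb Q(q)$ with generators $e_i,f_i$ ($i\in I$), $q^h$ ($h\in P^*$), $t_i=q^{h_i}$, and coproduct $\Delta(q^h)=q^h\otimes q^h$, $\Delta(e_i)=e_i\otimes1+t_i^{-1}\otimes e_i$, $\Delta(f_i)=f_i\otimes t_i+1\otimes f_i$. $[n]=(q^n-q^{-n})/(q-q^{-1})$; $A\subset\mathbb Q(q)$ is the ring of rational functions regular at $q=0$. Let $J=\{0,1,2\}$. $V_{\mathrm{aff}}$ is the $\mathbb Q(q)$-space with basis $z^av_j$ ($a\in\mathbb Z$, $j\in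 J$), a $U_q(\mathfrak g)$-module via: $\mathrm{wt}(z^av_j)=2(1-j)(\Lambda_1-\Lambda_0)+a\delta$, $q^hz^av_j=q^{\langle h,\mathrm{wt}(z^av_j)\rangle}z^av_j$, $e_1z^av_j=[3-j]z^av_{j-1}$, $f_1z^av_j=[j+1]z^av_{j+1}$, $e_0z^av_j=[j+1]z^{a+1}v_{j+1}$, $f_0z^av_j=[3-j]z^{a-1}v_{j-1}$ (with $v_{-1}=v_3=0$). The operator $z^b$ sends $z^av_j\mapsto z^{a+b}v_j$. The crystal of $V_{\mathrm{aff}}$ is $B_{\mathrm{aff}}=\{z^ab_j\}$ with lower global base $G(z^ab_j)=z^av_j$; the energy function is $H(z^ab_i\otimes z^{a'}b_j)=\min\{i,2-j\}-a+a'$. $N\subset V_{\mathrm{aff}}\otimes V_{\mathrm{aff}}$ is the smallest subspace containing $v_0\otimes v_0$ that is stable under the action of $U_q(\mathfrak g)$ (via $\Delta$) and under the operators $z\otimes z$, $z^{-1}\otimes z^{-1}$, $z\otimes1+1\otimes z$. For $n\ge2$, $N_n=\sum_{r=0}^{n-2}V_{\mathrm{aff}}^{\otimes r}\otimes N\otimes V_{\mathrm{aff}}^{\otimes(n-r-2)}$, $\bigwedge^nV_{\mathrm{aff}}:=V_{\mathrm{aff}}^{\otimes n}/N_n$, and $L(\bigwedge^nV_{\mathrm{aff}})$ is the image of the $A$-lattice spanned by all $G(c_1)\otimes\cdots\otimes G(c_n)$, $c_r\in B_{\mathrm{aff}}$. Ground state sequences: (A) $b^\circ_m=zb_2$ for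 $m$ even, $b^\circ_m=b_0$ for $m$ odd; (B) $b^\circ_m=b_1$ for all $m$. Put $v^\circ_m=G(b^\circ_m)$. The pre-Fock space $\bar{\mathcal F}_m$ is the inductive limit of the spaces $\bigwedge^rV_{\mathrm{aff}}$ ($r\ge0$) along the maps $u\mapsto u\wedge v^\circ_{m+r}$; the image of $u\in\bigwedge^rV_{\mathrm{aff}}$ is written $u\wedge\overline{|m+r\rangle}$ (the formal semi-infinite wedge $u\wedge v^\circ_{m+r}\wedge v^\circ_{m+r+1}\wedge\cdots$), and $\overline{|m\rangle}$ is the image of $1\in\bigwedge^0V_{\mathrm{aff}}=\mathbb Q(q)$. $L(\bar{\mathcal F}_m)$ is the $A$-span of the images of the $L(\bigwedge^rV_{\mathrm{aff}})$. The Fock space is $\mathcal F_m=\bar{\mathcal F}_m/\bigcap_{n>0}q^nL(\bar{\mathcal F}_m)$, $|m\rangle$ is the image of $\overline{|m\rangle}$, $L(\mathcal F_m)$ is the image of $L(\bar{\mathcal F}_m)$, and $\mathcal F_m$ carries the $q$-adic topology with neighborhood basis of $0$ given by $\{q^nL(\mathcal F_m)\}_{n\ge0}$. *)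

(* Defs.v *)
From mathcomp Require Import all_boot all_algebra.
From Stdlib Require List.
Set Implicit Arguments.
Unset Strict Implicit.
Unset Printing Implicit Defensive.
Import GRing.Theory Num.Theory.
Local Open Scope ring_scope.

Notation K := {fraction {poly rat}}.
Notation tofracQ := (@FracField.tofrac {poly rat}).
Definition q : K := tofracQ 'X.
Definition qint (n : int) : K := (q ^ n - q ^ (- n)) / (q - q^-1).
Definition inA (f : K) : Prop :=
  exists p r : {poly rat}, r.[0] != 0 /\ f = tofracQ p / tofracQ r.

(* Basis of V_aff : the key (a, j) stands for z^a v_j (crystal z^a b_j)*)
Definition key := (int * 'I_3)%type.
Definition mk (a : int) (j : nat) : key := (a, inord j).
Definition kj (k : key) : nat := nat_of_ord k.2.
Definition zsh (b : int) (k : key) : key := (k.1 + b, k.2).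

(* P^* : h is given by its values (<h,Lambda_0>, <h,Lambda_1>), <h,delta> *)
Definition hP := ((int * int) * int)%type.
Definition hh0 : hP := ((1, 0), 0).
Definition hh1 : hP := ((0, 1), 0).
(* <h, wt(z^a v_j)>  with  wt(z^a v_j) = 2(1-j)(Lambda_1 - Lambda_0) + a delta *)
Definition pairh (h : hP) (k : key) : int :=
  2 * (1 - Posz (kj k)) * (h.1.2 - h.1.1) + k.1 * h.2.

(* action of e_i, f_i on a basis vector: None = 0, Some (c, k') = c * k' *)
Definition opE1 (k : key) : option (K * key) :=
  if (1 <= kj k)%N then Some (qint (Posz (3 - kj k)), mk k.1 (kj k).-1) else None.
Definition opF1 (k : key) : option (K * key) :=
  if (kj k <= 1)%N then Some (qint (Posz (kj k).+1), mk k.1 (kj k).+1) else None.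
Definition opE0 (k : key) : option (K * key) :=
  if (kj k <= 1)%N then Some (qint (Posz (kj k).+1), mk (k.1 + 1) (kj k).+1) else None.
Definition opF0 (k : key) : option (K * key) :=
  if (1 <= kj k)%N then Some (qint (Posz (3 - kj k)), mk (k.1 - 1) (kj k).-1) else None.

(* Vectors of the tensor algebra: coefficient functions on words of    *)
(* basis keys; V_aff^{(x) n} = finitely supported ones on length-n     *)
(* words.  Finite formal combinations are lists.                       *)
Definition vec := seq key -> K.
Definition lvec := seq (K * seq key).
Definition coef (v : lvec) : vec :=
  fun s => \sum_(p <- v) (if p.2 == s then p.1 else 0).
Definition vzero : vec := fun _ => 0.
Definition vadd (f g : vec) : vec := fun s => f s + g s.
Definition vscale (c : K) (f : vec) : vec := fun s => c * f s.
Definition vsum (l : seq vec) : vec := foldr vadd vzero l.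
Definition veq (f g : vec) : Prop := forall s, f s = g s.

Definition inVr (r : nat) (u : vec) : Prop :=
  exists l : lvec, all (fun p => size p.2 == r) l /\ veq u (coef l).

Definition op2 := key -> key -> lvec.
Definition opt_list (o : option (K * key)) (f : K * key -> K * seq key) : lvec :=
  if o is Some x then [:: f x] else [::].
(* Delta(e_i) = e_i (x) 1 + t_i^{-1} (x) e_i *)
Definition DE (e : key -> option (K * key)) (h : hP) : op2 := fun k1 k2 =>
  opt_list (e k1) (fun x => (x.1, [:: x.2; k2])) ++
  opt_list (e k2) (fun x => (q ^ (- pairh h k1) * x.1, [:: k1; x.2])).
(* Delta(f_i) = f_i (x) t_i + 1 (x) f_i *)
Definition DF (f : key -> option (K * key)) (h : hP) : op2 := fun k1 k2 =>
  opt_list (f k1) (fun x => (x.1 * q ^ (pairh h k2), [:: x.2; k2])) ++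
  opt_list (f k2) (fun x => (x.1, [:: k1; x.2])).
(* Delta(q^h) = q^h (x) q^h *)
Definition DQ (h : hP) : op2 := fun k1 k2 =>
  [:: (q ^ (pairh h k1 + pairh h k2), [:: k1; k2])].
Definition Dzz : op2 := fun k1 k2 => [:: (1, [:: zsh 1 k1; zsh 1 k2])].
Definition Dzizi : op2 := fun k1 k2 => [:: (1, [:: zsh (-1) k1; zsh (-1) k2])].
Definition Dzsum : op2 := fun k1 k2 =>
  [:: (1, [:: zsh 1 k1; k2]); (1, [:: k1; zsh 1 k2])].

Definition apply2 (X : op2) (v : lvec) : lvec :=
  flatten [seq (if p.2 is [:: k1; k2] then [seq (p.1 * r.1, r.2) | r <- X k1 k2]
                else [::]) | p <- v].

Definition subspace (S : vec -> Prop) : Prop :=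
  S vzero /\ (forall f g, S f -> S g -> S (vadd f g)) /\
  (forall c f, S f -> S (vscale c f)) /\
  (forall f g, veq f g -> S f -> S g).
Definition in_VV (f : vec) : Prop := inVr 2 f.
Definition stable2 (S : vec -> Prop) (X : op2) : Prop :=
  forall v : lvec, S (coef v) -> S (coef (apply2 X v)).
Definition v0key : key := mk 0 0.

Definition N_candidate (S : vec -> Prop) : Prop :=
  [/\ subspace S, (forall f, S f -> in_VV f),
      S (coef [:: (1, [:: v0key; v0key])]),
      (forall h, stable2 S (DQ h)) &
      [/\ stable2 S (DE opE0 hh0), stable2 S (DE opE1 hh1),
          stable2 S (DF opF0 hh0), stable2 S (DF opF1 hh1) &
          [/\ stable2 S Dzz, stable2 S Dzizi & stable2 S Dzsum]]].
Definition Nsp (f : vec) : Prop := forall S, N_candidate S -> S f.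

(* N_n = sum_r V^{(x) r} (x) N (x) V^{(x) (n-r-2)} *)
Definition ins (t : seq key) (y : vec) (t' : seq key) : vec := fun s =>
  if (take (size t) s == t) && (drop (size t + 2) s == t')
  then y (take 2 (drop (size t) s)) else 0.
Record Ngen := { ncoef : K; nleft : seq key; nmid : vec; nright : seq key }.
Definition Nn (n : nat) (x : vec) : Prop :=
  exists l : seq Ngen,
    List.Forall (fun p => Nsp (nmid p) /\ (size (nleft p) + 2 + size (nright p))%N = n) l /\
    veq x (vsum [seq vscale (ncoef p) (ins (nleft p) (nmid p) (nright p)) | p <- l]).

Inductive gseq := GA | GB.
Definition bgs (g : gseq) (s : int) : key :=
  match g with
  | GA => if odd (absz s) then mk 0 0 else mk 1 2
  | GB => mk 0 1
  end.
Definition vtail (g : gseq) (m : int) (r k : nat) : seq key :=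
  [seq bgs g (m + Posz (r + i)) | i <- iota 0 k].
(* image of u in level R >= r: u (x) v°_{m+r} (x) ... (x) v°_{m+R-1} *)
Definition lift (g : gseq) (m : int) (r R : nat) (u : vec) : vec := fun s =>
  u (take r s) * (drop r s == vtail g m r (R - r))%:R.

(* an element of the pre-Fock space given as a finite combination of
   images of elements of the various wedge^r V_aff: entries (c, (r, u)) *)
Definition fterm := seq (K * (nat * vec)).
Definition levels_le (R : nat) (t : fterm) : bool := all (fun p => (p.2.1 <= R)%N) t.
Definition evalF (g : gseq) (m : int) (R : nat) (t : fterm) : vec :=
  vsum [seq vscale p.1 (lift g m p.2.1 R p.2.2) | p <- t].
Definition scaleF (c : K) (t : fterm) : fterm := [seq (c * p.1, p.2) | p <- t].
(* equality in the inductive limit \bar F_m *)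
Definition barF_eq (g : gseq) (m : int) (t1 t2 : fterm) : Prop :=
  exists R : nat, levels_le R t1 /\ levels_le R t2 /\
    Nn R (vadd (evalF g m R t1) (vscale (-1) (evalF g m R t2))).

(* L(wedge^r V_aff) lifted: A-span of the G(c_1)(x)...(x)G(c_r) *)
Definition latt (r : nat) (w : vec) : Prop :=
  exists l : lvec, List.Forall (fun p => inA p.1 /\ size p.2 = r) l /\ veq w (coef l).
(* y is (a representative of) an element of L(\bar F_m): an A-linear
   combination of images of elements of the L(wedge^r V_aff) *)
Definition inLterm (y : fterm) : Prop :=
  List.Forall (fun p => inA p.1 /\ latt p.2.1 p.2.2) y.
(* t is zero in F_m, i.e. t lies in  \bigcap_{n>0} q^n L(\bar F_m) *)
Definition Fock_zero (g : gseq) (m : int) (t : fterm) : Prop :=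
  forall n : nat, (0 < n)%N ->
    exists y : fterm, inLterm y /\ barF_eq g m t (scaleF (q ^+ n) y).
Definition Fock_eq (g : gseq) (m : int) (t1 t2 : fterm) : Prop :=
  Fock_zero g m (t1 ++ scaleF (-1) t2).

Definition energy (k k' : key) : int :=
  Posz (minn (kj k) (2 - kj k')) - k.1 + k'.1.
(* c : nat -> key encodes (c_m, c_{m+1}, ...) via c i = c_{m+i} *)
Definition normal_seq (g : gseq) (m : int) (c : nat -> key) (r : nat) : Prop :=
  (forall i : nat, (r <= i)%N -> c i = bgs g (m + Posz i)) /\
  (forall i : nat, 0 < energy (c i) (c i.+1)).
(* G(c_m) (x) ... (x) G(c_{m+r-1}), representing in \bar F_m the wedge
   G(c_m) ^ ... ^ G(c_{m+r-1}) ^ |m+r> *)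
Definition wedge (c : nat -> key) (r : nat) : vec :=
  coef [:: (1, [seq c i | i <- iota 0 r])].
Definition wterm (l : seq (K * (nat -> key) * nat)) : fterm :=
  [seq (p.1.1, (p.2, wedge p.1.2 p.2)) | p <- l].

(* Main.v *)
(* Write words z^{a_1} v_{j_1} (x) ... (x) z^{a_n} v_{j_n} with shifted exponents
   a'_i = a_i + k_1 + ... + k_{i-1}, k_l = min(j_l, 2 - j_{l+1}): a word is normally
   ordered iff a' is strictly increasing.  N is the fixed space of the R-matrix R of
   the three-dimensional representation, free over the symmetric Laurent polynomials
   on nine generators z_1^k v_i (x) v_j + O(q), and at q = 0 the operator R merely
   exchanges adjacent shifted exponents.

   Independence: since R satisfies the Yang-Baxter equation, the alternating sum of
   the operators R_w over the symmetric group kills N_n.  Evaluated at positive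
   integers it preserves the lattice, and at q = 0 it sends a word to the alternant
   of its shifted exponents; alternants of distinct increasing exponents are
   independent.

   Spanning: modulo q the relations sort the shifted exponents, so by Nakayama's
   lemma the normally ordered words span each wedge power.  If such a word does not
   continue to a normally ordered semi-infinite wedge, then its last letter wedged
   with the vacuum has a weight which no normally ordered wedge has; sorting modulo q
   shows that it lies in q L, hence in the intersection of the q^n L. *)
Require Import Defs.
From mathcomp Require Import all_boot all_order all_algebra.
From mathcomp Require Import zify ring.
From Stdlib Require Import FunctionalExtensionality.
From Stdlib Require List.
Set Implicit Arguments.
Unset Strict Implicit.
Unset Printing Implicit Defensive.
Import Order.TTheory GRing.Theory Num.Theory.
Local Open Scope ring_scope.

(** * Values at q = 0 *)

(** Integer values of the spectral parameters keep all computations in [K]: the denominators y - q^2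
    x and y - q^4 x become units of A, and there are enough points to recover a Laurent polynomial
    from its values. Since R exchanges the parameters, all specialisations must be kept at once;
    this is why a tensor is turned into a function of the list of its (parameter, index) pairs.
    Independence has to survive the quotient by the intersection of the q^n L, so it is proved
    q-adically: each stage shows the coefficients divisible by one more power of q. Nakayama's lemma
    needs a finite set of words although the tensor powers are infinite dimensional. It is available
    because the relation sorting a pair only creates exponents between the two exponents of that
    pair. Sorting preserves weights, so the remainder of a word of impossible weight again has
    impossible weight and the argument can be iterated. The vacuum tail may have to be lengthened
    each time, so the conclusion is membership in every q^n L and not vanishing at a fixed level. *)

Definition val0 (f : K) (r : rat) : Prop :=
  exists p d : {poly rat}, [/\ d.[0] != 0, f = tofracQ p / tofracQ d & r = p.[0] / d.[0]].

Lemma horner0_neq0 (d : {poly rat}) : d.[0] != 0 -> d != 0.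
Proof. by apply: contraNneq => ->; rewrite horner0. Qed.

Lemma tofrac_horner0_neq0 (d : {poly rat}) : d.[0] != 0 -> tofracQ d != 0.
Proof. by rewrite tofrac_eq0; exact: horner0_neq0. Qed.

Lemma inA_val0 f : inA f -> exists r, val0 f r.
Proof. by case=> p [d [d0 ->]]; exists (p.[0] / d.[0]), p, d. Qed.

Lemma val0_inA f r : val0 f r -> inA f.
Proof. by case=> p [d [d0 -> _]]; exists p, d. Qed.

Lemma val0_poly (p : {poly rat}) : val0 (tofracQ p) p.[0].
Proof. by exists p, 1; rewrite hornerC rmorph1 !divr1 oner_neq0. Qed.

Lemma val0D f g r s : val0 f r -> val0 g s -> val0 (f + g) (r + s).
Proof.
move=> [p [d [d0 -> ->]]] [p' [d' [d0' -> ->]]].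
exists (p * d' + p' * d), (d * d'); split.
- by rewrite hornerM mulf_neq0.
- by rewrite rmorphD !rmorphM addf_div ?tofrac_horner0_neq0.
- by rewrite hornerD !hornerM addf_div.
Qed.

Lemma val0M f g r s : val0 f r -> val0 g s -> val0 (f * g) (r * s).
Proof.
move=> [p [d [d0 -> ->]]] [p' [d' [d0' -> ->]]].
exists (p * p'), (d * d'); split.
- by rewrite hornerM mulf_neq0.
- by rewrite !rmorphM mulf_div.
- by rewrite !hornerM mulf_div.
Qed.

(** This makes [val0] a partial function; its domain is A, and there it is a ring morphism to the
    rationals. *)
Lemma val0_uniq f r s : val0 f r -> val0 f s -> r = s.
Proof.
move=> [p [d [d0 -> ->]]] [p' [d' [d0' /eqP h ->]]].
move: h; rewrite eqr_div ?tofrac_horner0_neq0 // -!rmorphM tofrac_eq => /eqP h.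
by apply/eqP; rewrite eqr_div // -!hornerM h.
Qed.

Lemma val0_nat n : val0 n%:R n%:R.
Proof.
have := val0_poly (n%:R : {poly rat}).
by rewrite rmorph_nat -[(n%:R : {poly rat})](rmorph_nat (@polyC rat)) hornerC.
Qed.

Lemma val00 : val0 0 0. Proof. exact: (val0_nat 0). Qed.
Lemma val01 : val0 1 1. Proof. exact: (val0_nat 1). Qed.

Lemma val0N f r : val0 f r -> val0 (- f) (- r).
Proof.
move=> [p [d [d0 -> ->]]]; exists (- p), d.
by rewrite rmorphN hornerN !mulNr.
Qed.

Lemma val0B f g r s : val0 f r -> val0 g s -> val0 (f - g) (r - s).
Proof. by move=> fr gs; apply: val0D => //; apply: val0N. Qed.

Lemma val0X f r n : val0 f r -> val0 (f ^+ n) (r ^+ n).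
Proof.
move=> fr; elim: n => [|n IH]; first by rewrite !expr0; exact: val01.
by rewrite !exprS; exact: val0M.
Qed.

Lemma val0_q : val0 q 0.
Proof. by have := val0_poly 'X; rewrite hornerX. Qed.

Lemma val0V f r : r != 0 -> val0 f r -> val0 f^-1 r^-1.
Proof.
move=> r0 [p [d [d0 fE rE]]]; move: r0; rewrite fE rE => r0; exists d, p.
rewrite !invf_div; split=> //; apply: contraNneq r0 => ->.
by rewrite mul0r.
Qed.

Lemma val0_neq0 f r : r != 0 -> val0 f r -> f != 0.
Proof.
move=> r0 fr; apply: contraNneq r0 => f0; apply/eqP.
by apply: val0_uniq fr _; rewrite f0; exact: val00.
Qed.

Lemma val0_eq0 f : val0 f 0 <-> exists2 g, inA g & f = q * g.
Proof.
split=> [[p [d [d0 -> rE]]]|[g /inA_val0[r gr] ->]]; last first.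
  by rewrite -(mul0r r); exact: val0M val0_q gr.
have : root p 0.
  rewrite /root; move/esym/eqP: rE; rewrite mulf_eq0 invr_eq0 (negbTE d0) orbF.
  by [].
case/factor_theorem => p'; rewrite subr0 => ->.
exists (tofracQ p' / tofracQ d); first by exists p', d.
by rewrite rmorphM mulrAC mulrC.
Qed.

Lemma inAD f g : inA f -> inA g -> inA (f + g).
Proof.
by move=> /inA_val0[r fr] /inA_val0[s gs]; exact: val0_inA (val0D fr gs).
Qed.

Lemma inAM f g : inA f -> inA g -> inA (f * g).
Proof.
by move=> /inA_val0[r fr] /inA_val0[s gs]; exact: val0_inA (val0M fr gs).
Qed.

Lemma inAN f : inA f -> inA (- f).
Proof. by move=> /inA_val0[r fr]; exact: val0_inA (val0N fr). Qed.

Lemma inA_nat n : inA n%:R.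
Proof. exact: val0_inA (val0_nat n). Qed.

Lemma inA_q : inA q.
Proof. exact: val0_inA val0_q. Qed.

Lemma inAX f n : inA f -> inA (f ^+ n).
Proof. by move=> /inA_val0[r fr]; exact: val0_inA (val0X n fr). Qed.

Lemma inA_sum I (s : seq I) (f : I -> K) : (forall i, inA (f i)) -> inA (\sum_(i <- s) f i).
Proof.
move=> fA; elim: s => [|i s IH]; first by rewrite big_nil; exact: (inA_nat 0).
by rewrite big_cons; exact: inAD.
Qed.

Lemma q_neq0 : q != 0 :> K.
Proof. by rewrite /q tofrac_eq0 polyX_eq0. Qed.

Lemma frac_numden (R : idomainType) (f : {fraction R}) :
  exists p d, d != 0 /\ f = FracField.tofrac p / FracField.tofrac d.
Proof.
elim/quotW: f => r; exists (frac r).1, (frac r).2; split; first exact: denom_ratioP.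
have d0 := denom_ratioP r.
rewrite !piE /= /FracField.invf /FracField.mulf !numden_Ratio ?oner_neq0 //.
rewrite mul1r mulr1.
by rewrite FracField.Ratio_numden.
Qed.

Lemma clear_denominator (f : K) : exists n, inA (q ^+ n * f).
Proof.
have [p [d [d0 ->]]] := frac_numden f.
have [n [d' d'0 dE]] := multiplicity_XsubC d 0; exists n.
exists p, d'; split; first by move: d'0; rewrite d0.
rewrite dE subr0 rmorphM rmorphXn invfM mulrCA; congr (_ * _).
by rewrite mulrCA mulfV ?mulr1 // expf_neq0 // q_neq0.
Qed.

(** A is q-adically separated: denominators are prime to X, so X^(size p) would have to divide the
    numerator p itself, which is impossible by degree. Both the independence proof and Nakayama's
    lemma end here. *)
Lemma val0_divisible f : inA f -> (forall n, exists2 g, inA g & f = q ^+ n * g) -> f = 0.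
Proof.
move=> [p [d [d0 ->]]] div.
suff -> : p = 0 by rewrite rmorph0 mul0r.
apply/eqP; apply: contraT => p0.
have [g [a [b [b0 gE]]] pE] := div (size p).
have : tofracQ (p * b) = tofracQ ('X^(size p) * (a * d)).
  rewrite !rmorphM rmorphXn -/q.
  have := congr1 (fun x => x * (tofracQ d * tofracQ b)) pE; rewrite gE.
  rewrite mulrA mulfVK ?tofrac_horner0_neq0 // => ->.
  rewrite -!mulrA; congr (_ * (_ * _)).
  by rewrite mulrCA mulVf ?mulr1 // tofrac_horner0_neq0.
move/eqP; rewrite tofrac_eq => /eqP h.
have : 'X^(size p) %| p * b by rewrite h dvdp_mulIl.
rewrite Gauss_dvdpl; last first.
  apply: coprimep_expl; rewrite coprimep_sym.
  rewrite (_ : 'X = 'X - 0%:P); last by rewrite subr0.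
  by rewrite coprimep_XsubC.
by move/(dvdp_leq p0); rewrite size_polyXn ltnn.
Qed.

(** * The antisymmetrizer *)

Section LinearCombinations.
Variable (F : comPzRingType).

(** Written as a fold so that explicit lists, such as rows of the R-matrix, reduce to plain sums. *)
Definition lsum (I : Type) (L : seq (F * I)) (f : I -> F) : F :=
  foldr (fun p r => p.1 * f p.2 + r) 0 L.

Lemma lsumE I (L : seq (F * I)) f : lsum L f = \sum_(p <- L) p.1 * f p.2.
Proof. by elim: L => [|p L IH]; rewrite ?big_nil ?big_cons //= IH. Qed.

Lemma lsum_cat I (L L' : seq (F * I)) f : lsum (L ++ L') f = lsum L f + lsum L' f.
Proof. by rewrite !lsumE big_cat. Qed.

Lemma lsumZl I (L : seq (F * I)) f c : lsum L (fun i => c * f i) = c * lsum L f.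
Proof. by rewrite !lsumE mulr_sumr; apply: eq_bigr => p _; rewrite mulrCA. Qed.

Lemma lsum_scale I (L : seq (F * I)) f c :
  lsum [seq (c * p.1, p.2) | p <- L] f = c * lsum L f.
Proof. by rewrite !lsumE big_map mulr_sumr; apply: eq_bigr => p _; rewrite mulrA. Qed.

Lemma lsumD I (L : seq (F * I)) f g :
  lsum L (fun i => f i + g i) = lsum L f + lsum L g.
Proof. by rewrite !lsumE -big_split; apply: eq_bigr => p _; rewrite mulrDr. Qed.

Lemma exchange_lsum I J (L : seq (F * I)) (M : seq (F * J)) (f : I -> J -> F) :
  lsum L (fun i => lsum M (f i)) = lsum M (fun j => lsum L (fun i => f i j)).
Proof.
rewrite !lsumE; under eq_bigr => p _ do rewrite lsumE mulr_sumr.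
rewrite exchange_big; apply: eq_bigr => p _; rewrite lsumE mulr_sumr.
by apply: eq_bigr => r _; rewrite mulrCA.
Qed.

Lemma lsum_map I J (h : J -> I) (L : seq (F * J)) f :
  lsum [seq (p.1, h p.2) | p <- L] f = lsum L (f \o h).
Proof. by rewrite !lsumE big_map. Qed.

Lemma eq_lsum I (L : seq (F * I)) f g : f =1 g -> lsum L f = lsum L g.
Proof. by move=> fg; rewrite !lsumE; apply: eq_bigr => p _; rewrite fg. Qed.

(** Linearity for all finite combinations at once; the empty list gives the value 0 at the zero
    function. *)
Definition linop (S S' : Type) (X : (S -> F) -> S' -> F) : Prop :=
  forall I (L : seq (F * I)) (f : I -> S -> F) s,
    X (fun t => lsum L (f^~ t)) s = lsum L (fun i => X (f i) s).

End LinearCombinations.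

(* An element of V^(x)n depending on n spectral parameters is a function of the
   list of pairs (label of the parameter, index of the component).  Rl x y j k
   lists the nonzero entries of row (j, k) of the R-matrix R(x, y). *)
Section Antisymmetrizer.
Variables (F : comPzRingType) (Rl : nat -> nat -> nat -> nat -> seq (F * (nat * nat))).
Notation pts := (seq (nat * nat)).
Implicit Types (phi : pts -> F) (s : pts).

Fixpoint T (l : nat) phi s : F :=
  match l, s with
  | 0%N, (x, j) :: (y, k) :: s' =>
      lsum (Rl x y j k) (fun jk => phi ((y, jk.1) :: (x, jk.2) :: s'))
  | l'.+1, a :: s' => T l' (fun t => phi (a :: t)) s'
  | _, _ => 0
  end.

Arguments T !l phi !s /.

(** The product T_0 T_1 ... T_(p-1), attached to the cycle between position p and the front. For p =
    0, ..., n these represent the cosets of the permutations fixing the first of n + 1 positions. *)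
Fixpoint U (p : nat) phi : pts -> F :=
  if p is p'.+1 then U p' (T p' phi) else phi.

Definition cosets (n : nat) : seq (F * nat) := [seq ((-1) ^+ p, p) | p <- iota 0 n.+1].

Definition Cop (n : nat) phi s : F := lsum (cosets n) (fun p => U p phi s).

(** The alternating sum over the symmetric group, built coset by coset instead of from reduced
    words. *)
Fixpoint Aop (n : nat) phi s : F :=
  match n, s with
  | 0%N, _ => phi s
  | n'.+1, a :: s' => Aop n' (fun t => Cop n' phi (a :: t)) s'
  | _, [::] => 0
  end.

Lemma lsum0 I (L : seq (F * I)) : lsum L (fun=> 0) = 0.
Proof. by elim: L => //= p L ->; rewrite mulr0 addr0. Qed.

Lemma lsum_cosets n f : lsum (cosets n) f = \sum_(p < n.+1) (-1) ^+ p * f p.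
Proof. by rewrite lsumE big_map -[iota _ _]/(index_iota 0 n.+1) big_mkord. Qed.

Lemma T_lin l : linop (T l).
Proof.
move=> I L f; elim: l f => [|l IH] f [|[x j] [|[y k] s]] //=; rewrite ?lsum0 ?IH //.
by rewrite exchange_lsum.
Qed.

Lemma T_sum l I (L : seq (F * I)) f :
  T l (fun t => lsum L (f^~ t)) = (fun s => lsum L (fun i => T l (f i) s)).
Proof. by apply: functional_extensionality => s; exact: T_lin. Qed.

Lemma T_add l phi psi : T l (fun s => phi s + psi s) = (fun s => T l phi s + T l psi s).
Proof.
pose L := [:: (1 : F, true); (1, false)]; pose f (b : bool) := if b then phi else psi.
have -> : (fun s => phi s + psi s) = (fun s => lsum L (f^~ s)).
  by apply: functional_extensionality => t; rewrite /= !mul1r addr0.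
by rewrite T_sum; apply: functional_extensionality => s; rewrite /= !mul1r addr0.
Qed.

Lemma T_mull l c phi : T l (fun s => c * phi s) = (fun s => c * T l phi s).
Proof.
pose L := [:: (c, tt)]; pose f (b : unit) := phi.
have -> : (fun s => c * phi s) = (fun s => lsum L (f^~ s)).
  by apply: functional_extensionality => t; rewrite /= addr0.
by rewrite T_sum; apply: functional_extensionality => s; rewrite /= addr0.
Qed.

Lemma U_sum p I (L : seq (F * I)) f :
  U p (fun t => lsum L (f^~ t)) = (fun s => lsum L (fun i => U p (f i) s)).
Proof. by elim: p f => //= p IH f; rewrite T_sum IH. Qed.

Lemma Cop_lin n : linop (Cop n).
Proof.
move=> I L f s; rewrite /Cop exchange_lsum.
by apply: eq_lsum => p; rewrite U_sum.
Qed.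

Lemma Aop_lin n : linop (Aop n).
Proof.
move=> I L f s; elim: n s f => [|n IH] [|a s] f //=; rewrite ?lsum0 //.
rewrite -IH; congr Aop; apply: functional_extensionality => t.
exact: Cop_lin.
Qed.

Lemma Aop_add n phi psi s : Aop n (fun s => phi s + psi s) s = Aop n phi s + Aop n psi s.
Proof.
pose L := [:: (1 : F, true); (1, false)]; pose f (b : bool) := if b then phi else psi.
have -> : (fun s => phi s + psi s) = (fun s => lsum L (f^~ s)).
  by apply: functional_extensionality => t; rewrite /= !mul1r addr0.
by rewrite Aop_lin /= !mul1r addr0.
Qed.

Lemma Aop_mull n c phi s : Aop n (fun s => c * phi s) s = c * Aop n phi s.
Proof.
pose L := [:: (c, tt)]; pose f (b : unit) := phi.
have -> : (fun s => c * phi s) = (fun s => lsum L (f^~ s)).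
  by apply: functional_extensionality => t; rewrite /= addr0.
by rewrite Aop_lin /= addr0.
Qed.

Lemma T_far k l phi : (k.+1 < l)%N -> T l (T k phi) = T k (T l phi).
Proof.
elim: k l phi => [|k IH] [|l] // phi kl; apply: functional_extensionality.
  case: l kl => // l _ [|[x j] [|[y k] s]] //=.
  by rewrite T_lin.
by move=> [|a s] //=; rewrite IH.
Qed.

Hypothesis braid0 : forall phi s, T 0 (T 1 (T 0 phi)) s = T 1 (T 0 (T 1 phi)) s.

Lemma T_braid l phi : T l (T l.+1 (T l phi)) = T l.+1 (T l (T l.+1 phi)).
Proof.
elim: l phi => [|l IH] phi; apply: functional_extensionality => s; first exact: braid0.
by case: s => [|a s] //=; rewrite -[LHS]/(T l (T l.+1 (T l _)) s) IH.
Qed.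

Lemma TU_far l p phi : (p < l)%N -> T l (U p phi) = U p (T l phi).
Proof.
elim: p phi => //= p IH phi pl.
by rewrite IH ?(ltnW pl) // T_far.
Qed.

(** The braid relation at the factors T_l T_(l+1) of the cycle turns T_(l+1) into T_l; all other
    factors commute with it. *)
Lemma TU_shift l p phi : (l.+1 < p)%N -> T l.+1 (U p phi) = U p (T l phi).
Proof.
elim: p phi => //= p IH phi; rewrite ltnS leq_eqVlt => /orP[/eqP<-|lp].
  have US f : U l.+1 f = U l (T l f) by [].
  by rewrite !US TU_far // -T_braid.
by rewrite IH // -(T_far _ lp).
Qed.

(* The summands p = l and p = l + 1 of Cop cancel, the others are fixed by some T l'.+1. *)
Lemma Aop_fixed n l phi s : (l.+1 < n)%N -> T l phi = phi -> Aop n phi s = 0.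
Proof.
elim: n l phi s => // n IH l phi [|a s] //= ln fixl.
have -> : (fun t => Cop n phi (a :: t)) = (fun t => lsum (cosets n)
    (fun p => if (p == l) || (p == l.+1) then 0 else U p phi (a :: t))).
  apply: functional_extensionality => t; rewrite /Cop !lsum_cosets.
  have ll1 : Ordinal ln != Ordinal (ltnW ln) by rewrite -val_eqE /= gtn_eqF.
  have splitE (f : nat -> F) : \sum_(p < n.+1) f p = f l + (f l.+1 +
      \sum_(p < n.+1 | (p != Ordinal (ltnW ln)) && (p != Ordinal ln)) f p).
    by rewrite (bigD1 (Ordinal (ltnW ln))) // (bigD1 (Ordinal ln)).
  rewrite [LHS](splitE (fun p => (-1) ^+ p * U p phi (a :: t))).
  rewrite [RHS](splitE (fun p => (-1) ^+ p *
    (if (p == l) || (p == l.+1) then 0 else U p phi (a :: t)))) /= !eqxx orbT fixl exprS mulN1r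
      mulNr !mulr0 !add0r addrA subrr add0r.
  by apply: eq_bigr => p; rewrite -!val_eqE /= => /andP[/negbTE-> /negbTE->].
rewrite (@Aop_lin n _ _ (fun p t => if (p == l) || (p == l.+1) then 0 else U p phi (a :: t))).
rewrite lsumE big_seq big1 // => -[c p] /mapP[p' + [_ ->]] /=.
rewrite mem_iota /= add0n => pn.
have [_|/norP[pl pl1]] := boolP ((p' == l) || (p' == l.+1)); last first.
  have [pltl|lp] := ltnP p' l.
    case: l ln pl pl1 pltl fixl => // l ln pl pl1 pltl fixl.
    rewrite (IH l) ?mulr0 //; apply: functional_extensionality => t.
    by rewrite -[LHS]/(T l.+1 (U p' phi) (a :: t)) TU_far // fixl.
  rewrite (IH l) ?mulr0 //; first by lia.
  apply: functional_extensionality => t.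
  by rewrite -[LHS]/(T l.+1 (U p' phi) (a :: t)) TU_shift ?fixl //; lia.
(* The two cancelled summands have been replaced by the zero function. *)
have := @Aop_lin n unit [::] (fun _ _ => 0) s => /= ->; exact: mulr0.
Qed.

End Antisymmetrizer.

(** * The R-matrix *)

(* The R-matrix of the three-dimensional representation, multiplied by rden: it
   is G(x, y) G(y, x)^-1, where the columns of G are the generators of N over
   the symmetric Laurent polynomials. *)
Section RMatrix.
Variables (F : fieldType) (Q : F) (pt : nat -> F).
Implicit Types (x y : F) (j k : nat).

Definition rden x y : F := (y - Q ^+ 4 * x) * (y - Q ^+ 2 * x).

Definition rinv x y : F := (rden x y)^-1.

Definition rnum x y j k : seq (F * (nat * nat)) :=
  match j, k with
  | 0%N, 0%N | 2%N, 2%N => [:: (rden x y, (j, k))]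
  | 0%N, 1%N | 1%N, 2%N =>
      [:: ((1 - Q ^+ 4) * y * (y - Q ^+ 2 * x), (j, k));
          (Q ^+ 2 * (y - x) * (y - Q ^+ 2 * x), (k, j))]
  | 1%N, 0%N | 2%N, 1%N =>
      [:: ((1 - Q ^+ 4) * x * (y - Q ^+ 2 * x), (j, k));
          (Q ^+ 2 * (y - x) * (y - Q ^+ 2 * x), (k, j))]
  | 0%N, 2%N =>
      [:: ((1 - Q ^+ 2) * (1 - Q ^+ 4) * y ^+ 2, (0%N, 2%N));
          ((Q + Q ^+ 3) * (1 - Q ^+ 4) * y * (y - x), (1%N, 1%N));
          (Q ^+ 2 * (y - x) * (Q ^+ 2 * y - x), (2%N, 0%N))]
  | 1%N, 1%N =>
      [:: (Q ^+ 2 * y ^+ 2 + Q ^+ 4 * x ^+ 2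
           + (1 - Q ^+ 2 *+ 2 - Q ^+ 4 *+ 2 + Q ^+ 6) * x * y, (1%N, 1%N));
          (Q * (1 - Q ^+ 2) * y * (y - x), (0%N, 2%N));
          (Q * (1 - Q ^+ 2) * x * (y - x), (2%N, 0%N))]
  | 2%N, 0%N =>
      [:: ((1 - Q ^+ 2) * (1 - Q ^+ 4) * x ^+ 2, (2%N, 0%N));
          ((Q + Q ^+ 3) * (1 - Q ^+ 4) * x * (y - x), (1%N, 1%N));
          (Q ^+ 2 * (y - x) * (Q ^+ 2 * y - x), (0%N, 2%N))]
  | _, _ => [::]
  end.

Definition Rmx (x y j k : nat) : seq (F * (nat * nat)) :=
  [seq (rinv (pt x) (pt y) * p.1, p.2) | p <- rnum (pt x) (pt y) j k].

Lemma T_braid0 phi s :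
  T Rmx 0 (T Rmx 1 (T Rmx 0 phi)) s = T Rmx 1 (T Rmx 0 (T Rmx 1 phi)) s.
Proof.
case: s => [|[x j] [|[y k] [|[z l] s]]] //=; first exact: lsum0.
rewrite /Rmx.
(* Both sides use each pair of parameters exactly once, hence carry the same product of inverse
   denominators. These can be left free, and what remains are polynomial identities. *)
move: (rinv (pt x) (pt y)) (rinv (pt x) (pt z)) (rinv (pt y) (pt z)) => a b c.
move: (pt x) (pt y) (pt z) => X Y Z.
case: j => [|[|[|j]]]; case: k => [|[|[|k]]]; case: l => [|[|[|l]]] //=.
all: rewrite /rden; ring.
Qed.

End RMatrix.

(** * The R-matrix commutes with the quantum group *)

Section Intertwining.
Variables (F : fieldType) (Q : F) (pt : nat -> F).
Implicit Types (phi : seq (nat * nat) -> F) (s : seq (nat * nat)).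

(* Matrix coefficients of g (x) mu + la (x) g, where g maps the component of
   index tau j to the one of index j with coefficient al x j. *)
Definition coprod (al : F -> nat -> F) (tau : nat -> nat) (la mu : nat -> F) phi s : F :=
  match s with
  | (x, j) :: (y, k) :: s' =>
      al (pt x) j * mu k * phi ((x, tau j) :: (y, k) :: s')
      + la j * al (pt y) k * phi ((x, j) :: (y, tau k) :: s')
  | _ => 0
  end.

(** Matrix entries [2], [1] of e_1 (u = 1) and f_0 (u x = x^-1); [down_coef] serves f_1 and e_0.
    They vanish where the shifted index would leave the range 0, 1, 2. *)
Definition up_coef (u : F -> F) (x : F) (j : nat) : F :=
  match j with 0%N => u x * (Q + Q^-1) | 1%N => u x | _ => 0 end.
Definition down_coef (u : F -> F) (x : F) (j : nat) : F :=
  match j with 1%N => u x | 2%N => u x * (Q + Q^-1) | _ => 0 end.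
(** The eigenvalue of t_1, equivalently of t_0^-1, on v_j. *)
Definition tweight (j : nat) : F :=
  match j with 0%N => Q ^+ 2 | 1%N => 1 | _ => Q ^- 2 end.
Definition tweightV (j : nat) : F :=
  match j with 0%N => Q ^- 2 | 1%N => 1 | _ => Q ^+ 2 end.
Definition one_weight (j : nat) : F := 1.

Hypothesis Q0 : Q != 0.
Hypothesis pt0 : forall x, pt x != 0.

Let T0 := T (Rmx Q pt) 0.

Ltac intertwine x y j k :=
  rewrite /T0 /coprod /Rmx /=;
  move: (rinv Q (pt x) (pt y)) (pt0 x) (pt0 y) => r;
  move: (pt x) (pt y) => X Y X0 Y0;
  case: j => [|[|[|j]]]; case: k => [|[|[|k]]] //=;
  rewrite ?(mulr0, mul0r, addr0) //= /rden /one_weight; field; do ?[apply/andP; split] => //.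

Lemma T_coprodE1 phi s :
  T0 (coprod (up_coef (fun=> 1)) succn tweightV one_weight phi) s =
  coprod (up_coef (fun=> 1)) succn tweightV one_weight (T0 phi) s.
Proof. by case: s => [|[x j] [|[y k] s]] //; intertwine x y j k. Qed.

Lemma T_coprodE0 phi s :
  T0 (coprod (down_coef id) predn tweight one_weight phi) s =
  coprod (down_coef id) predn tweight one_weight (T0 phi) s.
Proof. by case: s => [|[x j] [|[y k] s]] //; intertwine x y j k. Qed.

Lemma T_coprodF1 phi s :
  T0 (coprod (down_coef (fun=> 1)) predn one_weight tweight phi) s =
  coprod (down_coef (fun=> 1)) predn one_weight tweight (T0 phi) s.
Proof. by case: s => [|[x j] [|[y k] s]] //; intertwine x y j k. Qed.

Lemma T_coprodF0 phi s :
  T0 (coprod (up_coef (fun x => x^-1)) succn one_weight tweightV phi) s =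
  coprod (up_coef (fun x => x^-1)) succn one_weight tweightV (T0 phi) s.
Proof. by case: s => [|[x j] [|[y k] s]] //; intertwine x y j k. Qed.

Lemma coprod_lin al tau la mu : linop (coprod al tau la mu).
Proof.
move=> I L f [|[x j] [|[y k] s]] /=; rewrite ?lsum0 //.
by rewrite lsumD !lsumZl.
Qed.

(** The component of the tensor w at the indices listed in s, its i-th variable z being specialised
    at the i-th parameter of s. *)
Fixpoint ev (s : seq (nat * nat)) (w : seq key) : F :=
  match s, w with
  | [::], [::] => 1
  | (x, j) :: s', k :: w' => (if kj k == j then pt x ^ k.1 else 0) * ev s' w'
  | _, _ => 0
  end.

End Intertwining.

(** * The relations are fixed by the R-matrix *)

Definition lscale (c : K) (l : lvec) : lvec := [seq (c * p.1, p.2) | p <- l].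

Definition words_of_size (n : nat) (l : lvec) : bool := all (fun p => size p.2 == n) l.

Lemma coef_lsumE l s : coef l s = lsum l (fun w => (w == s)%:R).
Proof.
by rewrite lsumE; apply: eq_bigr => p _; case: eqP; rewrite ?mulr1 ?mulr0.
Qed.

Lemma coef_cat l l' s : coef (l ++ l') s = coef l s + coef l' s.
Proof. by rewrite !coef_lsumE lsum_cat. Qed.

Lemma coef_scale c l s : coef (lscale c l) s = c * coef l s.
Proof. by rewrite !coef_lsumE lsum_scale. Qed.

Lemma lsum_coef (l : lvec) (X : seq (seq key)) phi :
  uniq X -> {subset [seq p.2 | p <- l] <= X} ->
  lsum l phi = \sum_(w <- X) coef l w * phi w.
Proof.
move=> uX sX; rewrite lsumE; under [RHS]eq_bigr => w _ do rewrite coef_lsumE lsumE mulr_suml.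
rewrite exchange_big /= [RHS]big_seq [LHS]big_seq; apply: eq_bigr => p pl.
have pX : p.2 \in X by apply: sX; apply: map_f.
rewrite (bigD1_seq p.2) //= eqxx mulr1 big1 ?addr0 // => w wp.
by rewrite eq_sym (negbTE wp) mulr0 mul0r.
Qed.

Lemma eq_coef_lsum (l l' : lvec) phi : veq (coef l) (coef l') -> lsum l phi = lsum l' phi.
Proof.
move=> ll'; pose X := undup ([seq p.2 | p <- l] ++ [seq p.2 | p <- l']).
rewrite (@lsum_coef l X) ?undup_uniq //; last by move=> w wl; rewrite mem_undup mem_cat wl.
rewrite (@lsum_coef l' X) ?undup_uniq //; last by move=> w wl; rewrite mem_undup mem_cat wl orbT.
by apply: eq_bigr => w _; rewrite ll'.
Qed.

Lemma lsum_apply2 (X : op2) v phi :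
  lsum (apply2 X v) phi =
  lsum v (fun w => if w is [:: k1; k2] then lsum (X k1 k2) phi else 0).
Proof.
elim: v => //= -[c w] v IH; rewrite /apply2 /= lsum_cat -/(apply2 X v) IH; congr (_ + _).
by case: w => [|k1 [|k2 [|k3 w]]] /=; rewrite ?mulr0 // lsum_scale.
Qed.

(** The shift by one avoids the point 0: z must be invertible, and at q = 0 the denominator of R(x,
    y) becomes the square of the point y, which must be a unit. *)
Definition ptK (x : nat) : K := x.+1%:R.

Lemma ptK_neq0 x : ptK x != 0.
Proof.
rewrite /ptK -(rmorph_nat (@FracField.tofrac {poly rat})) tofrac_eq0.
by rewrite -(rmorph_nat (@polyC rat)) polyC_eq0 pnatr_eq0.
Qed.

Notation evK := (@ev K ptK).
Notation Tq := (T (Rmx q ptK)).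

Definition zdeg (w : seq key) : int := \sum_(k <- w) k.1.

(* q^h with <h, delta> != 0 rescales the spectral parameters; it is compatible
   with their evaluation at integers only in each z-degree separately. *)
Definition evd (d : int) s w : K := if zdeg w == d then evK s w else 0.

(** N is the intersection of all admissible subspaces, so it suffices to see that the space fixed by
    R in each z-degree is one of them. *)
Definition Ninv (f : vec) : Prop :=
  exists l : lvec, [/\ words_of_size 2 l, veq f (coef l) &
    forall d, Tq 0 (fun s => lsum l (evd d s)) = (fun s => lsum l (evd d s))].

(** [e] is the shift of z-degree caused by X, and [D d] describes X on the components of tensors of
    z-degree d. Commutation of [D d] with R then transports fixedness from degree d - e to degree
    d. *)
Lemma stable2_Ninv (X : op2) (e : int)
    (D : int -> (seq (nat * nat) -> K) -> seq (nat * nat) -> K) :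
  (forall k1 k2, all (fun p => (size p.2 == 2) && (zdeg p.2 == k1.1 + k2.1 + e)) (X k1 k2)) ->
  (forall d, linop (D d)) ->
  (forall k1 k2 s, lsum (X k1 k2) (evK s) = D (k1.1 + k2.1) (fun s => evK s [:: k1; k2]) s) ->
  (forall d phi s, Tq 0 (D d phi) s = D d (Tq 0 phi) s) ->
  stable2 Ninv X.
Proof.
move=> X2 Dlin DX TD v [l [l2 vl Tl]].
exists (apply2 X l); split.
- apply/allP => p /flattenP[u /mapP[[c w] /= wl ->]].
  case: w wl => [|k1 [|k2 [|k3 w]]] //= wl /mapP[r rX -> /=].
  by have /allP/(_ _ rX)/andP[] := X2 k1 k2.
- by move=> s; rewrite !coef_lsumE !lsum_apply2; apply: eq_coef_lsum.
move=> d.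
have -> : (fun s => lsum (apply2 X l) (evd d s)) = D (d - e) (fun s => lsum l (evd (d - e) s)).
  apply: functional_extensionality => s; rewrite (Dlin _ _ l (fun w s => evd (d - e) s w)).
  rewrite lsum_apply2 !lsumE !big_seq; apply: eq_bigr => -[c w] /(allP l2) /=.
  case: w => [|k1 [|k2 [|k3 w]]] //= _; congr (_ * _).
  have deg : (zdeg [:: k1; k2] == d - e) = (k1.1 + k2.1 + e == d).
    by rewrite /zdeg !big_cons big_nil addr0 -(inj_eq (addIr e)) subrK.
  (* A word of another z-degree contributes zero to both sides: [D] is applied to the zero function,
     and all its images under X lie in the wrong degree. *)
  rewrite {2}/evd deg; case: eqP => [<-|de]; last first.
    have := Dlin (d - e) unit [::] (fun _ _ => 0) s => /= ->.
    rewrite lsumE big_seq big1 // => p /(allP (X2 k1 k2))/andP[_ /eqP pd].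
    by rewrite /evd pd; case: eqP => // _; rewrite mulr0.
  rewrite addrK -DX !lsumE !big_seq; apply: eq_bigr => p /(allP (X2 k1 k2))/andP[_ /eqP pd].
  by rewrite /evd pd eqxx.
by apply: functional_extensionality => s; rewrite TD Tl.
Qed.

Definition ev1 (x j : nat) (k : key) : K := if kj k == j then ptK x ^ k.1 else 0.

Lemma kj_mk a j : (j < 3)%N -> kj (mk a j) = j.
Proof. by move=> j3; rewrite /kj /mk /= inordK. Qed.

Lemma kj_lt3 k : (kj k < 3)%N.
Proof. exact: ltn_ord. Qed.

Lemma key_eta k : k = mk k.1 (kj k).
Proof. by case: k => a i; rewrite /mk /kj /= inord_val. Qed.

Lemma q2_neq1 : q ^+ 2 != 1 :> K.
Proof.
rewrite /q -(rmorphXn (@FracField.tofrac {poly rat})) -(rmorph1 (@FracField.tofrac {poly rat})).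
rewrite tofrac_eq.
apply/eqP => /(congr1 (fun p : {poly rat} => p`_2)).
by rewrite coefXn coefC /=.
Qed.

Lemma qmqV_neq0 : q - q^-1 != 0 :> K.
Proof.
apply/negP; rewrite subr_eq0 => /eqP h; case/eqP: q2_neq1.
by rewrite expr2 {2}h divff ?q_neq0.
Qed.

Lemma qint1 : qint 1 = 1.
Proof. by rewrite /qint expr1z exprN1 divff // qmqV_neq0. Qed.
Lemma qint2 : qint 2 = q + q^-1.
Proof.
rewrite /qint.
have -> : q ^ 2 = q ^+ 2 by [].
have -> : q ^ (-2) = q^-1 ^+ 2 by rewrite exprVn -exprnN.
by apply: canLR (mulfK qmqV_neq0) _; rewrite mulrC subr_sqr.
Qed.

(** The action of e on one tensor factor, read on evaluated components: component j of the image
    comes from component [tau j]. *)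
Definition site (e : key -> option (K * key)) (al : K -> nat -> K) (tau : nat -> nat) :=
  forall k x j, (if e k is Some r then r.1 * ev1 x j r.2 else 0) = al (ptK x) j * ev1 x (tau j) k.

Ltac site_tac k x j :=
  case: k => a []; rewrite /kj /ev1 /=; case => [|[|[|?]]] ? //=; case: j => [|[|[|j]]] //=;
  rewrite ?kj_mk //= ?qint1 ?qint2 ?mulr0 ?mul0r ?mulr1 ?mul1r
    ?exprzDr ?unitfE ?ptK_neq0 //= ?expr1z ?exprN1.

Lemma site_E1 : site opE1 (up_coef q (fun=> 1)) succn.
Proof. by move=> k x j; rewrite /opE1; site_tac k x j. Qed.
Lemma site_F1 : site opF1 (down_coef q (fun=> 1)) predn.
Proof. by move=> k x j; rewrite /opF1; site_tac k x j. Qed.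
Lemma site_E0 : site opE0 (down_coef q id) predn.
Proof. by move=> k x j; rewrite /opE0; site_tac k x j; first [by rewrite mulrC | by rewrite
  mulrC -mulrA [RHS]mulrC]. Qed.
Lemma site_F0 : site opF0 (up_coef q (fun x => x^-1)) succn.
Proof. by move=> k x j; rewrite /opF0; site_tac k x j; first [by rewrite mulrC | by rewrite
  mulrC -mulrA [RHS]mulrC]. Qed.

Lemma pairh_h1 k : pairh hh1 k = 2 * (1 - Posz (kj k)).
Proof. by rewrite /pairh /= subr0 mulr1 mulr0 addr0. Qed.

Lemma pairh_h0 k : pairh hh0 k = - (2 * (1 - Posz (kj k))).
Proof. by rewrite /pairh /= sub0r mulrN mulr1 mulr0 addr0. Qed.

Lemma q_pairh k : q ^ (2 * (1 - Posz (kj k))) = tweight q (kj k).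
Proof. by have := kj_lt3 k; case: (kj k) => [|[|[|j]]]. Qed.

Lemma q_pairhV k : q ^ (- (2 * (1 - Posz (kj k)))) = tweightV q (kj k).
Proof. by have := kj_lt3 k; case: (kj k) => [|[|[|j]]]. Qed.

Lemma evK_cons2 x j y k s k1 k2 :
  evK ((x, j) :: (y, k) :: s) [:: k1; k2] = ev1 x j k1 * (ev1 y k k2 * evK s [::]).
Proof. by []. Qed.

Lemma ev1_subst (w : nat -> K) x j k : ev1 x j k * w (kj k) = ev1 x j k * w j.
Proof. by rewrite /ev1; case: eqP => [->|]; rewrite ?mul0r. Qed.

Lemma lsum_opt (o : option (K * key)) f phi :
  lsum (opt_list o f) phi = if o is Some r then (f r).1 * phi (f r).2 else 0.
Proof. by case: o => [r|] //=; rewrite addr0. Qed.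

Fact coprod_left_identity (R : comPzRingType) (a b c d e : R) :
  a * b * (c * (d * e)) = c * a * (b * d * e).
Proof. by ring. Qed.

Fact coprod_right_identity (R : comPzRingType) (a b c d e : R) :
  a * b * (c * (d * e)) = a * c * (d * b * e).
Proof. by ring. Qed.

Lemma lsum_DE e h al tau (la : nat -> K) : site e al tau ->
  (forall k, q ^ (- pairh h k) = la (kj k)) -> forall k1 k2 s,
  lsum (DE e h k1 k2) (evK s) =
  coprod ptK al tau la (@one_weight K) (fun s => evK s [:: k1; k2]) s.
Proof.
move=> se lah k1 k2 s; rewrite /DE lsum_cat !lsum_opt.
case: s => [|[x j] [|[y k] s]].
- by case: (e k1) => [?|]; case: (e k2) => [?|]; rewrite ?mulr0 ?addr0.
- by case: (e k1) => [?|]; case: (e k2) => [?|]; rewrite /= ?mulr0 ?addr0.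
rewrite /coprod !evK_cons2 /one_weight mulr1; congr (_ + _).
  rewrite [RHS]mulrA -se; case: (e k1) => [r|]; last by rewrite mul0r.
  exact: (mulrA r.1 (ev1 x j r.2)).
rewrite [RHS]coprod_left_identity -se; case: (e k2) => [r|]; last by rewrite mul0r mulr0.
rewrite -[_.1]/(q ^ (- pairh h k1) * r.1) -[ev _ _ _]/(ev1 x j k1 * (ev1 y k r.2 * evK s [::])).
by rewrite lah coprod_left_identity ev1_subst.
Qed.

Lemma lsum_DF f h al tau (mu : nat -> K) : site f al tau ->
  (forall k, q ^ pairh h k = mu (kj k)) -> forall k1 k2 s,
  lsum (DF f h k1 k2) (evK s) =
  coprod ptK al tau (@one_weight K) mu (fun s => evK s [:: k1; k2]) s.
Proof.
move=> se muh k1 k2 s; rewrite /DF lsum_cat !lsum_opt.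
case: s => [|[x j] [|[y k] s]].
- by case: (f k1) => [?|]; case: (f k2) => [?|]; rewrite ?mulr0 ?addr0.
- by case: (f k1) => [?|]; case: (f k2) => [?|]; rewrite /= ?mulr0 ?addr0.
rewrite /coprod !evK_cons2 /one_weight mul1r; congr (_ + _); last first.
  rewrite [RHS]mulrCA [X in _ = _ * X]mulrA -se; case: (f k2) => [r|]; last by rewrite mul0r
    mulr0.
  rewrite -[_.1]/(r.1) -[ev _ _ _]/(ev1 x j k1 * (ev1 y k r.2 * evK s [::])).
  by rewrite mulrCA !mulrA.
rewrite [RHS]coprod_right_identity -se; case: (f k1) => [r|]; last by rewrite !mul0r.
rewrite -[_.1]/(r.1 * q ^ pairh h k2) -[ev _ _ _]/(ev1 x j r.2 * (ev1 y k k2 * evK s [::])).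
by rewrite muh coprod_right_identity ev1_subst.
Qed.

Lemma deg_DE (e : key -> option (K * key)) h (d : int) : (forall k, if e k is Some r then r.2.1
  == k.1 + d else true) ->
  forall k1 k2,
  all (fun p => (size p.2 == 2) && (zdeg p.2 == k1.1 + k2.1 + d)) (DE e h k1 k2).
Proof.
move=> ed k1 k2; rewrite /DE /zdeg; have := ed k1; have := ed k2.
case: (e k1) => [r1|]; case: (e k2) => [r2|] //= h1 h2; rewrite !big_cons !big_nil; lia.
Qed.

Lemma deg_DF (e : key -> option (K * key)) h (d : int) : (forall k, if e k is Some r then r.2.1
  == k.1 + d else true) ->
  forall k1 k2,
  all (fun p => (size p.2 == 2) && (zdeg p.2 == k1.1 + k2.1 + d)) (DF e h k1 k2).
Proof.
move=> ed k1 k2; rewrite /DF /zdeg; have := ed k1; have := ed k2.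
case: (e k1) => [r1|]; case: (e k2) => [r2|] //= h1 h2; rewrite !big_cons !big_nil; lia.
Qed.

Lemma ev_size s w : size s != size w -> evK s w = 0.
Proof.
elim: s w => [|[x j] s IH] [|k w] //=; rewrite eqSS => /IH ->.
exact: mulr0.
Qed.

(** For operators that multiply each component by a scalar: commuting with R means that the scalar
    is unchanged along every nonzero entry of R after the two parameters are exchanged. *)
Lemma stable2_diag (X : op2) (e : int) (c : int -> nat -> nat -> nat -> nat -> K) :
  (forall k1 k2, all (fun p => (size p.2 == 2) && (zdeg p.2 == k1.1 + k2.1 + e)) (X k1 k2)) ->
  (forall k1 k2 x j y k s, lsum (X k1 k2) (evK ((x, j) :: (y, k) :: s)) =
     c (k1.1 + k2.1) x j y k * (ev1 x j k1 * (ev1 y k k2 * evK s [::]))) ->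
  (forall d x j y k p, p \in Rmx q ptK x y j k -> c d y p.2.1 x p.2.2 = c d x j y k) ->
  stable2 Ninv X.
Proof.
move=> X2 Xc cR.
pose D d (phi : seq (nat * nat) -> K) s : K :=
  if s is (x, j) :: (y, k) :: s' then c d x j y k * phi s else 0.
apply: (@stable2_Ninv _ e D) => [//|d I L f s|k1 k2 s|d phi s].
- by case: s => [|[x j] [|[y k] s]] /=; rewrite ?lsum0 ?lsumZl.
- have short t : (size t < 2)%N -> lsum (X k1 k2) (evK t) = 0.
    move=> t2; rewrite lsumE big_seq big1 // => p /(allP (X2 k1 k2))/andP[/eqP p2 _].
    by rewrite ev_size ?mulr0 // p2 ltn_eqF.
  by case: s => [|[x j] [|[y k] s]]; [exact: short | exact: short | rewrite Xc].
case: s => [|[x j] [|[y k] s]] //=.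
rewrite -lsumZl !lsumE !big_seq; apply: eq_bigr => p pR.
by rewrite -(cR _ _ _ _ _ p pR).
Qed.

Lemma Rmx_weight x y j k p : p \in Rmx q ptK x y j k ->
  [/\ (j < 3)%N, (k < 3)%N, (p.2.1 < 3)%N, (p.2.2 < 3)%N & (p.2.1 + p.2.2 = j + k)%N].
Proof.
case/mapP => r rR -> /=; suff /allP/(_ _ rR) :
    all (fun r => [&& j < 3, k < 3, r.2.1 < 3, r.2.2 < 3 & r.2.1 + r.2.2 == j + k]%N)
      (rnum q (ptK x) (ptK y) j k).
  by case/and5P => ? ? ? ? /eqP.
by case: j {rR} => [|[|[|j]]]; case: k => [|[|[|k]]].
Qed.

Lemma zsh_ev1 b x j k : ev1 x j (zsh b k) = ptK x ^ b * ev1 x j k.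
Proof.
rewrite /ev1 /zsh /kj /=; case: eqP => _; last by rewrite mulr0.
by rewrite exprzDr ?unitfE ?ptK_neq0 // mulrC.
Qed.

Fact zz_identity (R : comPzRingType) (a b c d e : R) :
  a * c * (b * d * e) = a * b * (c * (d * e)).
Proof. by ring. Qed.

Fact zsum_identity (R : comPzRingType) (a b c d e : R) :
  a * c * (d * e) + (c * (b * d * e)) = (a + b) * (c * (d * e)).
Proof. by ring. Qed.

Fact evK2 x j y k s k1 k2 c :
  (c, [:: k1; k2]).1 * evK ((x, j) :: (y, k) :: s) (c, [:: k1; k2]).2 =
  c * (ev1 x j k1 * (ev1 y k k2 * evK s [::])).
Proof. by []. Qed.

Lemma pairh_weight (h : hP) (j k j' k' : nat) : (j + k = j' + k')%N ->
  2 * (1 - Posz j) * (h.1.2 - h.1.1) + 2 * (1 - Posz k) * (h.1.2 - h.1.1) =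
  2 * (1 - Posz j') * (h.1.2 - h.1.1) + 2 * (1 - Posz k') * (h.1.2 - h.1.1).
Proof. by move=> jk; rewrite -!mulrDl -!mulrDr; congr (_ * _ * _); lia. Qed.

Lemma Tq_eq0 : Tq 0 (fun=> 0) = (fun=> 0).
Proof.
by apply: functional_extensionality => s; exact: (@T_lin _ _ 0 unit [::] (fun _ _ => 0)).
Qed.

Lemma Tq_add phi psi : Tq 0 (fun s => phi s + psi s) = (fun s => Tq 0 phi s + Tq 0 psi s).
Proof. exact: T_add. Qed.

Lemma Tq_mull c phi : Tq 0 (fun s => c * phi s) = (fun s => c * Tq 0 phi s).
Proof. exact: T_mull. Qed.

Lemma lsum_catE (l l' : lvec) (phi : seq (nat * nat) -> seq key -> K) :
  (fun s => lsum (l ++ l') (phi s)) = (fun s => lsum l (phi s) + lsum l' (phi s)).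
Proof. by apply: functional_extensionality => s; rewrite lsum_cat. Qed.

Lemma lsum_scaleE c (l : lvec) (phi : seq (nat * nat) -> seq key -> K) :
  (fun s => lsum (lscale c l) (phi s)) = (fun s => c * lsum l (phi s)).
Proof. by apply: functional_extensionality => s; rewrite lsum_scale. Qed.

Lemma Ninv_subspace : subspace Ninv.
Proof.
split; [|split; [|split]].
- exists [::]; split => // [s|d]; first by rewrite coef_lsumE.
  exact: Tq_eq0.
- move=> f g [l [l2 fl Tl]] [l' [l2' gl Tl']]; exists (l ++ l'); split.
  + by rewrite /words_of_size all_cat; apply/andP.
  + by move=> s; rewrite coef_cat /vadd fl gl.
  by move=> d; rewrite lsum_catE Tq_add Tl Tl'.
- move=> c f [l [l2 fl Tl]]; exists (lscale c l); split.
  + by rewrite /words_of_size all_map.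
  + by move=> s; rewrite coef_scale /vscale fl.
  by move=> d; rewrite lsum_scaleE Tq_mull Tl.
- move=> f g fg [l [l2 fl Tl]]; exists l; split => // s.
  by rewrite -fg fl.
Qed.

Lemma val0_ptK x : val0 (ptK x) x.+1%:R.
Proof. exact: val0_nat. Qed.

Lemma val0_rden x y : val0 (rden q (ptK x) (ptK y)) (y.+1%:R ^+ 2).
Proof.
have h n : (0 < n)%N -> val0 (ptK y - q ^+ n * ptK x) y.+1%:R.
  move=> n0; have := val0X n val0_q; rewrite expr0n gtn_eqF // => qn.
  by have := val0B (val0_ptK y) (val0M qn (val0_ptK x)); rewrite mul0r subr0.
by rewrite expr2; apply: val0M (h 4 isT) (h 2 isT).
Qed.

Lemma rden_ptK x y : rden q (ptK x) (ptK y) != 0.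
Proof. by apply: val0_neq0 (val0_rden x y); rewrite expf_neq0 // pnatr_eq0. Qed.

Lemma lsum_single (R : comPzRingType) I (i : I) (f : I -> R) : lsum [:: (1, i)] f = f i.
Proof. by rewrite /= mul1r addr0. Qed.

Lemma Ninv_v0v0 : Ninv (coef [:: (1, [:: v0key; v0key])]).
Proof.
exists [:: (1, [:: v0key; v0key])]; split => // d.
have -> : (fun s => lsum [:: (1, [:: v0key; v0key])] (evd d s)) = evd d ^~ [:: v0key; v0key].
  by apply: functional_extensionality => s; rewrite lsum_single.
rewrite /evd; case: eqP => _; last exact: Tq_eq0.
apply: functional_extensionality => s.
case: s => [|[x j] [|[y k] s]]; do ?[by rewrite ev_size].
rewrite evK_cons2 /ev1 kj_mk // !expr0z.
rewrite -[LHS]/(lsum _ _) /Rmx lsumE big_map.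
case: j => [|[|[|j]]]; case: k => [|[|[|k]]];
  rewrite /rnum ?big_cons ?big_nil ?evK_cons2 /ev1 ?kj_mk //= ?mul1r ?mul0r ?mulr0 ?addr0 //.
by rewrite mulVf ?rden_ptK // mul1r.
Qed.

Lemma N_candidate_Ninv : N_candidate Ninv.
Proof.
have p0 := ptK_neq0; have q0 := q_neq0.
have sz a b (k1 k2 : key) d : (zdeg [:: a; b] == k1.1 + k2.1 + d) = (a.1 + b.1 == k1.1 + k2.1 +
  d).
  by rewrite /zdeg !big_cons big_nil addr0.
split.
- exact: Ninv_subspace.
- by move=> f [l [l2 fl _]]; exists l.
- exact: Ninv_v0v0.
(* The scalar of q^h depends on the indices only through their sum, which R preserves; the
   contribution of delta is carried by the z-degree d. *)
- move=> h; pose c d (x j y k : nat) := q ^ (2 * (1 - Posz j) * (h.1.2 - h.1.1) +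
    2 * (1 - Posz k) * (h.1.2 - h.1.1) + d * h.2).
  apply: (@stable2_diag _ 0 c) => [k1 k2|k1 k2 x j y k s|d x j y k p /Rmx_weight[_ _ _ _ jk]].
  + by rewrite /= sz addr0 eqxx.
  + rewrite /DQ /lsum /foldr addr0 evK2.
    rewrite (_ : pairh h k1 + pairh h k2 = 2 * (1 - Posz (kj k1)) * (h.1.2 - h.1.1) +
      2 * (1 - Posz (kj k2)) * (h.1.2 - h.1.1) + (k1.1 + k2.1) * h.2); last first.
      by rewrite /pairh (mulrDl k1.1) addrACA.
    rewrite -[q ^ _]/(c (k1.1 + k2.1) x (kj k1) y (kj k2)).
    rewrite /ev1; case: eqP => [->|_]; last by rewrite !mul0r !mulr0.
    by case: eqP => [->|_] //; rewrite !mul0r !mulr0.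
  by congr (q ^ (_ + _)); exact: pairh_weight.
split.
- apply: (@stable2_Ninv _ 1 _ (deg_DE _ _) (fun=> @coprod_lin _ _ _ _ _ _)
    (fun k1 k2 s => lsum_DE site_E0 _ k1 k2 s) (fun _ => @T_coprodE0 _ _ _ q0 p0)).
  + by move=> k; rewrite /opE0; case: ifP.
  + by move=> _ _ _ k; rewrite pairh_h0 opprK q_pairh.
- apply: (@stable2_Ninv _ 0 _ (deg_DE _ _) (fun=> @coprod_lin _ _ _ _ _ _)
    (fun k1 k2 s => lsum_DE site_E1 _ k1 k2 s) (fun _ => @T_coprodE1 _ _ _ q0 p0)).
  + by move=> k; rewrite /opE1; case: ifP; rewrite //= addr0.
  + by move=> _ _ _ k; rewrite pairh_h1 q_pairhV.
- apply: (@stable2_Ninv _ (-1) _ (deg_DF _ _) (fun=> @coprod_lin _ _ _ _ _ _)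
    (fun k1 k2 s => lsum_DF site_F0 _ k1 k2 s) (fun _ => @T_coprodF0 _ _ _ q0 p0)).
  + by move=> k; rewrite /opF0; case: ifP.
  + by move=> _ _ _ k; rewrite pairh_h0 q_pairhV.
- apply: (@stable2_Ninv _ 0 _ (deg_DF _ _) (fun=> @coprod_lin _ _ _ _ _ _)
    (fun k1 k2 s => lsum_DF site_F1 _ k1 k2 s) (fun _ => @T_coprodF1 _ _ _ q0 p0)).
  + by move=> k; rewrite /opF1; case: ifP; rewrite //= addr0.
  + by move=> _ _ _ k; rewrite pairh_h1 q_pairh.
split.
- apply: (@stable2_diag _ 2 (fun _ x _ y _ => ptK x ^ 1 * ptK y ^ 1)) => [k1 k2|k1 k2 x j y k
    s|d x j y k p _].
  + by rewrite /= sz /= addrACA eqxx.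
  + by rewrite lsum_single evK_cons2 !zsh_ev1 zz_identity.
  + exact: mulrC.
- apply: (@stable2_diag _ (-2) (fun _ x _ y _ => ptK x ^ (-1) * ptK y ^ (-1))) => [k1 k2|k1 k2
    x j y k s|d x j y k p _].
  + by rewrite /= sz /= addrACA eqxx.
  + by rewrite lsum_single evK_cons2 !zsh_ev1 zz_identity.
  + exact: mulrC.
- apply: (@stable2_diag _ 1 (fun _ x _ y _ => ptK x ^ 1 + ptK y ^ 1)) => [k1 k2|k1 k2 x j y k
    s|d x j y k p _].
  + by rewrite /= !sz /= addrAC eqxx addrA eqxx.
  + rewrite -[Dzsum k1 k2]/([:: (1, _)] ++ [:: (1, _)]) lsum_cat !lsum_single.
    by rewrite !evK_cons2 !zsh_ev1 zsum_identity.
  + exact: addrC.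
Qed.

Lemma Nsp_fixed f : Nsp f -> exists l : lvec,
  [/\ words_of_size 2 l, veq f (coef l) &
    Tq 0 (fun s => lsum l (evK s)) = (fun s => lsum l (evK s))].
Proof.
move=> /(_ _ N_candidate_Ninv)[l [l2 fl Tl]]; exists l; split=> //.
(* Only finitely many z-degrees occur in l, and the graded evaluations add up to the full one. *)
pose ds := [seq (1 : K, d) | d <- undup [seq zdeg p.2 | p <- l]].
have -> : (fun s => lsum l (evK s)) = (fun s => lsum ds (fun d => lsum l (evd d s))).
  apply: functional_extensionality => s; rewrite exchange_lsum !lsumE !big_seq.
  apply: eq_bigr => p pl; congr (_ * _); rewrite lsumE big_map.
  have pd : zdeg p.2 \in undup [seq zdeg p.2 | p <- l].
    by rewrite mem_undup; exact: (map_f (fun p : K * seq key => zdeg p.2)).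
  rewrite (bigD1_seq (zdeg p.2)) ?undup_uniq //= mul1r /evd eqxx big1 ?addr0 // => d dp.
  by rewrite eq_sym (negbTE dp) mulr0.
rewrite (T_sum _ 0 ds (fun d s => lsum l (evd d s))).
by apply: functional_extensionality => s; apply: eq_lsum => d; rewrite Tl.
Qed.

Definition insl (t : seq key) (l : lvec) (t' : seq key) : lvec :=
  [seq (p.1, t ++ p.2 ++ t') | p <- l].

Lemma ins_coef t l t' : words_of_size 2 l ->
  veq (ins t (coef l) t') (coef (insl t l t')).
Proof.
move=> l2 s; rewrite /ins !coef_lsumE /insl (lsum_map (fun w => t ++ w ++ t')).
have eqs w : size w == 2%N -> (t ++ w ++ t' == s) =
    (take (size t) s == t) && (drop (size t + 2) s == t') && (w == take 2 (drop (size t) s)).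
  move=> /eqP w2; apply/eqP/idP => [<-|/andP[/andP[/eqP st /eqP st'] /eqP ww]].
    rewrite take_size_cat // addnC -drop_drop drop_size_cat //.
    by rewrite (drop_size_cat _ w2) (take_size_cat _ w2) !eqxx.
  rewrite ww -{1}st -st' -{4}(cat_take_drop (size t) s); congr (_ ++ _).
  by rewrite addnC -drop_drop cat_take_drop.
case: ifP => C; last first.
  rewrite lsumE big_seq big1 // => p /(allP l2) p2.
  by rewrite /= eqs // C mulr0.
by rewrite !lsumE !big_seq; apply: eq_bigr => p /(allP l2) p2; rewrite /= eqs // C.
Qed.

Lemma evK_cat s s' w w' : size s = size w -> evK (s ++ s') (w ++ w') = evK s w * evK s' w'.
Proof.
elim: s w => [|[x j] s IH] [|k w] //= => [_|[/IH ->]]; first by rewrite mul1r.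
by rewrite mulrA.
Qed.

(** The letters of t and t' contribute only scalar factors to [evK]; those of t move the place where
    the R-matrix acts. *)
Lemma T_insl t l t' : words_of_size 2 l ->
  Tq 0 (fun s => lsum l (evK s)) = (fun s => lsum l (evK s)) ->
  Tq (size t) (fun s => lsum l (fun w => evK s (t ++ w ++ t'))) =
  (fun s => lsum l (fun w => evK s (t ++ w ++ t'))).
Proof.
move=> l2 Tl; elim: t => [|k t IH]; last first.
  apply: functional_extensionality => -[|[x j] s]; first by rewrite [RHS]lsum0.
  rewrite -[LHS]/(Tq (size t) (fun s => lsum l (fun w => ev1 x j k * evK s (t ++ w ++ t'))) s).
  under (functional_extensionality (fun s => lsum l _)) => u do rewrite lsumZl.
  rewrite T_mull IH -lsumZl.
  by [].
have short s : (size s < 2)%N -> lsum l (fun w => evK s (w ++ t')) = 0.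
  move=> s2; rewrite lsumE big_seq big1 // => p /(allP l2) /eqP p2.
  by rewrite ev_size ?mulr0 // size_cat p2 ltn_eqF // ltn_addr.
apply: functional_extensionality => -[|[x j] [|[y k] s]]; do ?[by rewrite [RHS]short].
have split2 x' j' y' k' : lsum l (fun w => evK [:: (x', j'), (y', k') & s] (w ++ t')) =
    evK s t' * lsum l (fun w => evK [:: (x', j'); (y', k')] w).
  rewrite -lsumZl !lsumE !big_seq; apply: eq_bigr => p /(allP l2) /eqP p2.
  by rewrite -[_ :: _ :: s]/([:: (x', j'); (y', k')] ++ s) evK_cat //; congr (_ * _); exact:
    mulrC.
have Tl2 := congr1 (@^~ [:: (x, j); (y, k)]) Tl.
rewrite [RHS]split2 -[X in _ = _ * X]Tl2.
rewrite -[X in _ = _ * X]/(lsum _ _) -[LHS]/(lsum _ _) -lsumZl.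
by apply: eq_lsum => jk; rewrite split2.
Qed.

Lemma Aop_Nn_ex n x : Nn n x -> exists l : lvec,
  veq x (coef l) /\ forall s, Aop (Rmx q ptK) n (fun s => lsum l (evK s)) s = 0.
Proof.
case=> gens [gensP xE].
suff [l [vl Al]] : exists l : lvec,
    veq (vsum [seq vscale (ncoef p) (ins (nleft p) (nmid p) (nright p)) | p <- gens]) (coef l) /\
    forall s, Aop (Rmx q ptK) n (fun s => lsum l (evK s)) s = 0.
  by exists l; split=> // s; rewrite xE vl.
elim: gens gensP {xE} => [|p gens IH] gensP.
  exists [::]; split=> [s|s]; first by rewrite coef_lsumE.
  exact: (@Aop_lin _ _ n unit [::] (fun _ _ => 0)).
have [[pN psize] /IH[l [vl Al]]] := (List.Forall_inv gensP, List.Forall_inv_tail gensP).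
have [l2 [l2s fl2 Tl2]] := Nsp_fixed pN.
exists (lscale (ncoef p) (insl (nleft p) l2 (nright p)) ++ l); split.
  move=> s; rewrite /= coef_cat /vadd vl; congr (_ + _).
  rewrite coef_scale /vscale -(ins_coef _ _ l2s); congr (_ * _).
  by rewrite /ins; case: ifP => // _; rewrite fl2.
move=> s; rewrite lsum_catE Aop_add lsum_scaleE Aop_mull Al addr0.
have fixed := T_insl (nleft p) (nright p) l2s Tl2.
have E : (fun s => lsum (insl (nleft p) l2 (nright p)) (evK s)) =
    (fun s => lsum l2 (fun w => evK s (nleft p ++ w ++ nright p))).
  by apply: functional_extensionality => u; rewrite /insl (lsum_map (fun w => _ ++ w ++ _)).
rewrite E (Aop_fixed _ _ _ fixed) ?mulr0 //; last by rewrite -psize; lia.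
exact: T_braid0.
Qed.

Lemma Aop_Nn n (l : lvec) s : Nn n (coef l) ->
  Aop (Rmx q ptK) n (fun s => lsum l (evK s)) s = 0.
Proof.
case/Aop_Nn_ex => l' [ll' Al]; rewrite -[RHS](Al s).
congr Aop; apply: functional_extensionality => t; exact: eq_coef_lsum.
Qed.

(** * The antisymmetrizer at q = 0 *)

Definition ptQ (x : nat) : rat := x.+1%:R.
Notation evQ := (@ev rat ptQ).
Notation T0 := (T (Rmx (0 : rat) ptQ)).

Lemma ptQ_neq0 x : ptQ x != 0.
Proof. by rewrite pnatr_eq0. Qed.

Lemma val0Mn f r n : val0 f r -> val0 (f *+ n) (r *+ n).
Proof. by move=> fr; rewrite -(mulr_natr f) -(mulr_natr r); apply: val0M fr (val0_nat n). Qed.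

Lemma rden_ptQ x y : rden 0 (ptQ x) (ptQ y) != 0.
Proof. by rewrite /rden !expr0n /= !mul0r !subr0 mulf_neq0 ?ptQ_neq0. Qed.

Ltac val0_tac := repeat first
  [ assumption | exact: val00 | exact: val01 | exact: val0_q | exact: val0_ptK
  | apply: val0M | apply: val0B | apply: val0D | apply: val0X | apply: val0Mn ].

(** At the chosen points R has entries in A, so setting q = 0 commutes with its action. *)
Lemma val0_T l phi phi0 : (forall s, val0 (phi s) (phi0 s)) ->
  forall s, val0 (T (Rmx q ptK) l phi s) (T0 l phi0 s).
Proof.
elim: l phi phi0 => [|l IH] phi phi0 phiE [|[x j] s]; try exact: val00; last first.
  by apply: (IH (fun t => phi ((x, j) :: t)) (fun t => phi0 ((x, j) :: t))) => t; exact: phiE.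
case: s => [|[y k] s]; first exact: val00.
rewrite -[T _ _ phi _]/(lsum _ _) -[T _ _ phi0 _]/(lsum _ _) /Rmx.
have rE : val0 (rinv q (ptK x) (ptK y)) (rinv 0 (ptQ x) (ptQ y)).
  apply: val0V; first exact: rden_ptQ.
  by rewrite /rden; val0_tac.
move: rE; move: (rinv _ _ _) (rinv _ _ _) => r r0 rE.
case: j => [|[|[|j]]]; case: k => [|[|[|k]]]; try exact: val00;
  rewrite /rnum /rden /lsum /=; val0_tac; exact: phiE.
Qed.

Lemma val0_lsum I (L : seq I) (c : I -> K) (c0 : I -> rat) (f : I -> K) (f0 : I -> rat) :
  (forall i, val0 (c i) (c0 i)) -> (forall i, val0 (f i) (f0 i)) ->
  val0 (\sum_(i <- L) c i * f i) (\sum_(i <- L) c0 i * f0 i).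
Proof.
move=> cE fE; elim: L => [|i L IH]; first by rewrite !big_nil; exact: val00.
by rewrite !big_cons; apply: val0D IH; apply: val0M.
Qed.

Lemma val0_U p phi phi0 : (forall s, val0 (phi s) (phi0 s)) ->
  forall s, val0 (U (Rmx q ptK) p phi s) (U (Rmx (0 : rat) ptQ) p phi0 s).
Proof. by elim: p phi phi0 => //= p IH phi phi0 phiE; apply: IH; apply: val0_T. Qed.

Lemma val0_Aop n phi phi0 : (forall s, val0 (phi s) (phi0 s)) ->
  forall s, val0 (Aop (Rmx q ptK) n phi s) (Aop (Rmx (0 : rat) ptQ) n phi0 s).
Proof.
elim: n phi phi0 => [|n IH] phi phi0 phiE [|a s] //=; first exact: val00.
apply: IH => t; rewrite /Cop !lsum_cosets; apply: val0_lsum => p.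
  by apply: val0X; apply: val0N; exact: val01.
exact: val0_U.
Qed.

Lemma val0_evK s w : val0 (evK s w) (evQ s w).
Proof.
elim: s w => [|[x j] s IH] [|k w] /=; try exact: val00; first exact: val01.
apply: val0M (IH w); case: eqP => _; last exact: val00.
case: k.1 => n; first by apply: val0X; exact: val0_ptK.
by apply: val0V; [rewrite expf_neq0 ?ptQ_neq0 | apply: val0X; exact: val0_ptK].
Qed.

(** * Words, shifted exponents and alternants *)

Definition kappa (j k : nat) : nat := minn j (2 - k).
Definition kap (j : 'I_3) (js : seq 'I_3) : int := if js is k :: _ then Posz (kappa j k) else 0.

(* wd e js b is the word with indices js and shifted exponents b, where the
   exponent of a letter is shifted by e plus the sum of the values of kappa to
   its left.  At q = 0 the R-matrix permutes the shifted exponents. *)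
Fixpoint wd (e : int) (js : seq 'I_3) (b : seq int) : seq key :=
  match js, b with
  | j :: js', a :: b' => (a - e, j) :: wd (e + kap j js') js' b'
  | _, _ => [::]
  end.

Fixpoint bd (e : int) (w : seq key) : seq int :=
  if w is k :: w' then (k.1 + e) :: bd (e + kap k.2 (map snd w')) w' else [::].

Fixpoint swapl (l : nat) (b : seq int) : seq int :=
  match l, b with
  | 0%N, x :: y :: b' => y :: x :: b'
  | l'.+1, x :: b' => x :: swapl l' b'
  | _, _ => b
  end.

Section AtZero.
Variables (F : fieldType) (pt : nat -> F).
Hypothesis pt0 : forall x, pt x != 0.
Let R0 := Rmx 0 pt.

(** At q = 0 only the entry (j, k) of row (j, k) survives, with value (x/y)^kappa. This is how the
    energy function enters. *)
Lemma T_at0 x j y k phi s : (j < 3)%N -> (k < 3)%N ->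
  T R0 0 phi ((x, j) :: (y, k) :: s) =
  pt x ^ kappa j k * pt y ^ (- Posz (kappa j k)) * phi ((y, j) :: (x, k) :: s).
Proof.
rewrite /= /R0 /Rmx; move: (pt0 x) (pt0 y); set X := pt x; set Y := pt y => X0 Y0.
have -> : rinv 0 X Y = Y^-1 ^+ 2 by rewrite /rinv /rden !expr0n /= !mul0r !subr0 exprVn.
case: j => [|[|[|j]]]; case: k => [|[|[|k]]] // _ _;
  rewrite /rnum /rden /kappa /lsum /= ?expr0n /= ?(mul0r, mulr0, addr0, subr0, add0r, mulrN);
  rewrite -?exprnN -?exprnP ?exprVn ?expr0 ?expr1; field; rewrite ?oner_neq0; do ?[apply/andP;
    split] => //.
Qed.

(** The monomial (x/y)^kappa is exactly what the shift of the exponents absorbs. *)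
Lemma T_wd l e js b : size js = size b -> (l.+1 < size b)%N ->
  T R0 l (fun s => ev pt s (wd e js b)) = (fun s => ev pt s (wd e js (swapl l b))).
Proof.
elim: l e js b => [|l IH] e [|j0 js] [|b0 b] // [eqs]; last first.
  rewrite /= ltnS => lb; apply: functional_extensionality => -[|[x j] s] //=.
  by rewrite T_mull IH.
case: js b eqs => [|j1 js] [|b1 b] // _ _; apply: functional_extensionality.
case=> [|[x j] [|[y k] s]]; [by [] | by rewrite /= mulr0 |].
have [j3|j3] := ltnP j 3; last first.
  rewrite [RHS](_ : _ = 0); last first.
    by rewrite /kj /= ifN ?mul0r // neq_ltn (leq_trans (ltn_ord _) j3).
  by rewrite /= /R0 /Rmx; case: j j3 => [|[|[|j]]].
have [k3|k3] := ltnP k 3; last first.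
  rewrite [RHS](_ : _ = 0); last first.
    by rewrite /kj /= [X in _ * (X * _)]ifN ?mul0r ?mulr0 // neq_ltn (leq_trans (ltn_ord _) k3).
  by rewrite /= /R0 /Rmx; case: j {j3} => [|[|[|j]]]; case: k k3 => [|[|[|k]]].
rewrite (T_at0 _ _ _ _ j3 k3) /= /kj /=.
case: eqP => [<-|_]; last by rewrite !mul0r mulr0.
case: eqP => [<-|_]; last by rewrite !(mul0r, mulr0).
have -> : b1 - e = Posz (kappa j0 j1) + (b1 - (e + Posz (kappa j0 j1))) by ring.
have -> : b0 - (e + Posz (kappa j0 j1)) = - Posz (kappa j0 j1) + (b0 - e) by ring.
rewrite !exprzDr ?unitfE ?pt0 //.
by move: (pt x ^ _) (pt x ^ _) (pt y ^ _) (pt y ^ _) (ev _ _ _) => ? ? ? ? ?; ring.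
Qed.

Lemma swapl_cat b x y b' : swapl (size b) (b ++ x :: y :: b') = b ++ y :: x :: b'.
Proof. by elim: b => //= a b ->. Qed.

Lemma U_wd e js b x b' : size js = size (b ++ x :: b') ->
  U R0 (size b) (fun s => ev pt s (wd e js (b ++ x :: b'))) =
  (fun s => ev pt s (wd e js (x :: b ++ b'))).
Proof.
elim/last_ind: b x b' => [|b y IH] x b' //=; rewrite size_rcons /= cat_rcons => eqs.
rewrite T_wd ?swapl_cat //; last by rewrite size_cat /=; lia.
by rewrite IH ?cat_rcons // eqs !size_cat.
Qed.

Definition del p (b : seq int) := take p b ++ drop p.+1 b.

(** The alternant expanded by the choice of its first entry, in step with the coset recursion of
    [Aop]. *)
Fixpoint alt (n : nat) (b : seq int) : seq (F * seq int) :=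
  if n is n'.+1 then
    flatten [seq [seq ((-1) ^+ p * r.1, nth 0 b p :: r.2) | r <- alt n' (del p b)] | p <- iota
      0 n]
  else [:: (1, b)].

Lemma size_del p b : (p < size b)%N -> size (del p b) = (size b).-1.
Proof. by move=> pb; rewrite size_cat size_take size_drop pb; lia. Qed.

Lemma lsum_alt n b (f : seq int -> F) :
  lsum (alt n.+1 b) f =
  \sum_(p < n.+1) (-1) ^+ p * lsum (alt n (del p b)) (fun u => f (nth 0 b p :: u)).
Proof.
have -> : alt n.+1 b = flatten [seq [seq ((-1) ^+ p * r.1, nth 0 b p :: r.2)
    | r <- alt n (del p b)] | p <- index_iota 0 n.+1] by [].
rewrite lsumE big_flatten big_map big_mkord.
by apply: eq_bigr => p _; rewrite big_map lsumE mulr_sumr; apply: eq_bigr => r _; rewrite mulrA.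
Qed.

Lemma Aop_wd n e js b s : size js = n -> size b = n ->
  Aop R0 n (fun s => ev pt s (wd e js b)) s = lsum (alt n b) (fun u => ev pt s (wd e js u)).
Proof.
elim: n e js b s => [|n IH] e js b s js_n b_n; first by rewrite /= mul1r addr0.
rewrite lsum_alt; case: js js_n => // j0 js [js_n].
case: s => [|[x j] s].
  by rewrite /= big1 // => p _; rewrite lsum0 mulr0.
have -> : Aop R0 n.+1 (fun s => ev pt s (wd e (j0 :: js) b)) ((x, j) :: s) =
  Aop R0 n (fun t => lsum (cosets F n) (fun p =>
    U R0 p (fun s => ev pt s (wd e (j0 :: js) b)) ((x, j) :: t))) s by [].
rewrite (@Aop_lin _ R0 n nat _ (fun p t => U R0 p _ ((x, j) :: t))) lsum_cosets.
apply: eq_bigr => p _; congr (_ * _).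
have pb : (p < size b)%N by rewrite b_n.
have bE : b = take p b ++ nth 0 b p :: drop p.+1 b by rewrite -drop_nth // cat_take_drop.
have sp : size (take p b) = p by rewrite size_take pb.
have -> : U R0 p (fun s => ev pt s (wd e (j0 :: js) b)) =
    (fun s => ev pt s (wd e (j0 :: js) (nth 0 b p :: del p b))).
  have := @U_wd e (j0 :: js) (take p b) (nth 0 b p) (drop p.+1 b).
  by rewrite -bE sp => -> //=; rewrite js_n b_n.
rewrite [RHS]lsumZl [LHS]Aop_mull; congr (_ * _).
by apply: IH => //; rewrite size_del // b_n.
Qed.
End AtZero.

Lemma sorted_del p (b : seq int) : sorted <%R b -> sorted <%R (del p b).
Proof.
apply: subseq_sorted; first exact: lt_trans.
by rewrite -{2}(cat_take_drop p b) cat_subseq // -add1n -drop_drop drop_subseq.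
Qed.

Lemma alt_sorted (F : fieldType) n b b' : size b = n -> size b' = n ->
  sorted <%R b -> sorted <%R b' ->
  lsum (alt F n b) (fun u => (u == b')%:R) = (b == b')%:R.
Proof.
elim: n b b' => [|n IH] b b'.
  by move=> /size0nil-> /size0nil-> _ _ /=; rewrite mul1r addr0.
case: b' b => // x b' [//|y b] [b_n] [b'_n] b_s b'_s.
rewrite lsum_alt big_ord_recl expr0 mul1r.
have -> : del 0 (y :: b) = b by rewrite /del take0 drop1.
rewrite [X in _ + X]big1 ?addr0 => [|p _].
  rewrite -mulnb natrM -(IH b b') //; try exact: path_sorted (b_s); try exact: path_sorted (b'_s).
  rewrite -lsumZl; apply: eq_lsum => u.
  by rewrite eqseq_cons -mulnb natrM.
(* A later entry chosen first leaves the minimum y behind. The result cannot be the increasing list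
   x :: b', because y < x would stand in its tail. *)
rewrite [lsum _ _](_ : _ = (nth 0 (y :: b) (lift ord0 p) == x)%:R * (del (lift ord0 p) (y :: b)
  == b')%:R).
  have [px|] := eqVneq; last by rewrite mul0r mulr0.
  have [pb|] := eqVneq; last by rewrite !mulr0.
  have : x < y.
    have /allP := order_path_min lt_trans b'_s; apply.
    by rewrite -pb /del /= in_cons eqxx.
  have : y < x.
    have /allP := order_path_min lt_trans b_s; apply.
    by rewrite -px /= mem_nth // b_n ltn_ord.
  by move=> /lt_trans h /h; rewrite ltxx.
have lp : (lift ord0 p < size (y :: b))%N by rewrite /= b_n ltnS /bump add1n ltn_ord.
rewrite -(IH (del (lift ord0 p) (y :: b)) b') //; last first.
- exact: path_sorted b'_s.
- exact: (sorted_del (lift ord0 p) b_s).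
- by rewrite size_del //= b_n.
rewrite -lsumZl; apply: eq_lsum => u.
by rewrite eqseq_cons -mulnb natrM.
Qed.

(** After multiplication by a power of the variable this is a polynomial with more roots, all
    positive integers, than its size allows. *)
Lemma laurent_indep I (L : seq (rat * I)) (g : I -> rat) (a : I -> int) :
  (forall x, lsum L (fun i => g i * ptQ x ^ a i) = 0) ->
  forall e, lsum L (fun i => if a i == e then g i else 0) = 0.
Proof.
move=> L0 e.
have [M Ma] : exists M : nat, List.Forall (fun p => 0 <= a p.2 + Posz M) L /\ 0 <= e + Posz M.
  elim: L {L0} => [|p L [M [IH eM]]]; first by exists `|e|%N; split; [constructor|lia].
  exists (M + `|a p.2|)%N; split; last by lia.
  constructor; first by lia.
  by apply: List.Forall_impl IH => r /=; lia.
case: Ma => LM eM.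
pose P : {poly rat} := \sum_(p <- L) (p.1 * g p.2) *: 'X^(`|(a p.2 + Posz M)%R|%N).
have Pe : P`_(`|(e + Posz M)%R|%N) = lsum L (fun i => if a i == e then g i else 0).
  rewrite lsumE coef_sum; elim: L LM {L0 P} => [|p L IH] LM; first by rewrite !big_nil.
  have aM := List.Forall_inv LM.
  rewrite !big_cons (IH (List.Forall_inv_tail LM)); congr (_ + _).
  rewrite coefZ coefXn -mulrA; congr (_ * _).
  have -> : (`|(e + Posz M)%R|%N == `|(a p.2 + Posz M)%R|%N) = (a p.2 == e) by lia.
  by case: eqP; rewrite ?mulr1 ?mulr0.
rewrite -Pe; suff -> : P = 0 by rewrite coef0.
apply/eqP; apply: contraT => P0.
have rs : uniq [seq ptQ x | x <- iota 0 (size P)].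
  rewrite map_inj_uniq ?iota_uniq // => x y /eqP; rewrite /ptQ eqr_nat => /eqP[].
  by [].
have : all (root P) [seq ptQ x | x <- iota 0 (size P)].
  apply/allP => _ /mapP[x _ ->]; rewrite /root.
  suff -> : P.[ptQ x] = ptQ x ^+ M * lsum L (fun i => g i * ptQ x ^ a i) by rewrite L0 mulr0.
  rewrite horner_sum lsumE mulr_sumr.
  elim: L LM {L0 P Pe P0 rs} => [|p L IH] LM; first by rewrite !big_nil.
  have aM := List.Forall_inv LM.
  rewrite !big_cons (IH (List.Forall_inv_tail LM)); congr (_ + _).
  rewrite hornerZ hornerXn -[LHS]mulrA [RHS]mulrCA; congr (_ * _).
  rewrite [RHS]mulrCA; congr (_ * _).
  rewrite !exprnP -exprzDr ?unitfE ?ptQ_neq0 //.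
  by suff -> : Posz `|(a p.2 + Posz M)%R|%N = Posz M + a p.2 by []; lia.
by move/max_poly_roots => /(_ P0 rs); rewrite size_map size_iota ltnn.
Qed.

(** The parameters in s vary independently, so the first letter can be separated off by
    [laurent_indep] and the remaining letters by induction. *)
Lemma ev_indep (L : seq (rat * seq key)) : (forall s, lsum L (evQ s) = 0) ->
  forall w, lsum L (fun v => (v == w)%:R) = 0.
Proof.
move=> L0 w; elim: w L L0 => [|k w IH] L L0.
  rewrite -[RHS](L0 [::]); apply: eq_lsum => -[|k v] //.
pose L1 := [seq (p.1, behead p.2) | p <- L & if p.2 is k' :: _ then k' == k else false].
have L1E f : lsum L1 f = lsum L (fun v => if v is k' :: v' then (k' == k)%:R * f v' else 0).
  rewrite /L1; elim: L {L0 L1} => [|[c [|k' v]] L IHL] //=.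
    by rewrite IHL mulr0 add0r.
  by case: eqP => _ /=; rewrite IHL ?mul1r // mul0r mulr0 add0r.
rewrite [LHS](_ : _ = lsum L1 (fun v => (v == w)%:R)); last first.
  rewrite L1E; apply: eq_lsum => -[|k' v] //.
  by rewrite eqseq_cons -mulnb natrM.
apply: IH => s; rewrite L1E.
pose g v : rat := if v is k' :: v' then (kj k' == kj k)%:R * evQ s v' else 0.
pose a (v : seq key) : int := if v is k' :: _ then k'.1 else 0.
have ga0 x : lsum L (fun v => g v * ptQ x ^ a v) = 0.
  rewrite -[RHS](L0 ((x, kj k) :: s)); apply: eq_lsum => -[|k' v] /=; first by rewrite mul0r.
  by case: eqP => _; rewrite ?mul0r // mul1r mulrC.
rewrite -[RHS](laurent_indep ga0 k.1).
apply: eq_lsum => -[|k' v]; first by rewrite /=; case: eqP.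
rewrite /g /a; have -> : (k' == k) = (k'.1 == k.1) && (kj k' == kj k) by [].
by case: eqP => _; rewrite ?mul0r.
Qed.

Lemma wdK e js b : size js = size b -> bd e (wd e js b) = b.
Proof.
elim: js e b => [|j js IH] e [|a b] //= [eqs]; rewrite subrK; congr (_ :: _).
have -> : [seq i.2 | i <- wd (e + kap j js) js b] = js.
  by elim: js {IH} (e + _) b eqs => [|j' js IH] e' [|a' b] //= [/IH->].
exact: IH.
Qed.

Lemma wd_js e js b : size js = size b -> [seq k.2 | k <- wd e js b] = js.
Proof. by elim: js e b => [|j' js IH] e [|a b] //= [/IH->]. Qed.

Lemma bdK e w : wd e (map snd w) (bd e w) = w.
Proof. by elim: w e => [|[a j] w IH] e //=; rewrite IH addrK. Qed.

Lemma size_bd e w : size (bd e w) = size w.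
Proof. by elim: w e => //= k w IH e; rewrite IH. Qed.

Lemma size_alt (F : fieldType) n b r : size b = n -> r \in alt F n b -> size r.2 = n.
Proof.
elim: n b r => [|n IH] b r b_n; first by rewrite inE => /eqP->.
case/flattenP => u /mapP[p]; rewrite mem_iota => /andP[_ pn] -> /mapP[r' r'u ->] /=.
by rewrite (IH (del p b)) // size_del b_n.
Qed.

Definition normal_word (w : seq key) : bool := sorted <%R (bd 0 w).

Lemma normal_indep0 n (L : seq (rat * seq key)) :
  all (fun p => (size p.2 == n) && normal_word p.2) L ->
  (forall s, lsum L (fun w => Aop (Rmx (0 : rat) ptQ) n (fun s => evQ s w) s) = 0) ->
  forall w, size w = n -> normal_word w -> lsum L (fun v => (v == w)%:R) = 0.
Proof.
move=> Ln L0 w w_n w_s.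
pose L' := flatten [seq [seq (p.1 * r.1, wd 0 (map snd p.2) r.2) | r <- alt rat n (bd 0 p.2)] |
  p <- L].
have L'E f : lsum L' f = lsum L (fun v => lsum (alt rat n (bd 0 v)) (fun u => f (wd 0 (map snd
  v) u))).
  rewrite /L' !lsumE big_flatten big_map; apply: eq_bigr => p _.
  by rewrite big_map lsumE mulr_sumr; apply: eq_bigr => r _; rewrite mulrA.
have L'0 s : lsum L' (evQ s) = 0.
  rewrite L'E -[RHS](L0 s) !lsumE !big_seq.
  apply: eq_bigr => p /(allP Ln)/andP[/eqP p_n p_s]; congr (_ * _).
  rewrite -(Aop_wd ptQ_neq0) ?size_map ?size_bd //.
  by rewrite bdK.
rewrite -[RHS](ev_indep L'0 w) L'E.
rewrite !lsumE !big_seq; apply: eq_bigr => p /(allP Ln)/andP[/eqP p_n p_s]; congr (_ * _).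
  (* At q = 0 antisymmetrizing keeps the sequence of indices, so different sequences do not
     interact; for equal ones the words are compared through their shifted exponents. *)
  have [jsw|jsw] := eqVneq (map snd p.2) (map snd w); last first.
    rewrite lsumE big_seq big1 => [|r rp].
      by case: eqP => // pw; rewrite pw eqxx in jsw.
    case: eqP => [pw|]; last by rewrite mulr0.
    by rewrite -pw wd_js ?eqxx // in jsw; rewrite size_map p_n (size_alt _ rp) ?size_bd.
  rewrite -[w in LHS](bdK 0) -{1}(bdK 0 p.2) jsw.
  transitivity (lsum (alt rat n (bd 0 p.2)) (fun u => (u == bd 0 w)%:R)).
    rewrite alt_sorted ?size_bd //; congr (nat_of_bool _)%:R.
    apply/eqP/eqP => [/(congr1 (bd 0))|->//].
    by rewrite !wdK // size_map size_bd // p_n.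
  rewrite !lsumE !big_seq; apply: eq_bigr => r rp; congr (_ * (nat_of_bool _)%:R).
  have r_n : size r.2 = n by rewrite (size_alt _ rp) ?size_bd.
  apply/eqP/eqP => [->|/(congr1 (bd 0))]; first exact: bdK.
  by rewrite wdK // size_map w_n r_n.
Qed.

(** * Linear independence *)

Definition lattice_comb (n : nat) (l : lvec) : Prop :=
  List.Forall (fun p => inA p.1 /\ size p.2 = n) l.

Definition at0 (l : lvec) (l0 : seq (rat * seq key)) : Prop :=
  List.Forall2 (fun p p0 => val0 p.1 p0.1 /\ p.2 = p0.2) l l0.

Lemma lattice_at0 (l : lvec) : List.Forall (fun p => inA p.1) l -> exists l0, at0 l l0.
Proof.
elim: l => [|p l IH] lA; first by exists [::]; constructor.
have [l0 ll0] := IH (List.Forall_inv_tail lA).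
have [r pr] := inA_val0 (List.Forall_inv lA).
by exists ((r, p.2) :: l0); constructor.
Qed.

Lemma val0_at0 l l0 f f0 : at0 l l0 -> (forall w, val0 (f w) (f0 w)) ->
  val0 (lsum l f) (lsum l0 f0).
Proof.
move=> ll0 ff0; elim: ll0 => [|p p0 {}l {}l0 [pp0 e] _ IH] /=; first exact: val00.
by apply: val0D IH; apply: val0M => //; rewrite e.
Qed.

Definition Phi (n : nat) (l : lvec) s : K := Aop (Rmx q ptK) n (fun s => lsum l (evK s)) s.

Lemma val0_Phi n l l0 s : at0 l l0 ->
  val0 (Phi n l s) (lsum l0 (fun w => Aop (Rmx 0 ptQ) n (fun s => evQ s w) s)).
Proof.
move=> ll0; rewrite -(@Aop_lin _ _ n _ l0 (fun w s => evQ s w)).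
by apply: val0_Aop => t; apply: val0_at0 ll0 _ => w; exact: val0_evK.
Qed.

Lemma Phi_cat n l l' s : Phi n (l ++ l') s = Phi n l s + Phi n l' s.
Proof. by rewrite /Phi lsum_catE Aop_add. Qed.

Lemma Phi_scale n c l s : Phi n (lscale c l) s = c * Phi n l s.
Proof. by rewrite /Phi lsum_scaleE Aop_mull. Qed.

Lemma uniq_map_snd (S : eqType) (W : eqType) (l : seq (S * W)) p p' :
  uniq (map snd l) -> p \in l -> p' \in l -> p.2 = p'.2 -> p = p'.
Proof.
elim: l => //= r l IH /andP[rl ul]; rewrite !inE.
case/orP => [/eqP->|pl] /orP[/eqP->//|p'l] e; last exact: IH.
  by case/negP: rl; rewrite e; apply: map_f.
by case/negP: rl; rewrite -e; apply: map_f.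
Qed.

Lemma normal_indep n l :
  all (fun p => (size p.2 == n) && normal_word p.2) l -> uniq (map snd l) ->
  List.Forall (fun p => inA p.1) l -> (forall s, val0 (Phi n l s) 0) ->
  List.Forall (fun p => val0 p.1 0) l.
Proof.
move=> ln ul lA Phi0; have [l0 ll0] := lattice_at0 lA.
have sl : map snd l = map snd l0 by elim: ll0 => //= p p0 ? ? [_ ->] _ ->.
have l0n : all (fun p => (size p.2 == n) && normal_word p.2) l0.
  have : all (fun w => (size w == n) && normal_word w) (map snd l) by rewrite all_map.
  by rewrite sl all_map.
have := normal_indep0 l0n _ => /(_ (fun s => val0_uniq (val0_Phi n s ll0) (Phi0 s))) indep.
have coef0 p0 : p0 \in l0 -> p0.1 = 0.
  move=> p0l; have /andP[/eqP p0n p0s] := allP l0n _ p0l.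
  rewrite -[RHS](indep _ p0n p0s) lsumE (bigD1_seq p0) //=; last first.
    by apply: (@map_uniq _ _ snd); rewrite -sl.
  rewrite eqxx mulr1 big_seq_cond big1 ?addr0 // => p /andP[pl pp0].
  case: eqP => e; last by rewrite mulr0.
  case/eqP: pp0; rewrite sl in ul.
  exact: uniq_map_snd ul pl p0l e.
move: coef0; elim: ll0 => {ln ul lA Phi0 sl l0n indep} [|p p0 {}l {}l0 [pp0 _] _ IH] coef0;
  constructor.
  by rewrite -(coef0 p0 (mem_head _ _)).
by apply: IH => p1 p1l; apply: coef0; rewrite in_cons p1l orbT.
Qed.

Lemma Nn_veq n x y : veq x y -> Nn n x -> Nn n y.
Proof. by move=> xy [l [lP xl]]; exists l; split=> // s; rewrite -xy xl. Qed.

Lemma lift_coef g m r R l : words_of_size r l ->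
  veq (Defs.lift g m r R (coef l)) (coef [seq (p.1, p.2 ++ vtail g m r (R - r)) | p <- l]).
Proof.
move=> lr s; rewrite /Defs.lift !coef_lsumE (lsum_map (fun w => w ++ _)).
rewrite mulrC -lsumZl !lsumE !big_seq; apply: eq_bigr => p /(allP lr)/eqP pr.
congr (_ * _); rewrite -natrM mulnb; congr (nat_of_bool _)%:R.
apply/andP/eqP => [[/eqP <- /eqP ->]|<-]; first exact: cat_take_drop.
by rewrite drop_size_cat // take_size_cat.
Qed.

Lemma lift_veq g m r R u u' : veq u u' -> veq (Defs.lift g m r R u) (Defs.lift g m r R u').
Proof. by move=> uu s; rewrite /Defs.lift uu. Qed.

Lemma wedge_lift g m c r R : normal_seq g m c r -> (r <= R)%N ->
  veq (Defs.lift g m r R (wedge c r)) (coef [:: (1, map c (iota 0 R))]).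
Proof.
move=> [cg _] rR s; rewrite /wedge lift_coef /words_of_size /= ?size_map ?size_iota ?eqxx //.
congr (coef [:: (1, _)] s); rewrite -{2}(subnKC rR) iotaD map_cat add0n; congr (_ ++ _).
have -> : iota r (R - r) = map (addn r) (iota 0 (R - r)) by rewrite -iotaDl addn0.
rewrite -map_comp; apply: eq_map => i /=.
by rewrite cg ?leq_addr.
Qed.

Lemma evalF_wterm g m R l : List.Forall (fun p => normal_seq g m p.1.2 p.2) l ->
  levels_le R (wterm l) ->
  veq (evalF g m R (wterm l)) (coef [seq (p.1.1, map p.1.2 (iota 0 R)) | p <- l]).
Proof.
elim: l => [|[[c w] r] l IH] ln lR s; first by rewrite coef_lsumE.
have /andP[rR {}lR] := lR.
rewrite /evalF /= /vadd -/(evalF g m R (wterm l) s) (IH (List.Forall_inv_tail ln) lR).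
rewrite -cat1s coef_cat; congr (_ + _).
rewrite /vscale (wedge_lift (List.Forall_inv ln) rR) !coef_lsumE lsum_single.
by rewrite /lsum /= addr0.
Qed.

Lemma latt_lift g m r R w : latt r w -> (r <= R)%N ->
  exists l, lattice_comb R l /\ veq (Defs.lift g m r R w) (coef l).
Proof.
move=> [l [lP wl]] rR.
have lr : words_of_size r l.
  by elim: lP {wl} => //= p {}l [_ pr] _ IH; rewrite /words_of_size /= pr eqxx.
exists [seq (p.1, p.2 ++ vtail g m r (R - r)) | p <- l]; split; last first.
  by move=> s; rewrite (lift_veq _ _ _ _ wl) lift_coef.
elim: lP {wl lr} => [|p {}l [pA pr] _ IH]; constructor => //=; split=> //.
by rewrite size_cat pr /vtail size_map size_iota subnKC.
Qed.

Lemma lattice_scale n c l : inA c -> lattice_comb n l -> lattice_comb n (lscale c l).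
Proof.
move=> cA; elim=> [|p {}l [pA pn] _ IH]; constructor => //=; split=> //.
exact: inAM.
Qed.

Lemma lattice_cat n l l' : lattice_comb n l -> lattice_comb n l' -> lattice_comb n (l ++ l').
Proof. by move=> ? ?; apply/List.Forall_app. Qed.

Lemma evalF_inLterm g m R n (y : fterm) : inLterm y -> levels_le R (scaleF (q ^+ n) y) ->
  exists l, lattice_comb R l /\ veq (evalF g m R (scaleF (q ^+ n) y)) (coef (lscale (q ^+ n) l)).
Proof.
elim=> [|[c [r w]] {}y [cA wL] _ IH] yR; first by exists [::]; split=> [|s]; rewrite
  ?coef_lsumE //; constructor.
have /andP[rR {}yR] := yR.
have [l [lP yl]] := IH yR; have [l' [lP' wl']] := latt_lift g m wL rR.
exists (lscale c l' ++ l); split.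
  by apply: lattice_cat => //; apply: lattice_scale.
move=> s; rewrite coef_scale coef_cat mulrDr coef_scale -(coef_scale _ l) -yl.
by rewrite /evalF /= /vadd /vscale wl' -mulrA.
Qed.

Lemma energy_bd e k k' w : 0 < energy k k' ->
  sorted <%R (bd (e + kap k.2 (k'.2 :: map snd w)) (k' :: w)) ->
  sorted <%R (bd e (k :: k' :: w)).
Proof.
move=> ek; rewrite /= => ->; rewrite andbT.
by move: ek; rewrite /energy /kappa /kj; lia.
Qed.

Lemma normal_word_map g m c r n : normal_seq g m c r -> normal_word (map c (iota 0 n)).
Proof.
move=> [_ cE]; rewrite /normal_word; move: 0%N 0 => i e.
elim: n i e => // -[|n] IH i e //.
by apply: energy_bd (cE i) _; exact: IH.
Qed.

(** Once q^N clears the denominators of all coefficients, they are shown divisible by every power of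
    q; [val0_divisible] then makes them zero. *)
Lemma normal_wedges_independent g m (l : seq (K * (nat -> key) * nat)) :
  List.Forall (fun p => normal_seq g m p.1.2 p.2) l ->
  (forall i j : nat, (i < size l)%N -> (j < size l)%N -> i <> j ->
     exists k : nat, (nth (0, (fun _ => v0key), 0%N) l i).1.2 k <>
                     (nth (0, (fun _ => v0key), 0%N) l j).1.2 k) ->
  Fock_zero g m (wterm l) -> List.Forall (fun p => p.1.1 = 0) l.
Proof.
move=> ln ldist lz.
have [N NA] : exists N, List.Forall (fun p : K * (nat -> key) * nat => inA (q ^+ N * p.1.1)) l.
  elim: l {ln ldist lz} => [|p l [N IH]]; first by exists 0%N; constructor.
  have [n nA] := clear_denominator p.1.1; exists (N + n)%N; constructor.
    by rewrite exprD -mulrA; apply: inAM => //; apply: inAX; exact: inA_q.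
  apply: List.Forall_impl IH => r rA; rewrite addnC exprD -mulrA.
  by apply: inAM => //; apply: inAX; exact: inA_q.
suff div n : List.Forall (fun p : K * (nat -> key) * nat =>
    exists2 d, inA d & q ^+ N * p.1.1 = q ^+ n * d) l.
  have nz p : inA (q ^+ N * p) -> (forall n, exists2 d, inA d & q ^+ N * p = q ^+ n * d) -> p = 0.
    move=> pA /(val0_divisible pA)/eqP; rewrite mulf_eq0 expf_eq0 (negbTE q_neq0) andbF /=.
    by move/eqP.
  move: NA div; elim: l {ln ldist lz} => [|p l IH] NA div; constructor.
    apply: nz; first exact: List.Forall_inv NA.
    by move=> n; exact: List.Forall_inv (div n).
  apply: IH; first exact: List.Forall_inv_tail NA.
  by move=> n; exact: List.Forall_inv_tail (div n).
elim: n => [|n IH].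
  by apply: List.Forall_impl NA => p pA; exists (q ^+ N * p.1.1); rewrite // expr0 mul1r.
have [d dl] : exists d : seq K, List.Forall2 (fun (p : K * (nat -> key) * nat) d =>
    inA d /\ q ^+ N * p.1.1 = q ^+ n * d) l d.
  elim: IH {ln ldist lz NA} => [|p {}l [d dA pd] _ [ds IH]]; first by exists [::]; constructor.
  by exists (d :: ds); constructor.
have [y [yL [R [lR [yR RN]]]]] := lz n.+1 isT.
have [ly [lyA ylE]] := evalF_inLterm g m yL yR.
pose LW := [seq (p.1.1, map p.1.2 (iota 0 R)) | p <- l].
pose D := zip d [seq map p.1.2 (iota 0 R) | p <- l].
have {}RN : Nn R (coef (LW ++ lscale (-1) (lscale (q ^+ n.+1) ly))).
  apply: Nn_veq RN => s; rewrite coef_cat coef_scale /vadd /vscale -ylE.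
  by rewrite (evalF_wterm ln lR).
have LWD s : q ^+ N * Phi R LW s = q ^+ n * Phi R D s.
  rewrite -!Phi_scale; congr (Phi R _ s); rewrite /LW /D.
  by elim: dl {ln ldist lz NA IH lR RN LW D} => //= p e l' d' [_ pe] _ ->; rewrite pe.
(* The antisymmetrizer kills the relations, so q^n times its value on [D] equals q^(N+n+1) times its
   value on the lattice element [ly]. Cancelling q^n leaves a factor q. *)
have Dv s : val0 (Phi R D s) 0.
  apply/val0_eq0; exists (q ^+ N * Phi R ly s).
    have [l0 ll0] : exists l0, at0 ly l0.
      by apply: lattice_at0; apply: List.Forall_impl lyA => p [].
    by apply: inAM (val0_inA (val0_Phi R s ll0)); apply: inAX; exact: inA_q.
  have := Aop_Nn s RN; rewrite -/(Phi R _ s) Phi_cat !Phi_scale mulN1r => /eqP.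
  rewrite subr_eq0 => /eqP LWy.
  apply: (@mulfI _ (q ^+ n)); first by rewrite expf_neq0 ?q_neq0.
  by rewrite -LWD LWy exprSr -!mulrA mulrCA; congr (_ * _); rewrite mulrCA.
have szd : size d = size l by elim: dl => //= ? ? ? ? _ _ ->.
have sndD : map snd D = [seq map p.1.2 (iota 0 R) | p <- l].
  by rewrite -/(unzip2 _) unzip2_zip // size_map szd.
have Dn : all (fun p => (size p.2 == R) && normal_word p.2) D.
  suff : all (fun w => (size w == R) && normal_word w) (map snd D) by rewrite all_map.
  rewrite sndD all_map; elim: ln {ldist lz NA IH dl lR RN LW D LWD Dv szd sndD} => //= p {}l pn
    _ ->.
  by rewrite size_map size_iota eqxx (normal_word_map _ pn).
have Du : uniq (map snd D).
  rewrite sndD; apply/(uniqP [::]) => i j; rewrite !inE size_map => il jl.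
  pose x0 : K * (nat -> key) * nat := (0, (fun _ => v0key), 0%N).
  rewrite !(nth_map x0) // => wE; apply/eqP; apply: contraT => /eqP ij.
  have [k] := ldist i j il jl ij; case; rewrite -/x0.
  (* From position R on all the sequences agree with the vacuum, so two of them differ already
     within the first R letters. *)
  have [kR|Rk] := ltnP k R.
    have := congr1 (fun w => nth v0key w k) wE.
    by rewrite /= !(nth_map 0%N) ?size_iota // !nth_iota.
  have ground i' : (i' < size l)%N -> (nth x0 l i').1.2 k = bgs g (m + Posz k).
    move: ln lR; elim: l i' {ldist lz NA IH dl RN LW D LWD Dv szd sndD Dn il jl wE} => // p l'
      IHl i' ln' /andP[pR lR'].
    case: i' => [_|i' il']; last exact: IHl (List.Forall_inv_tail ln') lR' il'.
    by have [cg _] := List.Forall_inv ln'; apply: cg; exact: leq_trans Rk.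
  by rewrite !ground.
have DA : List.Forall (fun p => inA p.1) D.
  rewrite /D; elim: dl {ln ldist lz NA IH lR RN LW D LWD Dv szd sndD Dn Du}; first by constructor.
  by move=> p e l' d' [eA _] _ IH; constructor.
have Dz := normal_indep Dn Du DA Dv.
move: Dz; rewrite /D; elim: dl {ln ldist lz NA IH lR RN LW D LWD Dv szd sndD Dn Du DA}; first
  by constructor.
move=> p e l' d' [eA pe] _ IH Dz; constructor; last exact: IH (List.Forall_inv_tail Dz).
have /val0_eq0[f fA /= eE] := List.Forall_inv Dz.
by exists f => //; rewrite pe eE exprSr mulrA.
Qed.

(** * Generators of the relations *)

Definition leqv (l l' : lvec) : Prop := forall phi : seq key -> K, lsum l phi = lsum l' phi.

Definition inN (l : lvec) : Prop := Nsp (coef l).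

Lemma inN_eqv l l' : leqv l l' -> inN l -> inN l'.
Proof.
move=> ll' lN S SP; have [[_ [_ [_ Sveq]]] _ _ _ _] := SP.
by apply: (Sveq (coef l)); [move=> s; rewrite !coef_lsumE ll' | exact: lN].
Qed.

Lemma inN_cat l l' : inN l -> inN l' -> inN (l ++ l').
Proof.
move=> lN lN' S SP; have [[_ [Sadd [_ Sveq]]] _ _ _ _] := SP.
apply: Sveq (Sadd _ _ (lN _ SP) (lN' _ SP)) => s; by rewrite coef_cat.
Qed.

Lemma inN_scale c l : inN l -> inN (lscale c l).
Proof.
move=> lN S SP; have [[_ [_ [Sscale Sveq]]] _ _ _ _] := SP.
apply: Sveq (Sscale c _ (lN _ SP)) => s; by rewrite coef_scale.
Qed.

Lemma inN_unscale c l : c != 0 -> inN (lscale c l) -> inN l.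
Proof.
move=> c0 /(inN_scale c^-1); apply: inN_eqv => phi.
by rewrite !lsum_scale mulrA mulVf // mul1r.
Qed.

Lemma inN_v0v0 : inN [:: (1, [:: mk 0 0; mk 0 0])].
Proof. by move=> S [_ _ ? _ _]. Qed.

Lemma inN_E0 l : inN l -> inN (apply2 (DE opE0 hh0) l).
Proof. by move=> lN S SP; have [_ _ _ _ [+ _ _ _ _]] := SP; apply; exact: lN. Qed.

Lemma inN_F1 l : inN l -> inN (apply2 (DF opF1 hh1) l).
Proof. by move=> lN S SP; have [_ _ _ _ [_ _ _ + _]] := SP; apply; exact: lN. Qed.

Definition sh2 (c d : int) (w : seq key) : seq key :=
  if w is [:: k1; k2] then [:: zsh c k1; zsh d k2] else w.

Definition shz c d (l : lvec) : lvec := [seq (p.1, sh2 c d p.2) | p <- l].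

Definition symz c d (l : lvec) : lvec := shz c d l ++ shz d c l.

Lemma size_sh2 c d w : size (sh2 c d w) = size w.
Proof. by case: w => [|k1 [|k2 [|k3 w]]]. Qed.

Lemma shz_words c d l : words_of_size 2 l -> words_of_size 2 (shz c d l).
Proof. by move=> l2; apply/allP => _ /mapP[p /(allP l2) p2 ->]; rewrite /= size_sh2. Qed.

Lemma symz_words c d l : words_of_size 2 l -> words_of_size 2 (symz c d l).
Proof. by move=> l2; rewrite /words_of_size all_cat; apply/andP; split; exact: shz_words. Qed.

Lemma lsum_words2 (l : lvec) (f f' : seq key -> K) : words_of_size 2 l ->
  (forall k1 k2, f [:: k1; k2] = f' [:: k1; k2]) -> lsum l f = lsum l f'.
Proof.
move=> l2 ff'; rewrite !lsumE !big_seq; apply: eq_bigr => -[c w] /(allP l2) /=.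
by case: w => [|k1 [|k2 [|k3 w]]] //= _; rewrite ff'.
Qed.

Lemma lsum_shz c d l phi : lsum (shz c d l) phi = lsum l (fun w => phi (sh2 c d w)).
Proof. exact: (lsum_map (sh2 c d)). Qed.

Lemma inN_zz l : words_of_size 2 l -> inN l -> inN (shz 1 1 l).
Proof.
move=> l2 lN S SP; have [[_ [_ [_ Sveq]]] _ _ _ [_ _ _ _ [+ _ _]]] := SP.
move=> /(_ l (lN _ SP)); apply: Sveq => s.
rewrite !coef_lsumE lsum_apply2 lsum_shz; apply: lsum_words2 => // k1 k2.
by rewrite lsum_single.
Qed.

Lemma inN_zizi l : words_of_size 2 l -> inN l -> inN (shz (-1) (-1) l).
Proof.
move=> l2 lN S SP; have [[_ [_ [_ Sveq]]] _ _ _ [_ _ _ _ [_ + _]]] := SP.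
move=> /(_ l (lN _ SP)); apply: Sveq => s.
rewrite !coef_lsumE lsum_apply2 lsum_shz; apply: lsum_words2 => // k1 k2.
by rewrite lsum_single.
Qed.

Lemma inN_zsum l : words_of_size 2 l -> inN l -> inN (symz 1 0 l).
Proof.
move=> l2 lN S SP; have [[_ [_ [_ Sveq]]] _ _ _ [_ _ _ _ [_ _ +]]] := SP.
move=> /(_ l (lN _ SP)); apply: Sveq => s.
rewrite !coef_lsumE lsum_apply2 lsum_cat !lsum_shz -lsumD; apply: lsum_words2 => // k1 k2.
rewrite -[Dzsum k1 k2]/([:: (1, _)] ++ [:: (1, _)]) lsum_cat !lsum_single /=.
by rewrite /zsh !addr0 -!surjective_pairing.
Qed.

Lemma sh2D a b c d k1 k2 : sh2 a b (sh2 c d [:: k1; k2]) = sh2 (a + c) (b + d) [:: k1; k2].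
Proof. by rewrite /= /zsh /= -!addrA (addrC c) (addrC d). Qed.

Lemma inN_shz_diag c l : words_of_size 2 l -> inN l -> inN (shz c c l).
Proof.
move=> l2 lN; have step n : inN (shz (Posz n) (Posz n) l) /\ inN (shz (- Posz n) (- Posz n) l).
  elim: n => [|n [IH IH']].
    by split; apply: inN_eqv lN => phi; rewrite lsum_shz; apply: lsum_words2 => // k1 k2;
      rewrite /= /zsh ?oppr0 !addr0 -!surjective_pairing.
  split.
    apply: inN_eqv (inN_zz (shz_words _ _ l2) IH) => phi.
    by rewrite !lsum_shz; apply: lsum_words2 => // k1 k2; rewrite sh2D -intS.
  apply: inN_eqv (inN_zizi (shz_words _ _ l2) IH') => phi.
  by rewrite !lsum_shz; apply: lsum_words2 => // k1 k2; rewrite sh2D -opprD -intS.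
by case: c => n; [exact: (step n).1 | rewrite NegzE; exact: (step n.+1).2].
Qed.

(** Newton's recursion p_(n+2) = (z_1 + z_2) p_(n+1) - z_1 z_2 p_n for p_n = z_1^n + z_2^n, starting
    at p_0 = 2, followed by a diagonal shift. *)
Lemma inN_symz c d l : words_of_size 2 l -> inN l -> inN (symz c d l).
Proof.
move=> l2 lN.
have step n : inN (symz (Posz n) 0 l) /\ inN (symz (Posz n.+1) 0 l).
  elim: n => [|n [IH IH1]].
    by split; [apply: inN_cat; exact: inN_shz_diag | exact: inN_zsum].
  split=> //.
  have := inN_cat (inN_zsum (symz_words _ _ l2) IH1)
    (inN_scale (-1) (inN_zz (symz_words _ _ l2) IH)).
  apply: inN_eqv => phi; rewrite lsum_cat lsum_scale !lsum_cat !lsum_shz !lsum_cat !lsum_shz.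
  have E a b c' d' : lsum l (fun w => phi (sh2 a b (sh2 c' d' w))) =
      lsum l (fun w => phi (sh2 (a + c') (b + d') w)).
    by apply: lsum_words2 => // k1 k2; rewrite sh2D.
  rewrite !E !addr0 !add0r -!intS.
  by move: (lsum _ _) (lsum _ _) (lsum _ _) (lsum _ _) => *; ring.
have ge c' d' : d' <= c' -> inN (symz c' d' l).
  move=> dc; have [n nE] : exists n, c' = Posz n + d' by exists `|c' - d'|%N; lia.
  apply: inN_eqv (inN_shz_diag d' (symz_words _ _ l2) (step n).1) => phi.
  rewrite lsum_shz !lsum_cat !lsum_shz nE; congr (_ + _); apply: lsum_words2 => // k1 k2;
  by rewrite sh2D ?addr0 // addrC.
have [/ge//|/ltW/ge] := leP d c.
by apply: inN_eqv => phi; rewrite !lsum_cat addrC.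
Qed.

Lemma opF1_0 a : opF1 (mk a 0) = Some (1, mk a 1).
Proof. by rewrite /opF1 kj_mk //= qint1. Qed.
Lemma opF1_1 a : opF1 (mk a 1) = Some (q + q^-1, mk a 2).
Proof. by rewrite /opF1 kj_mk //= qint2. Qed.
Lemma opF1_2 a : opF1 (mk a 2) = None.
Proof. by rewrite /opF1 kj_mk. Qed.
Lemma opE0_0 a : opE0 (mk a 0) = Some (1, mk (a + 1) 1).
Proof. by rewrite /opE0 kj_mk //= qint1. Qed.
Lemma opE0_1 a : opE0 (mk a 1) = Some (q + q^-1, mk (a + 1) 2).
Proof. by rewrite /opE0 kj_mk //= qint2. Qed.
Lemma opE0_2 a : opE0 (mk a 2) = None.
Proof. by rewrite /opE0 kj_mk. Qed.

Definition opEF := (opF1_0, opF1_1, opF1_2, opE0_0, opE0_1, opE0_2).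

Lemma q_wt1 a j : (j < 3)%N -> q ^ pairh hh1 (mk a j) = tweight q j.
Proof. by move=> j3; rewrite pairh_h1 q_pairh kj_mk. Qed.
Lemma q_wt0 a j : (j < 3)%N -> q ^ (- pairh hh0 (mk a j)) = tweight q j.
Proof. by move=> j3; rewrite pairh_h0 opprK q_pairh kj_mk. Qed.

(** The quantum integer [3]. Like [2] and q^2 + q^-2, it appears as a factor when f_1 or e_0
    produces a generator, and has to be divided out. *)
Definition quad := q ^+ 2 + 1 + q ^- 2.

Lemma two_neq0 : q + q^-1 != 0.
Proof.
have : q ^+ 2 + 1 != 0.
  by apply: (@val0_neq0 _ (0 ^+ 2 + 1)) => //; apply: val0D val01; apply: val0X val0_q.
rewrite (_ : q ^+ 2 + 1 = q * (q + q^-1)); first by rewrite mulf_eq0 negb_or => /andP[].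
by rewrite mulrDr mulfV // q_neq0.
Qed.

Lemma quad_neq0 : quad != 0.
Proof.
have : q ^+ 4 + q ^+ 2 + 1 != 0.
  apply: (@val0_neq0 _ (0 ^+ 4 + 0 ^+ 2 + 1)) => //.
  by apply: val0D val01; apply: val0D; apply: val0X val0_q.
rewrite (_ : q ^+ 4 + q ^+ 2 + 1 = q ^+ 2 * quad); first by rewrite mulf_eq0 negb_or => /andP[].
by rewrite /quad !mulrDr mulr1 -exprD mulfV // expf_neq0 // q_neq0.
Qed.

(* gen i j is z_1^k v_i (x) v_j + O(q) with k = kappa i j. *)
Definition gen01 : lvec := [:: (1, [:: mk 0 0; mk 0 1]); (q ^+ 2, [:: mk 0 1; mk 0 0])].
Definition gen10 : lvec := [:: (1, [:: mk 1 1; mk 0 0]); (q ^+ 2, [:: mk 0 0; mk 1 1])].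
Definition gen02 : lvec := [:: (1, [:: mk 0 0; mk 0 2]); (q, [:: mk 0 1; mk 0 1]);
  (q ^+ 4, [:: mk 0 2; mk 0 0])].
Definition gen11 : lvec := [:: (1, [:: mk 1 1; mk 0 1]); (q ^+ 2, [:: mk 0 1; mk 1 1]);
  (q ^+ 3 + q, [:: mk 1 2; mk 0 0]); (q ^+ 3 + q, [:: mk 0 0; mk 1 2])].
Definition gen20 : lvec := [:: (1, [:: mk 2 2; mk 0 0]); (q, [:: mk 1 1; mk 1 1]);
  (q ^+ 4, [:: mk 0 0; mk 2 2])].
Definition gen12 : lvec := [:: (1, [:: mk 0 1; mk 0 2]); (q ^+ 2, [:: mk 0 2; mk 0 1])].
Definition gen21 : lvec := [:: (1, [:: mk 1 2; mk 0 1]); (q ^+ 2, [:: mk 0 1; mk 1 2])].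
Definition gen22 : lvec := [:: (1, [:: mk 0 2; mk 0 2])].

Ltac compute_op :=
  rewrite /apply2 /DF /DE /opt_list /= ?opEF /= ?q_wt1 ?q_wt0 // /lsum /lscale /= ?add0r
    ?addr0 ?mulr1 ?mul1r.

Lemma inN_gen01 : inN gen01.
Proof.
by apply: inN_eqv (inN_F1 inN_v0v0) => phi; compute_op; rewrite addrC.
Qed.

Lemma inN_gen10 : inN gen10.
Proof. by apply: inN_eqv (inN_E0 inN_v0v0) => phi; compute_op. Qed.

Section GeneratorIdentities.
Variables (F : fieldType) (Q : F).
Hypothesis Q0 : Q != 0.
Implicit Types a b c d : F.

Fact gen02_identity a b c :
  b + ((Q + Q^-1) * a + (Q ^+ 2 * ((Q + Q^-1) * Q ^+ 2) * c + Q ^+ 2 * b)) =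
  (Q + Q^-1) * a + ((Q + Q^-1) * Q * b + (Q + Q^-1) * Q ^+ 4 * c).
Proof. by field. Qed.

Fact gen12_identity a b :
  Q ^- 2 * a + (Q * (Q + Q^-1) * b + (Q * (Q + Q^-1) * a + Q ^+ 4 * b)) =
  (Q ^+ 2 + 1 + Q ^- 2) * a + (Q ^+ 2 + 1 + Q ^- 2) * Q ^+ 2 * b.
Proof. by field. Qed.

Fact gen22_identity a :
  (Q + Q^-1) / Q ^+ 2 * a + Q ^+ 2 * (Q + Q^-1) * a = (Q + Q^-1) * (Q ^+ 2 + Q ^- 2) * a.
Proof. by field. Qed.

Fact gen11_identity a b c d :
  (Q + Q^-1) * Q ^+ 2 * c + (a + (Q ^+ 2 * b + Q ^+ 2 * (Q + Q^-1) * d)) =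
  a + (Q ^+ 2 * b + ((Q ^+ 3 + Q) * c + (Q ^+ 3 + Q) * d)).
Proof. by field. Qed.

Fact gen20_identity a b c :
  (Q + Q^-1) * a + (b + (Q ^+ 2 * b + Q ^+ 2 * (Q ^+ 2 * (Q + Q^-1)) * c)) =
  (Q + Q^-1) * a + ((Q + Q^-1) * Q * b + (Q + Q^-1) * Q ^+ 4 * c).
Proof. by field. Qed.

Fact gen21_identity a b c d :
  a + (Q * (Q + Q^-1) * b + (Q * (Q + Q^-1) * c + Q ^+ 4 / Q ^+ 2 * d)) +
  -1 * (a + (Q ^+ 2 * b + (c + Q ^+ 2 * d))) = b + Q ^+ 2 * c.
Proof. by field. Qed.

Fact quart_identity : Q ^+ 4 + 1 = Q ^+ 2 * (Q ^+ 2 + Q ^- 2).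
Proof. by field. Qed.

End GeneratorIdentities.

Lemma inN_gen02 : inN gen02.
Proof.
apply: (inN_unscale two_neq0); apply: inN_eqv (inN_F1 inN_gen01) => phi; compute_op.
exact: gen02_identity q_neq0 _ _ _.
Qed.

Lemma inN_gen12 : inN gen12.
Proof.
apply: (inN_unscale quad_neq0); apply: inN_eqv (inN_F1 inN_gen02) => phi; compute_op.
exact: gen12_identity q_neq0 _ _.
Qed.

Lemma quart_neq0 : q ^+ 2 + q ^- 2 != 0.
Proof.
have h : q ^+ 4 + 1 != 0.
  by apply: (@val0_neq0 _ (0 ^+ 4 + 1)) => //; apply: val0D val01; apply: val0X val0_q.
have e : q ^+ 4 + 1 = q ^+ 2 * (q ^+ 2 + q ^- 2).
  exact: quart_identity q_neq0.
by move: h; rewrite e mulf_eq0 negb_or => /andP[].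
Qed.

Lemma inN_gen22 : inN gen22.
Proof.
apply: (@inN_unscale ((q + q^-1) * (q ^+ 2 + q ^- 2))).
  by apply: mulf_neq0; [exact: two_neq0 | exact: quart_neq0].
apply: inN_eqv (inN_F1 inN_gen12) => phi; compute_op.
exact: gen22_identity q_neq0 _.
Qed.

Lemma inN_gen11 : inN gen11.
Proof.
apply: inN_eqv (inN_F1 inN_gen10) => phi; compute_op.
exact: gen11_identity q_neq0 _ _ _ _.
Qed.

Lemma inN_gen20 : inN gen20.
Proof.
apply: (inN_unscale two_neq0); apply: inN_eqv (inN_E0 inN_gen10) => phi; compute_op.
exact: gen20_identity q_neq0 _ _ _.
Qed.

(** Here e_0 applied to [gen02] yields [gen21] plus (z_1 + z_2) [gen12], and the second summand is
    already known to lie in N. *)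
Lemma inN_gen21 : inN gen21.
Proof.
have gen12_2 : words_of_size 2 gen12 by [].
have := inN_cat (inN_E0 inN_gen02) (inN_scale (-1) (inN_zsum gen12_2 inN_gen12)).
apply: inN_eqv => phi; rewrite lsum_cat lsum_scale; compute_op.
rewrite /zsh /mk /= ?add0r ?addr0 -!/(mk _ _).
exact: gen21_identity q_neq0 _ _ _ _.
Qed.

Lemma lsum_cons (R : comPzRingType) I (p : R * I) L f : lsum (p :: L) f = p.1 * f p.2 + lsum L f.
Proof. by []. Qed.

Definition between (lo hi : int) (k : key) : bool := (lo <= k.1) && (k.1 <= hi).

Definition pair_ok (k1 k2 : key) (p : K * seq key) : Prop :=
  inA p.1 /\ exists k k', [/\ p.2 = [:: k; k'], between k2.1 k1.1 k, between k2.1 k1.1 k',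
    k.1 + k'.1 = k1.1 + k2.1 & (kj k + kj k' = kj k1 + kj k2)%N].

Definition gen_ok (i j : nat) (p : K * seq key) : Prop :=
  inA p.1 /\ exists c d i' j', [/\ p.2 = [:: mk (Posz c) i'; mk (Posz d) j'],
    (c + d = kappa i j)%N, (i' < 3)%N, (j' < 3)%N & (i' + j' = i + j)%N].

Fact kappaE : ((kappa 0 0 = 0%N) * (kappa 0 1 = 0%N) * (kappa 0 2 = 0%N) *
  (kappa 1 0 = 1%N) * (kappa 1 1 = 1%N) * (kappa 1 2 = 0%N) *
  (kappa 2 0 = 2%N) * (kappa 2 1 = 1%N) * (kappa 2 2 = 0%N))%type.
Proof. by []. Qed.

Lemma generator i j : (i < 3)%N -> (j < 3)%N -> exists r : lvec,
  inN ((1, [:: mk (Posz (kappa i j)) i; mk 0 j]) :: lscale q r) /\ List.Forall (gen_ok i j) r.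
Proof.
have qA := inA_q.
have q2A : inA (q ^+ 2 + 1) by apply: inAD (inA_nat 1); exact: inAX.
case: i => [|[|[|i]]]; case: j => [|[|[|j]]] // _ _; rewrite ?kappaE.
- by exists [::]; split; [exact: inN_v0v0 | constructor].
- exists [:: (q, [:: mk 0 1; mk 0 0])]; split.
    by apply: inN_eqv inN_gen01 => phi; rewrite /lscale /gen01 /lsum /=; ring.
  by constructor; [split=> //; exists 0%N, 0%N, 1%N, 0%N | constructor].
- exists [:: (1, [:: mk 0 1; mk 0 1]); (q ^+ 3, [:: mk 0 2; mk 0 0])]; split.
    by apply: inN_eqv inN_gen02 => phi; rewrite /lscale /gen02 /lsum /=; ring.
  constructor; first by split; [exact: (inA_nat 1) | exists 0%N, 0%N, 1%N, 1%N].
  by constructor; [split; [exact: inAX | exists 0%N, 0%N, 2%N, 0%N] | constructor].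
- exists [:: (q, [:: mk 0 0; mk 1 1])]; split.
    by apply: inN_eqv inN_gen10 => phi; rewrite /lscale /gen10 /lsum /=; ring.
  by constructor; [split=> //; exists 0%N, 1%N, 0%N, 1%N | constructor].
- exists [:: (q, [:: mk 0 1; mk 1 1]); (q ^+ 2 + 1, [:: mk 1 2; mk 0 0]);
            (q ^+ 2 + 1, [:: mk 0 0; mk 1 2])]; split.
    by apply: inN_eqv inN_gen11 => phi; rewrite /lscale /gen11 /lsum /=; ring.
  constructor; first by split=> //; exists 0%N, 1%N, 1%N, 1%N.
  constructor; first by split=> //; exists 1%N, 0%N, 2%N, 0%N.
  by constructor; [split=> //; exists 0%N, 1%N, 0%N, 2%N | constructor].
- exists [:: (q, [:: mk 0 2; mk 0 1])]; split.
    by apply: inN_eqv inN_gen12 => phi; rewrite /lscale /gen12 /lsum /=; ring.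
  by constructor; [split=> //; exists 0%N, 0%N, 2%N, 1%N | constructor].
- exists [:: (1, [:: mk 1 1; mk 1 1]); (q ^+ 3, [:: mk 0 0; mk 2 2])]; split.
    by apply: inN_eqv inN_gen20 => phi; rewrite /lscale /gen20 /lsum /=; ring.
  constructor; first by split; [exact: (inA_nat 1) | exists 1%N, 1%N, 1%N, 1%N].
  by constructor; [split; [exact: inAX | exists 0%N, 2%N, 0%N, 2%N] | constructor].
- exists [:: (q, [:: mk 0 1; mk 1 2])]; split.
    by apply: inN_eqv inN_gen21 => phi; rewrite /lscale /gen21 /lsum /=; ring.
  by constructor; [split=> //; exists 0%N, 1%N, 1%N, 2%N | constructor].
by exists [::]; split; [exact: inN_gen22 | constructor].
Qed.

(** The same indices with the two shifted exponents exchanged. *)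
Definition swap_word (k1 k2 : key) : seq key :=
  [:: (k2.1 + Posz (kappa (kj k1) (kj k2)), k1.2); (k1.1 - Posz (kappa (kj k1) (kj k2)), k2.2)].

Lemma zsh_mk c a j : zsh c (mk a j) = mk (a + c) j.
Proof. by []. Qed.

(** Multiply the generator with the indices of k1, k2 by z_1^c z_2^d + z_1^d z_2^c, where d is the
    exponent of k2 and c that of k1 minus kappa. Its leading term gives the pair and the swapped
    pair. Nonpositive energy means d <= c, so the exponents of all corrections lie between d and c +
    kappa. *)
Lemma pair_relation k1 k2 : energy k1 k2 <= 0 -> exists r : lvec,
  inN ((1, [:: k1; k2]) :: (1, swap_word k1 k2) :: lscale q r) /\
  List.Forall (pair_ok k1 k2) r.
Proof.
rewrite /energy -/(kappa (kj k1) (kj k2)) => E.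
have [r [rN rP]] := generator (kj_lt3 k1) (kj_lt3 k2).
set ka := kappa _ _ in rN rP E.
pose c := k1.1 - Posz ka.
exists (symz c k2.1 r); split; last first.
  have ok c' d' : (c' = c /\ d' = k2.1) \/ (c' = k2.1 /\ d' = c) ->
      List.Forall (pair_ok k1 k2) (shz c' d' r).
    move=> cd; elim: rP {rN} => [|p {}r [pA [a [b [i [j [pE ab i3 j3 ij]]]]]] _ IH];
      constructor=> //.
    split=> //=; rewrite pE; exists (mk (Posz a + c') i), (mk (Posz b + d') j).
    rewrite !kj_mk // ij; split=> //; rewrite /between /=;
      by move: cd; rewrite /c; lia.
  by apply/List.Forall_app; split; apply: ok; [left | right].
have r2 : words_of_size 2 ((1, [:: mk (Posz ka) (kj k1); mk 0 (kj k2)]) :: lscale q r).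
  by elim: rP {rN} => //= p {}r [_ [a [b [i [j [-> _ _ _ _]]]]]] _.
apply: inN_eqv (inN_symz c k2.1 r2 rN) => phi.
rewrite !lsum_cat !lsum_shz /shz !lsum_cons !lsum_scale !lsum_cat !lsum_shz /=.
rewrite !zsh_mk add0r [Posz ka + c]addrC subrK -!key_eta.
have -> : swap_word k1 k2 = [:: mk (Posz ka + k2.1) (kj k1); mk (0 + c) (kj k2)].
  by rewrite /swap_word -/ka /mk /kj !inord_val add0r [Posz ka + _]addrC.
by ring.
Qed.

(** * Straightening *)

Definition inNn (n : nat) (l : lvec) : Prop := Nn n (coef l).

Lemma leqv_coef l l' : leqv l l' -> veq (coef l) (coef l').
Proof. by move=> ll' s; rewrite !coef_lsumE ll'. Qed.

Lemma inNn_eqv n l l' : leqv l l' -> inNn n l -> inNn n l'.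
Proof. by move=> /leqv_coef; exact: Nn_veq. Qed.

Lemma inNn_nil n : inNn n [::].
Proof. by exists [::]; split=> [|s]; [constructor | rewrite coef_lsumE]. Qed.

Lemma vsum_cat (l l' : seq vec) s : vsum (l ++ l') s = vsum l s + vsum l' s.
Proof. by elim: l => [|f l IH] /=; rewrite ?add0r // /vadd IH addrA. Qed.

Lemma inNn_cat n l l' : inNn n l -> inNn n l' -> inNn n (l ++ l').
Proof.
move=> [G [GP lE]] [G' [GP' lE']]; exists (G ++ G'); split; first by apply/List.Forall_app.
by move=> s; rewrite coef_cat map_cat vsum_cat lE lE'.
Qed.

Lemma inNn_scale n c l : inNn n l -> inNn n (lscale c l).
Proof.
move=> [G [GP lE]]; exists [seq Build_Ngen (c * ncoef p) (nleft p) (nmid p) (nright p) | p <- G].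
split; first by elim: GP {lE} => //= p {}G; constructor.
move=> s; rewrite coef_scale lE; elim: G {GP lE} => [|p G IH] /=; first exact: mulr0.
by rewrite /vadd /vscale mulrDr IH mulrA.
Qed.

Lemma inNn_insl t l t' : words_of_size 2 l -> inN l -> inNn (size t + 2 + size t') (insl t l t').
Proof.
move=> l2 lN; exists [:: Build_Ngen 1 t (coef l) t']; split.
  by constructor; [split | constructor].
by move=> s; rewrite /= /vadd /vscale mul1r addr0 ins_coef.
Qed.

(** For maps that act only on the letters around a relation, such as adding a prefix or a suffix. *)
Lemma inNn_map (h : seq key -> seq key) n n' l :
  (forall t t', (size t + 2 + size t')%N = n -> exists u u',
    (size u + 2 + size u')%N = n' /\ forall w, h (t ++ w ++ t') = u ++ w ++ u') ->
  inNn n l -> inNn n' [seq (p.1, h p.2) | p <- l].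
Proof.
move=> hP [G [GP lE]].
suff [L [EL NL]] : exists L : lvec,
    veq (vsum [seq vscale (ncoef p) (ins (nleft p) (nmid p) (nright p)) | p <- G]) (coef L) /\
    inNn n' [seq (p.1, h p.2) | p <- L].
  apply: inNn_eqv NL => phi; rewrite !(lsum_map h); apply: eq_coef_lsum => s.
  by rewrite lE EL.
elim: GP {lE} => [|p {}G [pN pn] _ [L [EL NL]]].
  by exists [::]; split; [move=> s; rewrite coef_lsumE | exact: inNn_nil].
have [l2 [l2s fl2 _]] := Nsp_fixed pN.
exists (lscale (ncoef p) (insl (nleft p) l2 (nright p)) ++ L); split.
  move=> s; rewrite /= coef_cat /vadd EL; congr (_ + _).
  rewrite coef_scale /vscale -(ins_coef _ _ l2s); congr (_ * _).
  by rewrite /ins; case: ifP => // _; rewrite fl2.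
rewrite map_cat; apply: inNn_cat NL.
have [u [u' [un hu]]] := hP _ _ pn.
have l2N : inN l2 by move=> S SP; have [[_ [_ [_ Sveq]]] _ _ _ _] := SP; apply: Sveq fl2 (pN _
  SP).
rewrite -un; apply: inNn_eqv (inNn_scale (ncoef p) (inNn_insl u u' l2s l2N)) => phi.
rewrite lsum_scale (lsum_map h) lsum_scale; congr (_ * _).
rewrite /insl (lsum_map (fun w => u ++ w ++ u')) (lsum_map (fun w => nleft p ++ w ++ nright p)).
by apply: eq_lsum => w /=; rewrite hu.
Qed.

Lemma inNn_prefix t n l : inNn n l -> inNn (size t + n) [seq (p.1, t ++ p.2) | p <- l].
Proof.
apply: (inNn_map (h := cat t)) => u u' <-; exists (t ++ u), u'.
by split=> [|w]; rewrite ?size_cat ?addnA // catA.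
Qed.

Lemma inNn_suffix t n l : inNn n l -> inNn (n + size t) [seq (p.1, p.2 ++ t) | p <- l].
Proof.
apply: (inNn_map (h := cat^~ t)) => u u' <-; exists u, (u' ++ t).
by split=> [|w]; rewrite ?size_cat ?addnA // -!catA.
Qed.

Definition jdeg (w : seq key) : nat := (\sum_(k <- w) kj k)%N.

Definition same_weight (lo hi : int) (w u : seq key) : Prop :=
  [/\ size u = size w, zdeg u = zdeg w, jdeg u = jdeg w & all (between lo hi) u].

Lemma same_weight_trans lo hi w u v : same_weight lo hi w u -> same_weight lo hi u v ->
  same_weight lo hi w v.
Proof.
move=> [su zu ju _] [sv zv jv bv]; split=> //; [exact: etrans sv su|exact: etrans zv zu|exact:
  etrans jv ju].
Qed.

Definition sim_comb lo hi w (r : lvec) : Prop :=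
  List.Forall (fun p => inA p.1 /\ same_weight lo hi w p.2) r.

Lemma same_weight_pair lo hi t t' k1 k2 k k' : all (between lo hi) (t ++ [:: k1; k2] ++ t') ->
  between k2.1 k1.1 k -> between k2.1 k1.1 k' -> k.1 + k'.1 = k1.1 + k2.1 ->
  (kj k + kj k' = kj k1 + kj k2)%N ->
  same_weight lo hi (t ++ [:: k1; k2] ++ t') (t ++ [:: k; k'] ++ t').
Proof.
rewrite !all_cat /= => /and3P[bt /and3P[b1 b2 _] bt'] bk bk' ek ej; split.
- by rewrite !size_cat.
- by rewrite /zdeg !big_cat /= !big_cons; congr (_ + _); rewrite !addrA ek.
- by rewrite /jdeg !big_cat /= !big_cons; congr (_ + _)%N; rewrite !addnA ej.
rewrite !all_cat /= bt bt' /= !andbT.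
by move: b1 b2 bk bk'; rewrite /between; lia.
Qed.

Lemma straighten_step lo hi t k1 k2 t' : all (between lo hi) (t ++ [:: k1; k2] ++ t') ->
  energy k1 k2 <= 0 -> exists r,
  [/\ inNn (size (t ++ [:: k1; k2] ++ t'))
        ((1, t ++ [:: k1; k2] ++ t') :: (1, t ++ swap_word k1 k2 ++ t') :: lscale q r),
      same_weight lo hi (t ++ [:: k1; k2] ++ t') (t ++ swap_word k1 k2 ++ t') &
      sim_comb lo hi (t ++ [:: k1; k2] ++ t') r].
Proof.
move=> bw E; have [r [rN rP]] := pair_relation E.
exists (insl t r t'); split.
- rewrite !size_cat addnA.
  have r2 : words_of_size 2 ((1, [:: k1; k2]) :: (1, swap_word k1 k2) :: lscale q r).
    by elim: rP {rN} => //= p {}r [_ [k [k' [-> _ _ _ _]]]] _.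
  apply: inNn_eqv (inNn_insl t t' r2 rN) => phi.
  rewrite /insl (lsum_map (fun w => t ++ w ++ t')) !lsum_cons !lsum_scale.
  by rewrite (lsum_map (fun w => t ++ w ++ t')).
- move: E; rewrite /energy -/(kappa (kj k1) (kj k2)).
  rewrite /swap_word; move: (kappa _ _) => ka E.
  by apply: same_weight_pair; rewrite // /between /kj /=; lia.
elim: rP {rN} => [|p {}r [pA [k [k' [pE bk bk' ek ej]]]] _ IH]; constructor=> //.
by split=> //=; rewrite pE; exact: same_weight_pair.
Qed.

Fixpoint inv_count (b : seq int) : nat :=
  if b is x :: b' then (count (fun y => y < x)%R b' + inv_count b')%N else 0%N.

Lemma inv_count_swap b x y b' : y < x ->
  (inv_count (b ++ y :: x :: b') < inv_count (b ++ x :: y :: b'))%N.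
Proof.
move=> yx; elim: b => [|z b IH] /=.
  by rewrite yx ltNge (ltW yx) /=; lia.
have -> : count (fun u => u < z)%R (b ++ y :: x :: b') = count (fun u => u < z)%R (b ++ x :: y
  :: b').
  by rewrite !count_cat /=; lia.
by rewrite ltn_add2l.
Qed.

Lemma map_snd_swap k1 k2 t t' :
  map snd (t ++ swap_word k1 k2 ++ t') = map snd (t ++ [:: k1; k2] ++ t').
Proof. by rewrite !map_cat. Qed.

Lemma bd_swap e t k1 k2 t' : exists b x y b',
  [/\ bd e (t ++ [:: k1; k2] ++ t') = b ++ x :: y :: b',
      bd e (t ++ swap_word k1 k2 ++ t') = b ++ y :: x :: b' & y - x = energy k1 k2].
Proof.
elim: t e => [|k t IH] e; last first.
  have [b [x [y [b' [E1 E2 E3]]]]] := IH (e + kap k.2 (map snd (t ++ [:: k1; k2] ++ t'))).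
  exists ((k.1 + e) :: b), x, y, b'; split=> //; rewrite /= -?E1 // map_snd_swap.
  by rewrite E2.
exists [::], (k1.1 + e), (k2.1 + (e + Posz (kappa (kj k1) (kj k2)))), (bd (e +
  Posz (kappa (kj k1) (kj k2)) + kap k2.2 (map snd t')) t').
split=> //; last by rewrite /energy /kappa; lia.
rewrite /swap_word /= -/(kj k1) -/(kj k2); congr [:: _, _ & _]; lia.
Qed.

Lemma not_normal w : ~~ normal_word w -> exists t k1 k2 t',
  w = t ++ [:: k1; k2] ++ t' /\ energy k1 k2 <= 0.
Proof.
rewrite /normal_word; move: {1}0; elim: w => // k [|k' w] IH e //.
rewrite [sorted _ _]/(path _ _ _) /= negb_and => /orP[kk'|kw].
  exists [::], k, k', w; split=> //.
  by move: kk'; rewrite /energy /kappa /kj; lia.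
have [t [k1 [k2 [t' [-> E]]]]] := IH _ kw.
by exists (k :: t), k1, k2, t'.
Qed.

Lemma inA_half : inA 2%:R^-1.
Proof. by apply: val0_inA (val0V _ (val0_nat 2)). Qed.

Lemma sim_scale lo hi w c r : inA c -> sim_comb lo hi w r -> sim_comb lo hi w (lscale c r).
Proof.
by move=> cA; elim=> [|p {}r [pA pw] _ IH]; constructor => //=; split=> //; exact: inAM.
Qed.

Fact half_identity (R : comPzRingType) (h x a b : R) : h + h = 1 ->
  h * (1 * a + (1 * a + x * b)) = 1 * a + x * (h * b).
Proof. by move=> hh; rewrite -[in RHS]hh; ring: hh. Qed.

(** Bubble sort of the shifted exponents modulo q: each swap lowers the number of inversions, and at
    most one sorted word is left. Weight and permutation are recorded for the weight argument, the
    bounds for the finiteness needed by Nakayama's lemma. *)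
Lemma straighten lo hi w : all (between lo hi) w -> exists l r,
  [/\ inNn (size w) ((1, w) :: l ++ lscale q r), sim_comb lo hi w r &
      l = [::] \/ exists c b, [/\ l = [:: (c, wd 0 (map snd w) b)], inA c, sorted <%R b,
        perm_eq b (bd 0 w) & same_weight lo hi w (wd 0 (map snd w) b)]].
Proof.
have [n] := ubnP (inv_count (bd 0 w)); elim: n w => // n IH w; rewrite ltnS => wn bw.
have [nw|/not_normal[t [k1 [k2 [t' [wE E]]]]]] := boolP (normal_word w).
  exists [:: (-1, w)], [::]; split; last first.
  - by right; exists (-1), (bd 0 w); rewrite bdK; split=> //; exact: inAN (inA_nat 1).
  - by constructor.
  apply: inNn_eqv (inNn_nil _) => phi; rewrite /= /lsum /=; ring.
rewrite wE in bw wn *.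
have [r [rN sim rP]] := straighten_step bw E.
have [b [x [y [b' [bE bE' xy]]]]] := bd_swap 0 t k1 k2 t'.
(* Equal shifted exponents: the swapped word is the word itself, so the relation shows that twice
   the word lies in q L modulo relations, and 2 is a unit of A. *)
have [E0|En0] := eqVneq (energy k1 k2) 0.
  exists [::], (lscale 2%:R^-1 r); split; [|exact: sim_scale inA_half rP|by left].
  have sE : swap_word k1 k2 = [:: k1; k2].
    move: E0; rewrite /swap_word /energy -/(kappa (kj k1) (kj k2)).
    case: k1 k2 {wE bw wn E rN sim rP bE bE' xy} => [a i] [a' j] /= E0.
    by congr [:: (_, _); (_, _)]; lia.
  rewrite sE in rN; apply: inNn_eqv (inNn_scale 2%:R^-1 rN) => phi.
  rewrite cat0s lsum_scale !lsum_cons !lsum_scale /=.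
  have half : 2%:R^-1 + 2%:R^-1 = 1 :> K by rewrite -mulr2n -(mulr_natr 2%:R^-1) mulVf //
    (val0_neq0 _ (val0_nat 2)).
  exact: half_identity.
have x_lt_y : y < x by move: E En0; rewrite -xy; lia.
have [_ _ _ bw'] := sim.
have wn' : (inv_count (bd 0 (t ++ swap_word k1 k2 ++ t')) < n)%N.
  by apply: leq_trans wn; rewrite bE bE'; exact: inv_count_swap.
have [l [r' [rN' rP' lP]]] := IH _ wn' bw'.
have [sw _ _ _] := sim; rewrite sw in rN'.
exists (lscale (-1) l), (r ++ lscale (-1) r'); split.
- apply: inNn_eqv (inNn_cat rN (inNn_scale (-1) rN')) => phi.
  rewrite !lsum_cat !lsum_cons !(lsum_scale, lsum_cat, lsum_cons) /=; ring.
- apply/List.Forall_app; split=> //; apply: sim_scale; first exact: inAN (inA_nat 1).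
  by apply: List.Forall_impl rP' => p [pA pw]; split=> //; exact: same_weight_trans sim pw.
case: lP => [->|[c [b0 [-> cA b0s b0p b0w]]]]; [by left | right].
rewrite map_snd_swap in b0w *; exists (-1 * c), b0; split=> //.
- by apply: inAM => //; exact: inAN (inA_nat 1).
- apply: perm_trans b0p _; rewrite bE bE' perm_cat2l.
  by rewrite -[[:: y, x & b']]/([:: y] ++ [:: x] ++ b') perm_catCA.
- exact: same_weight_trans sim b0w.
Qed.

(** * Nakayama's lemma on finite sets of words *)

Lemma fin_words lo hi n : exists X : seq (seq key), uniq X /\
  forall w, (w \in X) = (size w == n) && all (between lo hi) w.
Proof.
have [Ks KsE] : exists Ks : seq key, forall k, (k \in Ks) = between lo hi k.
  exists (if lo <= hi then
    [seq (lo + Posz a, j) | a <- iota 0 `|(hi - lo + 1)%R|%N, j <- enum 'I_3] else [::]).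
  move=> [a j]; rewrite /between /=; case: ifP => lh; last by rewrite in_nil; lia.
  apply/allpairsP/idP => [[[i j'] /= [+ _ [-> _]]]|aj]; first by rewrite mem_iota; lia.
  exists (`|(a - lo)%R|%N, j) => /=; split.
  - by rewrite mem_iota; lia.
  - by rewrite mem_enum.
  by congr (_, _); lia.
suff [X XE] : exists X : seq (seq key), forall w, (w \in X) = (size w == n) && all (between lo
  hi) w.
  by exists (undup X); split; [exact: undup_uniq | move=> w; rewrite mem_undup].
elim: n => [|n [X XE]]; first by exists [:: [::]] => -[|k w]; rewrite inE.
exists [seq k :: w | k <- Ks, w <- X] => -[|k w].
  by apply/allpairsP => -[[k w] []].
rewrite /= eqSS; apply/allpairsP/idP => [[[k' w'] /= [kK wX [-> ->]]]|].
  by rewrite -KsE kK; move: wX; rewrite XE.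
by move=> /and3P[wn bk bw]; exists (k, w); rewrite /= KsE XE wn bk bw.
Qed.

(** A vector in the kernel satisfies v = - q v M; iterating makes its entries, cleared of
    denominators, divisible by every power of q. *)
Lemma nakayama_unit n (M : 'M[K]_n) : (forall i j, inA (M i j)) -> 1%:M + q *: M \in unitmx.
Proof.
move=> MA; rewrite -row_free_unit; apply: inj_row_free => v.
rewrite mulmxDr mulmx1 -scalemxAr => /eqP; rewrite addr_eq0 => /eqP vE.
have [d dA] := fin_all_exists (fun j => clear_denominator (v 0 j)).
have [N NA] : exists N, forall j, inA (q ^+ N * v 0 j).
  exists (\sum_j d j)%N => j; rewrite (bigD1 j) //= addnC exprD -mulrA.
  by apply: inAM => //; apply: inAX; exact: inA_q.
have div k : exists2 g : 'rV[K]_n, forall j, inA (g 0 j) & q ^+ N *: v = q ^+ k *: g.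
  elim: k => [|k [g gA gE]].
    by exists (q ^+ N *: v); [move=> j; rewrite mxE | rewrite expr0 scale1r].
  exists (- (g *m M)).
    move=> j; rewrite !mxE; apply: inAN; apply: inA_sum => i; exact: inAM.
  rewrite vE !scalerN scalerA [q ^+ N * q]mulrC -scalerA scalemxAl gE -scalemxAl scalerA.
  by rewrite exprS.
apply/rowP => j; rewrite mxE.
have : q ^+ N * v 0 j = 0.
  apply: val0_divisible => // k; have [g gA gE] := div k; exists (g 0 j) => //.
  by have := congr1 (fun u : 'rV_n => u 0 j) gE; rewrite !mxE.
by move/eqP; rewrite mulf_eq0 expf_eq0 (negbTE q_neq0) andbF /= => /eqP.
Qed.

Lemma exists_bounds w : exists lo hi, all (between lo hi) w.
Proof.
elim: w => [|k w [lo [hi bw]]]; first by exists 0, 0.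
exists (Num.min lo k.1), (Num.max hi k.1); rewrite /= /between; apply/andP; split; first by lia.
by apply: sub_all bw => k'; rewrite /between; lia.
Qed.

Definition normal_comb n (l : lvec) : Prop :=
  List.Forall (fun p => size p.2 = n /\ normal_word p.2) l.

Lemma inNn_sum n (I : finType) (c : I -> K) (f : I -> lvec) : (forall i, inNn n (f i)) ->
  inNn n (flatten [seq lscale (c i) (f i) | i <- index_enum I]).
Proof.
move=> fN; elim: (index_enum I) => [|i s IH] /=; first exact: inNn_nil.
by apply: inNn_cat IH; exact: inNn_scale.
Qed.

Lemma lsum_flatten I (s : seq I) (c : I -> K) (f : I -> lvec) phi :
  lsum (flatten [seq lscale (c i) (f i) | i <- s]) phi = \sum_(i <- s) c i * lsum (f i) phi.
Proof.
elim: s => [|i s IH]; first by rewrite big_nil.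
by rewrite big_cons /= lsum_cat lsum_scale IH.
Qed.

(* Modulo q the relations express every word of the finite set X through normal
   words, so the system they form is invertible (Nakayama). *)
Lemma normal_span w : exists L,
  inNn (size w) ((1, w) :: lscale (-1) L) /\ normal_comb (size w) L.
Proof.
have [lo [hi bw]] := exists_bounds w.
set n := size w; have w_n : size w = n by [].
have [X [uX XE]] := fin_words lo hi n.
pose M := size X; pose W (i : 'I_M) := nth [::] X i.
have WX i : W i \in X by apply: mem_nth.
have st (i : 'I_M) : exists lr : lvec * lvec,
    [/\ inNn n ((1, W i) :: lr.1 ++ lscale q lr.2), sim_comb lo hi (W i) lr.2 & normal_comb n
      lr.1].
  have := WX i; rewrite XE => /andP[/eqP sW bW].
  have [l [r [rN rP lP]]] := straighten bW; exists (l, r); split=> //; first by rewrite -sW.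
  case: lP => [->|[c [b [-> _ bs bp [sb _ _ _]]]]]; constructor; last by constructor.
  rewrite /= sb sW; split=> //; rewrite /normal_word wdK // size_map.
  by rewrite (perm_size bp) size_bd.
have [lr lrP] := fin_all_exists st.
pose T : 'M[K]_M := \matrix_(i, j) coef (lr i).2 (W j).
have rE i phi : lsum (lr i).2 phi = \sum_j T i j * phi (W j).
  rewrite (lsum_coef _ uX); last first.
    move=> u /mapP[p pr ->]; have [_ rP _] := lrP i.
    have : List.Forall (fun p => p.2 \in X) (lr i).2.
      apply: List.Forall_impl rP => p' [_ [sp _ _ bp]].
      have := WX i; rewrite !XE => /andP[/eqP sW _].
      by rewrite sp sW eqxx.
    move: pr; elim: (lr i).2 => //= a r IH; rewrite inE => /orP[/eqP->|/IH h] H.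
      exact: List.Forall_inv H.
    by apply: h; exact: List.Forall_inv_tail H.
  rewrite (big_nth [::]) big_mkord; apply: eq_bigr => j _; by rewrite mxE.
have TA i j : inA (T i j).
  rewrite mxE; have [_ rP _] := lrP i; rewrite coef_lsumE.
  elim: rP => [|p r [pA _] _ IH]; first exact: (inA_nat 0).
  by rewrite lsum_cons; apply: inAD IH; apply: inAM => //; exact: inA_nat.
have Bu := nakayama_unit TA; set B := 1%:M + q *: T in Bu.
have wX : w \in X by rewrite XE w_n eqxx.
have [i0 wE] : exists i0 : 'I_M, W i0 = w.
  have iX : (index w X < M)%N by rewrite index_mem.
  by exists (Ordinal iX); rewrite /W nth_index.
(* Relation k says that row k of B, applied to the words of X, plus its normal part vanishes modulo
   N_n. Row i0 of the inverse of B solves this system for w. *)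
exists (flatten [seq lscale (- invmx B i0 k) (lr k).1 | k <- index_enum 'I_M]); split; last first.
  elim: (index_enum 'I_M) => [|k s IH] /=; first by constructor.
  apply/List.Forall_app; split=> //.
  have [_ _] := lrP k; elim=> [|p l pP _ IHl] /=; by constructor.
have lrN k : inNn n ((1, W k) :: (lr k).1 ++ lscale q (lr k).2) by have [] := lrP k.
have := inNn_sum (invmx B i0) lrN.
apply: inNn_eqv => phi; rewrite lsum_cons lsum_scale !lsum_flatten mul1r.
under eq_bigr => k _ do rewrite lsum_cons lsum_cat lsum_scale rE /= mul1r.
have eBk k : phi (W k) + q * (\sum_j T k j * phi (W j)) = \sum_j B k j * phi (W j).
  rewrite mulr_sumr.
  have Bkj j : B k j = (k == j)%:R + q * T k j by rewrite !mxE.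
  under [RHS]eq_bigr => j _ do rewrite Bkj mulrDl -mulrA.
  rewrite big_split /= [X in _ = X + _](bigD1 k) //= eqxx mul1r.
  rewrite [X in _ = _ + X + _]big1 ?addr0 // => j jk.
  by rewrite eq_sym (negbTE jk) mul0r.
under eq_bigr => k _ do rewrite addrCA addrC eBk mulrDr.
rewrite big_split /=; congr (_ + _); last first.
  by rewrite mulN1r -sumrN; apply: eq_bigr => k _; rewrite mulNr opprK.
under eq_bigr => k _ do rewrite mulr_sumr.
rewrite exchange_big /=.
under eq_bigr => j _ do under eq_bigr => k _ do rewrite mulrA.
under eq_bigr => j _ do rewrite -mulr_suml.
have VB j : \sum_k invmx B i0 k * B k j = (i0 == j)%:R.
  by have := congr1 (fun A : 'M_M => A i0 j) (mulVmx Bu); rewrite !mxE.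
under eq_bigr => j _ do rewrite VB.
rewrite (bigD1 i0) //= eqxx mul1r wE big1 ?addr0 // => j ji.
by rewrite eq_sym (negbTE ji) mul0r.
Qed.

(** * Weights of normally ordered wedges *)

Definition adj (k k' : key) : bool := 0 < energy k k'.

Lemma normal_wordE w : normal_word w = sorted adj w.
Proof.
rewrite /normal_word; move: {1}0; elim: w => // k [|k' w] IH e //.
have := IH (e + kap k.2 (map snd (k' :: w))); rewrite /= => ->; congr (_ && _).
by rewrite /adj /energy /kappa /kj; lia.
Qed.

Definition ground (g : gseq) (m : int) (k : nat) : seq key :=
  [seq bgs g (m + Posz i) | i <- iota 0 k].

Lemma groundS g m k : ground g m k.+1 = bgs g m :: ground g (m + 1) k.
Proof.
rewrite /ground /= addr0 (iotaDl 1 0) -map_comp; congr (_ :: _).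
by apply: eq_map => i /=; rewrite -addrA.
Qed.

Lemma size_ground g m k : size (ground g m k) = k.
Proof. by rewrite size_map size_iota. Qed.

Lemma ground_add g m k k' : ground g m (k + k') = ground g m k ++ ground g (m + Posz k) k'.
Proof.
elim: k m => [|k IH] m; first by rewrite addr0.
by rewrite addSn !groundS IH /= -addrA -intS.
Qed.

Lemma odd_absz_succ (m : int) : odd `|(m + 1)%R|%N = ~~ odd `|m|%N.
Proof.
case: m => n; first by have -> : `|(Posz n + 1)%R|%N = n.+1 by lia.
have -> : `|(Negz n + 1)%R|%N = n by lia.
by rewrite /= negbK.
Qed.

Lemma energy_ground g m : energy (bgs g m) (bgs g (m + 1)) = 1.
Proof.
rewrite /bgs odd_absz_succ; case: g; first by case: (odd _); rewrite /energy !kj_mk.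
by rewrite /energy !kj_mk.
Qed.

(** Neighbouring vacuum letters have energy exactly 1, so the shifted exponents of the vacuum form
    an interval without gaps. *)
Lemma bd_ground e g m k :
  bd e (ground g m k) = [seq (bgs g m).1 + e + Posz i | i <- iota 0 k].
Proof.
elim: k e m => // k IH e m; rewrite groundS [bd _ _]/= IH /= addr0; congr (_ :: _).
rewrite (iotaDl 1 0) -map_comp; case: k {IH} => // k.
have En := energy_ground g m.
have -> : kap (bgs g m).2 (map snd (ground g (m + 1) k.+1)) =
    Posz (kappa (kj (bgs g m)) (kj (bgs g (m + 1)))) by rewrite groundS.
apply: eq_map => i; rewrite /comp; move: En; rewrite /energy /kappa.
by move: (kj _) (kj _) (bgs g m).1 (bgs g (m + 1)).1 => *; lia.
Qed.

Lemma bd_cat_cons e u h : exists b e', size b = size u /\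
  forall v, bd e (u ++ h :: v) = b ++ bd e' (h :: v).
Proof.
elim: u e => [|k u IH] e; first by exists [::], e.
case: u IH => [|k' u] IH.
  exists [:: k.1 + e], (e + kap k.2 [:: h.2]); split=> // v.
have [b [e' [sb bE]]] := IH (e + kap k.2 [:: k'.2]).
exists (k.1 + e :: b), e'; split=> [|v]; first by rewrite /= sb.
exact: (congr1 (cons (k.1 + e)) (bE v)).
Qed.

Lemma bd_rcons_eq e w w' h : map snd w = map snd w' -> exists x,
  bd e (rcons w h) = rcons (bd e w) x /\ bd e (rcons w' h) = rcons (bd e w') x.
Proof.
elim: w w' e => [|k w IH] [|k' w'] e // => [_|[kk' ww']].
  by exists (h.1 + e).
have [x [xE xE']] := IH w' (e + kap k.2 (map snd (rcons w h))) ww'.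
exists x; rewrite /= -kk'.
have -> : kap k.2 (map snd (rcons w' h)) = kap k.2 (map snd (rcons w h)) by rewrite !map_rcons
  ww'.
rewrite xE xE'; case: w w' ww' {IH xE xE'} => [|k1 w] [|k1' w'] // [k1E wE].
by rewrite /= k1E.
Qed.

(** The weight of w minus that of the vacuum of equal length is - degE delta - degJ alpha_1. Since
    delta = alpha_0 + alpha_1, the numbers [degE] and [degE + degJ] count the simple roots alpha_0
    and alpha_1 subtracted from the vacuum weight. *)
Definition degE g m w : int := zdeg (ground g m (size w)) - zdeg w.
Definition degJ g m w : int := Posz (jdeg w) - Posz (jdeg (ground g m (size w))).

Lemma degE_nil g m : degE g m [::] = 0. Proof. exact: subrr. Qed.
Lemma degJ_nil g m : degJ g m [::] = 0. Proof. exact: subrr. Qed.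

(* Weights relative to the vacuum that no normally ordered wedge has. *)
Definition forbidden g m w : bool := (degE g m w < 0) || (degE g m w + degJ g m w < 0).

Lemma zdeg_cat u v : zdeg (u ++ v) = zdeg u + zdeg v.
Proof. by rewrite /zdeg big_cat. Qed.

Lemma jdeg_cat u v : jdeg (u ++ v) = (jdeg u + jdeg v)%N.
Proof. by rewrite /jdeg big_cat. Qed.

Lemma forbidden_ground g m u k : forbidden g m (u ++ ground g (m + Posz (size u)) k) =
  forbidden g m u.
Proof.
by rewrite /forbidden /degE /degJ size_cat size_ground ground_add !zdeg_cat !jdeg_cat; lia.
Qed.

Lemma forbidden_same_weight g m lo hi w u : same_weight lo hi w u -> forbidden g m u =
  forbidden g m w.
Proof. by case=> su zu ju _; rewrite /forbidden /degE /degJ su zu ju. Qed.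

Lemma sorted_adj_all (P : key -> bool) w h : P h ->
  (forall k k', adj k k' -> P k' -> P k) -> sorted adj (rcons w h) -> all P w.
Proof.
move=> Ph Pa; elim: w => // k w IH /= kw; have := path_sorted kw => /IH Pw.
rewrite Pw andbT; case: w kw Pw {IH} => [|k' w] /= /andP[kk' _]; first by move=> _; exact: Pa
  kk' Ph.
by move=> /andP[Pk' _]; exact: Pa kk' Pk'.
Qed.

(** Positive energy carries the bound [P] from the closing vacuum letter leftwards to all letters,
    and [P] makes each letter contribute nonnegatively to both counts. *)
Lemma degE_B m w : sorted adj (rcons w (bgs GB (m + Posz (size w)))) ->
  0 <= degE GB m w /\ 0 <= degE GB m w + degJ GB m w.
Proof.
pose P (k : key) := (k.1 <= 0) && ((kj k == 0%N) ==> (k.1 <= -1)).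
move/(@sorted_adj_all P) => aP.
have {aP} : all P w.
  apply: aP; first by rewrite /P kj_mk.
  move=> k k'; rewrite /adj /energy /P; have := kj_lt3 k; have := kj_lt3 k'; lia.
elim: w m => [|k w IH] m /=; first by rewrite degE_nil degJ_nil.
move=> /andP[Pk /(IH (m + 1))]; rewrite /degE /degJ /= groundS.
rewrite /zdeg /jdeg !big_cons -/(zdeg _) -/(zdeg _) -/(jdeg _) -/(jdeg _) kj_mk //.
by move: Pk; rewrite /P /=; lia.
Qed.

(** This vacuum has period two, so letters are compared with it in pairs; a pair of vacuum letters
    has total exponent 1 and index sum 2 whatever the parity of m. Hence the even length. *)
Lemma degE_A m w : ~~ odd (size w) -> sorted adj (rcons w (bgs GA (m + Posz (size w)))) ->
  0 <= degE GA m w /\ 0 <= degE GA m w + degJ GA m w.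
Proof.
pose P (k : key) := k.1 <= Posz (kj k == 2%N).
move=> ow sw; have : all P w.
  apply: sorted_adj_all sw; first by rewrite /P /bgs; case: ifP => _; rewrite kj_mk.
  move=> k k'; rewrite /adj /energy /P; have := kj_lt3 k; have := kj_lt3 k'; lia.
move: ow; have {sw} : sorted adj w by move: sw; rewrite -cats1 => /cat_sorted2[].
have [n] := ubnP (size w); elim: n w m => // n IH [|k [|k' w]] m //=; first by rewrite degE_nil
  degJ_nil.
rewrite !ltnS => wn /andP[kk' k'w]; rewrite negbK => ow /and3P[Pk Pk' Pw].
have [] := IH w (m + 1 + 1) (ltnW wn) (path_sorted k'w) ow Pw.
rewrite /degE /degJ [size [:: _, _ & _]]/= !groundS /zdeg /jdeg !big_cons.
rewrite -/(zdeg _) -/(zdeg w) -/(jdeg _) -/(jdeg w).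
have [E1 E2] : (bgs GA m).1 + (bgs GA (m + 1)).1 = 1 /\
    (kj (bgs GA m) + kj (bgs GA (m + 1)))%N = 2%N.
  by rewrite /bgs odd_absz_succ; case: (odd _); rewrite /= !kj_mk.
move: E1 E2 Pk Pk' kk'; rewrite /P /adj /energy.
have := kj_lt3 k; have := kj_lt3 k'.
move: (bgs GA m).1 (bgs GA (m + 1)).1 (kj (bgs GA m)) (kj (bgs GA (m + 1))) => a a' j j'.
lia.
Qed.

Lemma normal_not_forbidden g m w : ~~ odd (size w) ->
  sorted adj (rcons w (bgs g (m + Posz (size w)))) -> ~~ forbidden g m w.
Proof.
move=> ow sw; rewrite /forbidden negb_or -!leNgt.
by case: g sw => sw; apply/andP; [exact: degE_A | exact: degE_B].
Qed.

(** * Words of forbidden weight vanish in the Fock space *)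

Definition forbidden_comb g m R (y : lvec) : Prop :=
  List.Forall (fun p => [/\ inA p.1, size p.2 = R & forbidden g m p.2]) y.

Definition extend g m R R' (l : lvec) : lvec :=
  [seq (p.1, p.2 ++ ground g (m + Posz R) (R' - R)) | p <- l].

(* At q = 0 the tail of the vacuum occupies all large shifted exponents exactly
   once: sorting a forbidden word followed by a long enough piece of the vacuum
   either meets a repetition or would give a normally ordered word of forbidden
   weight. *)
Lemma forbidden_step g m u : forbidden g m u -> exists R y,
  [/\ (size u <= R)%N, forbidden_comb g m R y &
      inNn R (extend g m (size u) R [:: (1, u)] ++ lscale (- q) y)].
Proof.
move=> fu.
have [b [e [sb bE]]] := bd_cat_cons 0 u (bgs g (m + Posz (size u))).
pose al := (bgs g (m + Posz (size u))).1 + e.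
have tailE k : bd 0 (u ++ ground g (m + Posz (size u)) k.+1) =
    rcons (b ++ [seq al + Posz i | i <- iota 0 k]) (al + Posz k).
  rewrite groundS bE -groundS bd_ground rcons_cat -map_rcons; congr (_ ++ map _ _).
  by rewrite -[k.+1]addn1 iotaD cats1.
have [B Bb] : exists B : nat, all (fun x => x < al + Posz B) b.
  elim: (b) => [|x b' [B bB]]; first by exists 0%N.
  exists (B + `|(x - al)%R| + 1)%N => /=; apply/andP; split; first by lia.
  by apply: sub_all bB => y; lia.
(* [B] puts the next vacuum exponent al + k above all entries of b; the parity term makes the length
   of w even, as [normal_not_forbidden] requires. *)
pose k := (B + odd (size u + B))%N.
pose w := u ++ ground g (m + Posz (size u)) k.
have sw : size w = (size u + k)%N by rewrite size_cat size_ground.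
have ew : ~~ odd (size w) by rewrite sw addnA oddD; case: (odd (size u + B)).
have fw : forbidden g m w by rewrite forbidden_ground.
have [lo [hi bw]] := exists_bounds w.
have [l [r [rN rP lP]]] := straighten bw.
have rgood : forbidden_comb g m (size w) (lscale (-1) r).
  elim: rP => [|p r' [pA pw] _ IH]; constructor => //=; split.
  - by apply: inAM => //; exact: inAN (inA_nat 1).
  - by case: pw.
  - by rewrite (forbidden_same_weight _ _ pw).
have wE : extend g m (size u) (size w) [:: (1, u)] = [:: (1, w)].
  by rewrite /extend /= sw addKn.
case: lP => [l0|[c [b' [_ _ b's b'p b'w]]]].
  exists (size w), (lscale (-1) r); split=> //; first by rewrite sw leq_addr.
  rewrite wE; apply: inNn_eqv rN => phi; rewrite l0 cat0s lsum_cat !lsum_cons !lsum_scale [lsum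
    [::] _]/=; ring.
(* The next vacuum letter adds the same shifted exponent x to w and to its sorted form w', and x
   exceeds all others. So w' followed by this letter is normally ordered, which its weight
   excludes. *)
exfalso; set w' := wd 0 _ _ in b'w.
have sb' : size (map snd w) = size b' by rewrite size_map (perm_size b'p) size_bd.
have [x [xE x'E]] := @bd_rcons_eq 0 w w' (bgs g (m + Posz (size w))) (esym (wd_js 0 sb')).
have [sw' _ _ _] := b'w.
have : ~~ forbidden g m w'.
  apply: normal_not_forbidden; rewrite sw' //.
  rewrite -normal_wordE /normal_word x'E wdK //.
  have wk : rcons w (bgs g (m + Posz (size w))) = u ++ ground g (m + Posz (size u)) k.+1.
    rewrite -[k.+1]addn1 ground_add catA -/w -cats1 sw PoszD addrA.
    by rewrite groundS.
  move: xE; rewrite wk tailE => /rcons_inj[bwE xE].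
  have ltx : all (fun y => y < x) b'.
    rewrite (perm_all _ b'p) -bwE all_cat; apply/andP; split.
      by apply: sub_all Bb => y; rewrite -xE /k; lia.
    by apply/allP => z /mapP[i]; rewrite mem_iota => ik ->; rewrite -xE; lia.
  case: b' b's ltx {b'p b'w w' x'E sw' sb'} => // a b' b's ltx.
  rewrite /= rcons_path; apply/andP; split; first exact: b's.
  by apply: (allP ltx); exact: mem_last.
by rewrite (forbidden_same_weight _ _ b'w) fw.
Qed.

Lemma ground_split g m k R R' : (k <= R)%N -> (R <= R')%N ->
  ground g (m + Posz k) (R - k) ++ ground g (m + Posz R) (R' - R) = ground g (m + Posz k) (R' -
    k).
Proof.
move=> kR RR'; have -> : (R' - k = (R - k) + (R' - R))%N by lia.
by rewrite ground_add -addrA -PoszD subnKC.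
Qed.

Lemma extend_extend g m k R R' l : (k <= R)%N -> (R <= R')%N ->
  extend g m R R' (extend g m k R l) = extend g m k R' l.
Proof.
move=> kR RR'; rewrite /extend -map_comp; apply: eq_map => p /=.
by rewrite -catA ground_split.
Qed.

Lemma extend_cat g m R R' l l' : extend g m R R' (l ++ l') = extend g m R R' l ++ extend g m R
  R' l'.
Proof. exact: map_cat. Qed.

Lemma extend_scale g m R R' c l : extend g m R R' (lscale c l) = lscale c (extend g m R R' l).
Proof. by rewrite /extend /lscale -!map_comp. Qed.

Lemma extend_id g m R l : extend g m R R l = l.
Proof.
by rewrite /extend subnn /ground /=; elim: l => //= -[c w] l ->; rewrite cats0.
Qed.

Lemma inNn_extend g m R R' l : (R <= R')%N -> inNn R l -> inNn R' (extend g m R R' l).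
Proof.
move=> RR' /(inNn_suffix (ground g (m + Posz R) (R' - R))).
by rewrite size_ground subnKC.
Qed.

Lemma forbidden_comb_extend g m R R' l : (R <= R')%N -> forbidden_comb g m R l ->
  forbidden_comb g m R' (extend g m R R' l).
Proof.
move=> RR'; elim=> [|p {}l [pA pR pf] _ IH]; constructor => //=; split=> //.
  by rewrite size_cat size_ground pR subnKC.
by rewrite -pR forbidden_ground.
Qed.

Lemma forbidden_comb_scale g m R c l : inA c -> forbidden_comb g m R l -> forbidden_comb g m R
  (lscale c l).
Proof.
by move=> cA; elim=> [|p {}l [pA pR pf] _ IH]; constructor=> //=; split=> //; exact: inAM.
Qed.

Lemma forbidden_step_comb g m R y : forbidden_comb g m R y -> exists R' y',
  [/\ (R <= R')%N, forbidden_comb g m R' y' & inNn R' (extend g m R R' y ++ lscale (- q) y')].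
Proof.
elim=> [|[c u] {}y [/= cA uR uf] _ [R1 [y1 [RR1 y1g y1N]]]].
  by exists R, [::]; split; [exact: leqnn | constructor | exact: inNn_nil].
have [R2 [y2 [uR2 y2g y2N]]] := forbidden_step uf; rewrite uR in uR2 y2N.
pose R' := maxn R1 R2; have R1R' : (R1 <= R')%N := leq_maxl _ _.
have R2R' : (R2 <= R')%N := leq_maxr _ _.
exists R', (lscale c (extend g m R2 R' y2) ++ extend g m R1 R' y1); split.
- exact: leq_trans R1R'.
- by apply/List.Forall_app; split; [apply: forbidden_comb_scale => //|]; exact:
    forbidden_comb_extend.
have := inNn_cat (inNn_scale c (inNn_extend g m R2R' y2N)) (inNn_extend g m R1R' y1N).
rewrite !extend_cat !extend_scale !extend_extend //; apply: inNn_eqv => phi.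
rewrite !(lsum_cat, lsum_scale, lsum_cons) /=.
by move: (lsum (extend _ _ _ _ y) _) (lsum (extend _ _ _ _ y1) _) (lsum _ _) => *; ring.
Qed.

(* l, at level R, represents an element of the intersection of the q^n L. *)
Definition vanishing g m R (l : lvec) : Prop := forall n, exists R' y,
  [/\ (R <= R')%N, lattice_comb R' y & inNn R' (extend g m R R' l ++ lscale (- q ^+ n) y)].

(** The remainder after one step is again forbidden, so steps can be chained, each gaining a factor
    q. *)
Lemma forbidden_vanishing g m u : forbidden g m u -> vanishing g m (size u) [:: (1, u)].
Proof.
move=> fu n.
suff [R' [y [uR' yg yN]]] : exists R' y, [/\ (size u <= R')%N, forbidden_comb g m R' y &
    inNn R' (extend g m (size u) R' [:: (1, u)] ++ lscale (- q ^+ n) y)].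
  exists R', y; split=> //.
  by apply: List.Forall_impl yg => p [].
elim: n => [|n [R1 [y1 [uR1 y1g y1N]]]].
  exists (size u), [:: (1, u)]; split=> //.
    by constructor; [split=> //; exact: (inA_nat 1) | constructor].
  rewrite extend_id expr0; apply: inNn_eqv (inNn_nil _) => phi.
  by rewrite lsum_cat lsum_scale mulN1r subrr.
have [R' [y' [R1R' y'g y'N]]] := forbidden_step_comb y1g.
exists R', y'; split=> //; first exact: leq_trans R1R'.
have := inNn_cat (inNn_extend g m R1R' y1N) (inNn_scale (q ^+ n) y'N).
rewrite extend_cat extend_scale extend_extend //; apply: inNn_eqv => phi.
rewrite !(lsum_cat, lsum_scale) exprSr.
by move: (lsum _ _) (lsum _ _) (lsum _ _) (q ^+ n) => *; ring.
Qed.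

(** * Spanning *)

Lemma lattice_extend g m R R' l : (R <= R')%N -> lattice_comb R l ->
  lattice_comb R' (extend g m R R' l).
Proof.
move=> RR'; elim=> [|p {}l [pA pR] _ IH]; constructor => //=; split=> //.
by rewrite size_cat size_ground pR subnKC.
Qed.

Lemma vanishing_eqv g m R l l' : leqv l l' -> vanishing g m R l -> vanishing g m R l'.
Proof.
move=> ll' lV n; have [R' [y [RR' yL yN]]] := lV n; exists R', y; split=> //.
apply: inNn_eqv yN => phi; rewrite !lsum_cat; congr (_ + _).
by rewrite /extend !(lsum_map (fun w => w ++ _)) ll'.
Qed.

Lemma vanishing_inNn g m R l : inNn R l -> vanishing g m R l.
Proof.
move=> lN n; exists R, [::]; split; [exact: leqnn | by constructor |].
by rewrite cats0 extend_id.
Qed.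

Lemma vanishing_cat g m R l l' :
  vanishing g m R l -> vanishing g m R l' -> vanishing g m R (l ++ l').
Proof.
move=> lV lV' n; have [R1 [y1 [RR1 y1L y1N]]] := lV n; have [R2 [y2 [RR2 y2L y2N]]] := lV' n.
pose R' := maxn R1 R2; have R1R' : (R1 <= R')%N := leq_maxl _ _.
have R2R' : (R2 <= R')%N := leq_maxr _ _.
exists R', (extend g m R1 R' y1 ++ extend g m R2 R' y2); split.
- exact: leq_trans R1R'.
- by apply: lattice_cat; exact: lattice_extend.
have := inNn_cat (inNn_extend g m R1R' y1N) (inNn_extend g m R2R' y2N).
rewrite !extend_cat !extend_scale !extend_extend //; apply: inNn_eqv => phi.
rewrite !(lsum_cat, lsum_scale).
by move: (lsum _ _) (lsum _ _) (lsum _ _) (lsum _ _) (q ^+ n) => *; ring.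
Qed.

(** A pole of c at q = 0 is paid for by asking divisibility by a higher power of q. *)
Lemma vanishing_scale g m R c l : vanishing g m R l -> vanishing g m R (lscale c l).
Proof.
move=> lV n; have [v cA] := clear_denominator c.
have [R' [y [RR' yL yN]]] := lV (n + v)%N.
exists R', (lscale (q ^+ v * c) y); split=> //; first exact: lattice_scale.
apply: inNn_eqv (inNn_scale c yN) => phi.
rewrite extend_scale !(lsum_cat, lsum_scale) exprD.
by move: (lsum _ _) (lsum _ _) (q ^+ n) (q ^+ v) => *; ring.
Qed.

Lemma vanishing_prefix g m t R l : vanishing g (m + Posz (size t)) R l ->
  vanishing g m (size t + R) [seq (p.1, t ++ p.2) | p <- l].
Proof.
move=> lV n; have [R' [y [RR' yL yN]]] := lV n.
exists (size t + R')%N, [seq (p.1, t ++ p.2) | p <- y]; split.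
- by rewrite leq_add2l.
- by elim: yL {yN} => [|p {}y [pA pR] _ IH]; constructor=> //=; rewrite size_cat pR.
apply: inNn_eqv (inNn_prefix t yN) => phi.
rewrite (lsum_map (cat t)) !lsum_cat !lsum_scale (lsum_map (cat t)); congr (_ + _).
rewrite /extend -map_comp (lsum_map (fun w => w ++ _)).
rewrite (lsum_map (fun w => (t ++ w) ++ ground g (m + Posz (size t + R)) (size t + R' - (size t
  + R)))).
by apply: eq_lsum => w /=; rewrite subnDl PoszD addrA catA.
Qed.

Lemma forbidden_letter g n x : energy x (bgs g (n + 1)) <= 0 -> forbidden g n [:: x].
Proof.
rewrite /forbidden /degE /degJ groundS /zdeg /jdeg !big_cons !big_nil addr0 !addn0.
rewrite /energy /bgs odd_absz_succ; have := kj_lt3 x.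
by case: g; [case: (odd _) => /=|]; rewrite !kj_mk //=; move: (kj x) x.1 => j a; lia.
Qed.

(** Only the junction with the vacuum can fail. If it does, the last letter alone has forbidden
    weight relative to its position, so it vanishes there, and prefixing the other letters preserves
    this. *)
Lemma normal_word_cases g m w : normal_word w ->
  (exists c, normal_seq g m c (size w) /\ map c (iota 0 (size w)) = w) \/
  vanishing g m (size w) [:: (1, w)].
Proof.
rewrite normal_wordE => ws.
have extends : (forall i, (i.+1 = size w)%N -> adj (nth v0key w i) (bgs g (m + Posz (size w)))) ->
    exists c, normal_seq g m c (size w) /\ map c (iota 0 (size w)) = w.
  move=> jw; exists (fun i => nth (bgs g (m + Posz i)) w i); split; last first.
    apply: (@eq_from_nth _ v0key); rewrite size_map size_iota // => i iw.
    by rewrite (nth_map 0%N) ?size_iota // nth_iota // add0n (set_nth_default v0key).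
  split=> [i wi|i]; first by rewrite nth_default.
  have [wi|iw] := leqP (size w) i.
    rewrite !nth_default //; last exact: leqW.
    by rewrite -addn1 PoszD addrA energy_ground.
  rewrite (set_nth_default v0key) //.
  have [wi|i1w] := leqP (size w) i.+1.
    have e : i.+1 = size w by apply/eqP; rewrite eqn_leq iw.
    by rewrite [X in energy _ X]nth_default // e; exact: jw.
  rewrite [X in energy _ X](set_nth_default v0key) //.
  by move/(sortedP v0key): ws; exact.
case/lastP: w ws extends => [|w x] ws extends; first by left; apply: extends.
have [jx|/negbTE jx] := boolP (adj x (bgs g (m + Posz (size w).+1))).
  by left; apply: extends => i; rewrite size_rcons => -[->]; rewrite nth_rcons ltnn eqxx.
right; have fx : forbidden g (m + Posz (size w)) [:: x].
  by apply: forbidden_letter; rewrite -addrA -PoszD addn1 leNgt -/(adj _ _) jx.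
have := vanishing_prefix (forbidden_vanishing fx).
by rewrite /= addn1 cats1 size_rcons.
Qed.

Notation wedge_data := (seq (K * (nat -> key) * nat)).

Definition word_rep (R : nat) (l : wedge_data) : lvec :=
  [seq (p.1.1, map p.1.2 (iota 0 R)) | p <- l].

Definition wedges_at g m R (l : wedge_data) : Prop :=
  List.Forall (fun p => normal_seq g m p.1.2 p.2 /\ p.2 = R) l.

Definition scale_data (c : K) (l : wedge_data) : wedge_data :=
  [seq ((c * p.1.1, p.1.2), p.2) | p <- l].

Lemma word_rep_scale R c l : word_rep R (scale_data c l) = lscale c (word_rep R l).
Proof. by rewrite /word_rep /scale_data /lscale -!map_comp. Qed.

Lemma wedges_at_scale g m R c l : wedges_at g m R l -> wedges_at g m R (scale_data c l).
Proof. by elim=> [|p {}l [pn pR] _ IH]; constructor. Qed.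

Lemma normal_comb_span g m R L : normal_comb R L -> exists l,
  wedges_at g m R l /\ vanishing g m R (L ++ lscale (-1) (word_rep R l)).
Proof.
elim=> [|[c w] {}L [/= wR wn] _ [l [lW lV]]].
  by exists [::]; split; [constructor | exact: vanishing_inNn (inNn_nil _)].
case: (normal_word_cases g m wn); rewrite wR.
  move=> [f [fn fw]]; exists (((c, f), R) :: l); split; first by constructor.
  apply: vanishing_eqv lV => phi.
  have -> : word_rep R ((c, f, R) :: l) = (c, w) :: word_rep R l by rewrite -fw.
  rewrite lsum_cons !lsum_cat !lsum_scale lsum_cons /=.
  by move: (phi w) (lsum _ _) (lsum _ _) => *; ring.
move=> wV; exists l; split=> //.
apply: vanishing_eqv (vanishing_cat (vanishing_scale c wV) lV) => phi.
by rewrite lsum_cat lsum_scale lsum_single lsum_cons.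
Qed.

Lemma word_span g m w : exists l, wedges_at g m (size w) l /\
  vanishing g m (size w) ((1, w) :: lscale (-1) (word_rep (size w) l)).
Proof.
have [L [LN Ln]] := normal_span w; have [l [lW lV]] := normal_comb_span g m Ln.
exists l; split=> //; apply: vanishing_eqv (vanishing_cat (vanishing_inNn g m LN) lV) => phi.
rewrite !(lsum_cat, lsum_cons, lsum_scale).
by move: (phi _) (lsum _ _) (lsum _ _) => *; ring.
Qed.

Lemma lvec_span g m R L : words_of_size R L -> exists l,
  wedges_at g m R l /\ vanishing g m R (L ++ lscale (-1) (word_rep R l)).
Proof.
elim: L => [|[c w] L IH] LR.
  by exists [::]; split; [constructor | exact: vanishing_inNn (inNn_nil _)].
have /andP[/eqP /= wR {}LR] := LR.
have [l [lW lV]] := IH LR; have [l' []] := word_span g m w; rewrite wR => lW' lV'.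
exists (scale_data c l' ++ l); split.
  by apply/List.Forall_app; split=> //; exact: wedges_at_scale.
apply: vanishing_eqv (vanishing_cat (vanishing_scale c lV') lV) => phi.
have -> : word_rep R (scale_data c l' ++ l) = lscale c (word_rep R l') ++ word_rep R l.
  by rewrite -word_rep_scale -map_cat.
rewrite !(lsum_cat, lsum_cons, lsum_scale) /=.
by move: (phi _) (lsum _ _) (lsum _ _) (lsum _ _) => *; ring.
Qed.

Lemma vtailE g m r k : vtail g m r k = ground g (m + Posz r) k.
Proof. by apply: eq_map => i; rewrite PoszD addrA. Qed.

(** One list at level R must serve all higher levels, because the level at which vanishing is seen
    depends on n. *)
Lemma evalF_inVr g m R (t : fterm) : List.Forall (fun p => inVr p.2.1 p.2.2) t ->
  levels_le R t -> exists L, words_of_size R L /\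
  forall R', (R <= R')%N -> veq (evalF g m R' t) (coef (extend g m R R' L)).
Proof.
elim=> [|[c [r u]] {}t [lu [lur uE]] _ IH].
  by move=> _; exists [::]; split=> // R' _ s; rewrite coef_lsumE.
move=> /andP[/= rR /IH[L [LR LE]]].
exists (lscale c (extend g m r R lu) ++ L); split.
  rewrite /words_of_size all_cat -/(words_of_size R L) LR andbT !all_map.
  by apply: sub_all lur => p /= /eqP pr; rewrite size_cat size_ground pr subnKC.
move=> R' RR' s; rewrite /evalF /= /vadd -/(evalF g m R' t s) LE //.
rewrite extend_cat extend_scale extend_extend // coef_cat coef_scale /vscale; congr (c * _ + _).
rewrite (lift_veq _ _ _ _ uE) lift_coef //; congr (coef _ s).
by apply: eq_map => p; rewrite vtailE.
Qed.

Lemma exists_level (t : fterm) : exists R, levels_le R t.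
Proof.
elim: t => [|p t [R tR]]; first by exists 0%N.
exists (maxn p.2.1 R); rewrite /levels_le /= leq_maxl /=.
by apply: sub_all tR => x /leq_trans; apply; exact: leq_maxr.
Qed.

Lemma levels_leW R R' t : (R <= R')%N -> levels_le R t -> levels_le R' t.
Proof. by move=> RR'; apply: sub_all => x /leq_trans; exact. Qed.

Lemma evalF_cat g m R t t' s : evalF g m R (t ++ t') s = evalF g m R t s + evalF g m R t' s.
Proof. by rewrite /evalF map_cat vsum_cat. Qed.

Lemma evalF_scale g m R c t s : evalF g m R (scaleF c t) s = c * evalF g m R t s.
Proof.
elim: t => [|p t IH]; first by rewrite mulr0.
rewrite -[LHS]/(c * p.1 * Defs.lift g m p.2.1 R p.2.2 s + evalF g m R (scaleF c t) s).
by rewrite IH -mulrA -mulrDr.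
Qed.

Lemma levels_scaleF R c t : levels_le R (scaleF c t) = levels_le R t.
Proof. by rewrite /levels_le all_map. Qed.

Lemma wedges_span_Fock g m (t : fterm) : List.Forall (fun p => inVr p.2.1 p.2.2) t ->
  exists l, List.Forall (fun p => normal_seq g m p.1.2 p.2) l /\ Fock_eq g m t (wterm l).
Proof.
move=> tV; have [R tR] := exists_level t.
have [L [LR LE]] := evalF_inVr g m tV tR.
have [l [lW lV]] := lvec_span g m LR.
have ln : List.Forall (fun p => normal_seq g m p.1.2 p.2) l.
  by apply: List.Forall_impl lW => p [].
have lR : levels_le R (wterm l).
  elim: lW {lV ln} => //= p {}l [_ pR] _; rewrite /levels_le /= pR leqnn.
  by [].
exists l; split=> // n _; have [R' [y [RR' yL yN]]] := lV n.
(* The lattice element is a single term at level R', so its lift to that level adds no vacuum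
   letters. *)
exists [:: (1, (R', coef y))]; split.
  by constructor; [split; [exact: (inA_nat 1) | exists y] | constructor].
exists R'; split.
  rewrite /levels_le all_cat -/(levels_le R' t) (levels_leW RR' tR).
  by rewrite -/(levels_le R' (scaleF (-1) (wterm l))) levels_scaleF (levels_leW RR' lR).
split; first by rewrite /levels_le /= leqnn.
have yR : words_of_size R' y by elim: yL {yN} => //= p {}y [_ ->] _; rewrite eqxx.
have repE : extend g m R R' (word_rep R l) = word_rep R' l.
  elim: lW {lV ln lR yN} => //= p {}l [[cg _] pR] _ ->; congr ((_, _) :: _).
  rewrite -{2}(subnKC RR') iotaD map_cat add0n; congr (_ ++ _).
  have -> : iota R (R' - R) = map (addn R) (iota 0 (R' - R)) by rewrite -iotaDl addn0.
  rewrite -map_comp; apply: eq_map => i /=.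
  by rewrite cg ?pR ?leq_addr // PoszD addrA.
apply: Nn_veq yN => s.
rewrite extend_cat extend_scale repE !coef_cat !coef_scale /vadd /vscale.
rewrite evalF_cat !evalF_scale LE // (evalF_wterm ln (levels_leW RR' lR)).
rewrite -/(word_rep R' l) /evalF /= /vadd /vscale addr0 mul1r lift_coef //.
rewrite subnn; have -> : [seq (p.1, p.2 ++ vtail g m R' 0) | p <- y] = y.
  by elim: (y) => //= -[c w] y' ->; rewrite cats0.
by congr (_ + _); rewrite mulNr mulN1r.
Qed.

Theorem mainTheorem7 (g : gseq) (m : int) :
  (* linear independence in F_m of the normally ordered wedges
     (indexed by pairwise distinct normally ordered sequences) *)
  (forall l : seq (K * (nat -> key) * nat),
     List.Forall (fun p => normal_seq g m p.1.2 p.2) l ->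
     (forall i j : nat, (i < size l)%N -> (j < size l)%N -> i <> j ->
        exists k : nat,
          (nth (0, (fun _ => v0key), 0%N) l i).1.2 k <>
          (nth (0, (fun _ => v0key), 0%N) l j).1.2 k) ->
     Fock_zero g m (wterm l) ->
     List.Forall (fun p => p.1.1 = 0) l)
  /\
  (* spanning: every element of F_m is a finite linear combination *)
  (forall t : fterm,
     List.Forall (fun p => inVr p.2.1 p.2.2) t ->
     exists l : seq (K * (nat -> key) * nat),
       List.Forall (fun p => normal_seq g m p.1.2 p.2) l /\
       Fock_eq g m t (wterm l)).
Proof.
split; [exact: normal_wedges_independent | exact: wedges_span_Fock].
Qed.
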